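(* Let $A = L_0^{\infty}(w)^*$ with the first Arens product, let $\theta : A \to A$ be an algebra homomorphism, and let $(D,d)$ be a $\theta$-generalized derivation on $A$. Then the following statements hold. (i) $D$ maps $\mathrm{ran}(A)$ into $\mathrm{ran}(A)$. (ii) $D$ is $\theta$-centralizing if and only if $D$ is $\theta$-commuting. (iii) If $\theta$ is an isomorphism and $D$ is $\theta$-centralizing, then $D$ is a $\theta$-right centralizer.
   Context: Let $w:[0,\infty)\to[1,\infty)$ be a continuous function with $w(0)=1$ and $w(x+y)\le w(x)w(y)$ for all $x,y\ge 0$. $L^1(w)$ is the Banach space (a Banach algebra under convolution) of (classes of) Lebesgue measurable complex functions $\varphi$ on $[0,\infty)$ with $\int_0^\infty |\varphi(x)|w(x)\,dx<\infty$. $L_0^{\infty}(w)$ is the Banach space of (a.e.-classes of) Lebesgue measurable complex functions $f$ on $[0,\infty)$ with $\|f\|=\operatorname{ess\,sup}_{y\ge 0}|f(y)|/w(y)<\infty$ and $\operatorname{ess\,sup}\{|f(y)|\chi_{(x,\infty)}(y)/w(y): y\ge 0\}\to 0$ as $x\to+\infty$. Its dual $A=L_0^{\infty}(w)^*$ is a Banach algebra under the first Arens product: for $m,n\in A$, $f\in L_0^{\infty}(w)$, $\varphi\in L^1(w)$, put $(f\varphi)(x)=\int_0^\infty f(x+y)\varphi(y)\,dy$; let $nf\in L_0^\infty(w)$ be the element determined by $\int_0^\infty (nf)(x)\varphi(x)\,dx = n(f\varphi)$ for all $\varphi\in L^1(w)$; and set $(mn)(f)=m(nf)$. $Z(A)$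 is the center of $A$. The right annihilator is $\mathrm{ran}(A)=\{r\in A: mr=0 \text{ for all } m\in A\}$. ''Isomorphism on $A$'' means a bijective algebra homomorphism $A\to A$. All maps $D,d,T$ below are linear (no continuity is assumed). For a homomorphism $\theta$ on $A$: a linear map $d:A\to A$ is a $\theta$-derivation if $d(mn)=d(m)\theta(n)+\theta(m)d(n)$ for all $m,n\in A$. A $\theta$-generalized derivation $(D,d)$ is a linear map $D:A\to A$ together with an associated $\theta$-derivation $d$ such that $D(mn)=\theta(m)D(n)+d(m)\theta(n)$ for all $m,n\in A$. A linear map $T:A\to A$ is a $\theta$-right centralizer if $T(mn)=\theta(m)T(n)$ for all $m,n\in A$; it is $\theta$-commuting if $T(m)\theta(m)=\theta(m)T(m)$ for all $m\in A$; it is $\theta$-centralizing if $[T(m),\theta(m)]:=T(m)\theta(m)-\theta(m)T(m)\in Z(A)$ for all $m\in A$. *)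

(* Defs.v *)
From HB Require Import structures.
From mathcomp Require Import all_boot all_order all_algebra.
From mathcomp Require Import all_classical all_reals all_analysis.
From mathcomp Require Import measurable_realfun ess_sup_inf complex.

Set Implicit Arguments.
Unset Strict Implicit.
Unset Printing Implicit Defensive.

Import Order.TTheory GRing.Theory Num.Theory.
Import numFieldNormedType.Exports.
Import ComplexField.Normc.

Local Open Scope classical_set_scope.
Local Open Scope ring_scope.

Record weight (R : realType) := Weight {
  weight_fun :> R -> R ;
  weight_cont : {within `[0, +oo[, continuous weight_fun} ;
  weight_ge1 : forall x, 0 <= x -> 1 <= weight_fun x ;
  weight0 : weight_fun 0 = 1 ;
  weightD : forall x y, 0 <= x -> 0 <= y ->
    weight_fun (x + y) <= weight_fun x * weight_fun y }.

(* A function on [0, +oo[ is encoded by a function on R whose values on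
   negative reals are irrelevant. Measurability is Borel measurability; every
   Lebesgue measurable function is a.e. equal to a Borel one, so the spaces of
   a.e.-classes are the same. *)
Section functions_on_halfline.
Context {R : realType}.
Implicit Types f : R -> R[i].

Definition halfline : set R := `[0, +oo[%classic.

Definition cmeasurable f :=
  measurable_fun halfline (fun x => complex.Re (f x)) /\
  measurable_fun halfline (fun x => complex.Im (f x)).

Definition cintegral f : R[i] :=
  Complex (\int[lebesgue_measure]_(x in halfline) complex.Re (f x))
          (\int[lebesgue_measure]_(x in halfline) complex.Im (f x)).

End functions_on_halfline.

Section spaces.
Context {R : realType}.
Variable w : weight R.
Implicit Types f : R -> R[i].

Definition L1_pred : {pred R -> R[i]} := mem [set f |
  cmeasurable f /\
  (\int[lebesgue_measure]_(x in halfline) (normc (f x) * w x)%:E < +oo)%E].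

(* the essential supremum of |f| / w over E, for E included in the half-line *)
Definition wess_sup (E : set R) f : \bar R :=
  ess_sup lebesgue_measure (fun y => (normc (f y) * \1_E y / w y)%:E).

Definition L0inf_pred : {pred R -> R[i]} := mem [set f |
  [/\ cmeasurable f,
      (wess_sup halfline f < +oo)%E &
      wess_sup (halfline `&` `]x, +oo[) f @[x --> +oo%R] --> 0%E]].

End spaces.

Record L1 (R : realType) (w : weight R) := MkL1 {
  L1_fun :> R -> R[i] ; _ : L1_fun \in L1_pred w }.

Record L0inf (R : realType) (w : weight R) := MkL0inf {
  L0inf_fun :> R -> R[i] ; _ : L0inf_fun \in L0inf_pred w }.

HB.instance Definition _ (R : realType) (w : weight R) :=
  [isSub for @L1_fun R w].
HB.instance Definition _ (R : realType) (w : weight R) :=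
  [isSub for @L0inf_fun R w].
HB.instance Definition _ (R : realType) (w : weight R) :=
  [Choice of L0inf w by <:].

Section facts.
Context {R : realType}.
Implicit Types (w : weight R) (f g : R -> R[i]).
Local Notation mu := (@lebesgue_measure R).

Lemma normc_ge0 (z : R[i]) : 0 <= normc z.
Proof. by case: z => a b; exact: sqrtr_ge0. Qed.

Lemma weight_gt0 w x : 0 <= x -> 0 < w x.
Proof. by move=> x0; rewrite (lt_le_trans ltr01)// weight_ge1. Qed.

Lemma lebesgue_measureT_gt0 : (0 < mu [set: R])%E.
Proof.
apply: (@lt_le_trans _ _ (mu (`[0, 1]%classic : set R))).
  by rewrite lebesgue_measure_itv/= lte_fin ltr01 oppr0 adde0 lte_fin ltr01.
by apply: le_measure => //; rewrite inE.
Qed.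

Lemma ae_mono (P Q : R -> Prop) : (forall y, P y -> Q y) ->
  (\forall y \ae mu, P y) -> \forall y \ae mu, Q y.
Proof. by apply: filterS; exact: (ae_filter_ringOfSetsType mu). Qed.

Lemma ae_and (P Q : R -> Prop) : (\forall y \ae mu, P y) ->
  (\forall y \ae mu, Q y) -> \forall y \ae mu, P y /\ Q y.
Proof. by apply: filterI; exact: (ae_filter_ringOfSetsType mu). Qed.

Lemma wess_supP w E f M : E `<=` halfline -> 0 <= M ->
  (wess_sup w E f <= M%:E)%E <->
  (\forall y \ae mu, E y -> normc (f y) <= M * w y).
Proof.
move=> EH M0; split.
  move=> /ess_supP; apply: ae_mono => y + Ey.
  rewrite lee_fin indicE mem_set// mulr1 ler_pdivrMr// weight_gt0//.
  by have := EH _ Ey; rewrite /halfline/= in_itv/= andbT.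
move=> H; apply/ess_supP; move: H; apply: ae_mono => y Hy.
rewrite lee_fin indicE; have [/set_mem Ey|_] := boolP (y \in E); last first.
  by rewrite mulr0 mul0r.
rewrite mulr1 ler_pdivrMr ?Hy// weight_gt0//.
by have := EH _ Ey; rewrite /halfline/= in_itv/= andbT.
Qed.

Lemma wess_sup_ge0 w E f : E `<=` halfline -> (0 <= wess_sup w E f)%E.
Proof.
move=> EH; apply: ess_sup_gee; first exact: lebesgue_measureT_gt0.
apply: nearW => y; rewrite lee_fin.
rewrite indicE; have [/set_mem Ey|_] := boolP (y \in E); last first.
  by rewrite mulr0 mul0r.
rewrite mulr1 divr_ge0 ?normc_ge0// ltW// weight_gt0//.
by have := EH _ Ey; rewrite /halfline/= in_itv/= andbT.
Qed.

Lemma tail_sub (x : R) : halfline `&` `]x, +oo[ `<=` halfline.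
Proof. by move=> ? []. Qed.

Lemma L0infP w f : f \in L0inf_pred w <->
  [/\ cmeasurable f,
      exists2 M : R, 0 <= M &
        \forall y \ae mu, halfline y -> normc (f y) <= M * w y &
      forall e : R, 0 < e -> exists2 X : R, 0 <= X &
        \forall y \ae mu, X < y -> normc (f y) <= e * w y].
Proof.
rewrite inE; split.
  move=> [mf bf tf]; split => //.
    exists (fine (wess_sup w halfline f)).
      by rewrite fine_ge0// wess_sup_ge0.
    apply/wess_supP => //; first by rewrite fine_ge0// wess_sup_ge0.
    by rewrite fineK// ge0_fin_numE// wess_sup_ge0.
  move=> e e0.
  have /fine_cvgP[fint cvt] := tf.
  have /cvgrPdist_le/(_ e e0) := cvt.
  move=> near1.
  have [X [Xr HX]] := filterI fint near1.
  pose Y := Num.max 0 (X + 1).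
  have Y0 : 0 <= Y by rewrite le_max lexx.
  exists Y => //.
  have X1 : X < Y by rewrite lt_max ltrDl ltr01 orbT.
  have [fn] := HX _ X1; rewrite /= sub0r normrN => le_e.
  have : (wess_sup w (halfline `&` `]Y, +oo[) f <= e%:E)%E.
    by rewrite -(fineK fn) lee_fin (le_trans _ le_e)// ler_norm.
  move=> /(wess_supP w f (@tail_sub _) (ltW e0)).
  apply: ae_mono => y + yX; apply; split => /=.
    by rewrite /halfline/= in_itv/= andbT ltW// (le_lt_trans Y0 yX).
  by rewrite in_itv/= andbT.
move=> [mf [M M0 HM] tf]; split => //.
  by apply: (@le_lt_trans _ _ M%:E); [exact/wess_supP | rewrite ltry].
have tl e : 0 < e -> \forall x \near +oo%R,
    (wess_sup w (halfline `&` `]x, +oo[) f <= e%:E)%E.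
  move=> e0; have [X X0 HX] := tf _ e0.
  exists X; split; first by rewrite num_real.
  move=> x Xx; apply/wess_supP; [exact: tail_sub|exact: ltW|].
  move: HX; apply: ae_mono => y Hy [_ /=]; rewrite in_itv/= andbT => xy.
  by apply: Hy; exact: lt_trans xy.
apply/fine_cvgP; split.
  have := tl _ ltr01; apply: filterS => x Hx.
  rewrite ge0_fin_numE; last exact/wess_sup_ge0/tail_sub.
  by rewrite (le_lt_trans Hx)// ltry.
apply/cvgrPdist_le => e e0.
have := tl _ e0; apply: filterS => x Hx; rewrite /= sub0r normrN.
have g0 : (0 <= wess_sup w (halfline `&` `]x, +oo[) f)%E.
  exact/wess_sup_ge0/tail_sub.
rewrite ger0_norm ?fine_ge0// -lee_fin fineK// ge0_fin_numE//.
by rewrite (le_lt_trans Hx)// ltry.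
Qed.

End facts.

Section closure.
Context {R : realType}.
Implicit Types (w : weight R) (f g : R -> R[i]).
Local Notation mu := (@lebesgue_measure R).

Lemma measurable_halfline : measurable (halfline : set R).
Proof. exact: measurable_itv. Qed.
Local Notation mH := measurable_halfline.

Lemma normc_Re (z : R[i]) : `|complex.Re z| <= normc z.
Proof.
case: z => a b /=; rewrite -[leLHS]sqrtr_sqr ?sqrtr_sqr.
by rewrite -(sqrtr_sqr a) ler_sqrt ?lerDl ?sqr_ge0// addr_ge0 ?sqr_ge0.
Qed.

Lemma normc_Im (z : R[i]) : `|complex.Im z| <= normc z.
Proof.
case: z => a b /=.
by rewrite -(sqrtr_sqr b) ler_sqrt ?lerDr ?sqr_ge0// addr_ge0 ?sqr_ge0.
Qed.

Lemma ReD (z t : R[i]) : complex.Re (z + t) = complex.Re z + complex.Re t.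
Proof. by case: z; case: t. Qed.
Lemma ImD (z t : R[i]) : complex.Im (z + t) = complex.Im z + complex.Im t.
Proof. by case: z; case: t. Qed.
Lemma ReM (z t : R[i]) : complex.Re (z * t) =
  complex.Re z * complex.Re t - complex.Im z * complex.Im t.
Proof. by case: z; case: t. Qed.
Lemma ImM (z t : R[i]) : complex.Im (z * t) =
  complex.Re z * complex.Im t + complex.Im z * complex.Re t.
Proof. by case: z; case: t. Qed.

Lemma normc_leD (z t : R[i]) : normc (z + t) <= normc z + normc t.
Proof. exact: le_normcD. Qed.

Lemma normc_le_ReIm (z : R[i]) :
  normc z <= `|complex.Re z| + `|complex.Im z|.
Proof.
case: z => a b; rewrite [Complex a b](_ : _ = Complex a 0 + Complex 0 b); last first.
  by apply/eqP; rewrite eq_complex ReD ImD/= addr0 add0r !eqxx.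
rewrite (le_trans (normc_leD _ _))//=.
by rewrite expr0n/= !addr0 !add0r !sqrtr_sqr.
Qed.

Lemma L0inf_submod_closed w : submod_closed (L0inf_pred w).
Proof.
split.
  apply/L0infP; split.
  - by split; exact: measurable_cst.
  - exists 0 => //; apply: aeW => y _.
    by rewrite (_ : normc _ = 0) ?mul0r//; exact: normc0.
  - move=> e e0; exists 0 => //; apply: aeW => y y0.
    rewrite (_ : normc _ = 0); last exact: normc0.
    by rewrite mulr_ge0 ?ltW// weight_gt0// ltW.
move=> a f g /L0infP[[mf1 mf2] [M M0 fM] tf] /L0infP[[mg1 mg2] [N N0 gN] tg].
have na : 0 <= normc a := normc_ge0 a.
apply/L0infP; split.
- split.
    have -> : (fun x => complex.Re ((a *: f + g) x)) =
      (fun x => (complex.Re a * complex.Re (f x) -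
                 complex.Im a * complex.Im (f x)) + complex.Re (g x)).
      by apply/funext => x; rewrite -ReM -ReD.
    apply: measurable_funD => //; apply: measurable_funB => //;
      (apply: measurable_funM => //; exact: measurable_cst).
  have -> : (fun x => complex.Im ((a *: f + g) x)) =
    (fun x => (complex.Re a * complex.Im (f x) +
               complex.Im a * complex.Re (f x)) + complex.Im (g x)).
    by apply/funext => x; rewrite -ImM -ImD.
  apply: measurable_funD => //; apply: measurable_funD => //;
    (apply: measurable_funM => //; exact: measurable_cst).
- exists (normc a * M + N); first by rewrite addr_ge0 ?mulr_ge0.
  have := ae_and fM gN; apply: ae_mono => y [fy gy] hy.
  rewrite (le_trans (normc_leD _ _))// mulrDl lerD ?gy//.
  by rewrite normcM -mulrA ler_wpM2l ?fy.
- move=> e e0.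
  have e1 : 0 < e / 2 / (normc a + 1) by rewrite !divr_gt0// ltr_wpDl.
  have e2 : 0 < e / 2 by rewrite divr_gt0.
  have [X X0 fX] := tf _ e1; have [Y Y0 gY] := tg _ e2.
  exists (Num.max X Y); first by rewrite le_max X0.
  have := ae_and fX gY; apply: ae_mono => y [fy gy].
  rewrite gt_max => /andP[/fy{}fy /[dup] Yy /gy{}gy].
  rewrite (le_trans (normc_leD _ _))//.
  have -> : e * w y = e / 2 * w y + e / 2 * w y by rewrite -mulrDl -splitr.
  rewrite lerD// normcM.
  rewrite (le_trans (ler_wpM2l na fy))// mulrA ler_wpM2r//.
    by rewrite ltW// weight_gt0// ltW// (le_lt_trans Y0).
  rewrite mulrCA ler_piMr ?(ltW e2)//.
  by rewrite ler_pdivrMr ?mul1r ?lerDl// ltr_wpDl.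
Qed.

Lemma ae_translate (P : R -> Prop) (x : R) :
  (\forall y \ae mu, P y) -> \forall y \ae mu, P (x + y).
Proof.
have mx : measurable_fun [set: measurableTypeR R]
    (fun y : measurableTypeR R => x + y : measurableTypeR R).
  exact: measurable_funD.
move=> [N [mN N0 PN]]; exists ((fun y => x + y) @^-1` N); split.
- by rewrite -[_ @^-1` _]setTI; exact: mx.
- rewrite -N0; apply/esym.
  apply: (@lebesgue_measure_unique _ (pushforward mu (fun y : measurableTypeR R => x + y : measurableTypeR R))) => // _ [[a b]] _ <-.
  rewrite /pushforward/=.
  rewrite [X in _ = lebesgue_measure X](_ : _ = `]a - x, b - x]%classic); last first.
    by apply/seteqP; split=> y /=; rewrite !in_itv/= ltrBlDl lerBrDl.
  rewrite !lebesgue_measure_itv/= !lte_fin ltrD2r; case: ifPn => // _.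
  by rewrite -!EFinD opprB addrA subrK.
- by move=> y /= Py; apply: PN.
Qed.

End closure.

HB.instance Definition _ (R : realType) (w : weight R) :=
  GRing.isSubmodClosed.Build R[i] (R -> R[i]) (L0inf_pred w)
    (L0inf_submod_closed w).
HB.instance Definition _ (R : realType) (w : weight R) :=
  [SubChoice_isSubLmodule of L0inf w by <:].

Section convolution.
Context {R : realType}.
Implicit Types w : weight R.
Local Notation mu := (@lebesgue_measure R).
Local Notation mH := measurable_halfline.

Let conv (a1 a2 b1 b2 : R -> R) x y := a1 (x + y) * b1 y + a2 (x + y) * b2 y.

Let pconv (a1 a2 b1 b2 : R -> R) (z : R * R) :=
  (a1 \_ halfline) (z.1 + z.2) * (b1 \_ halfline) z.2 +
  (a2 \_ halfline) (z.1 + z.2) * (b2 \_ halfline) z.2.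

Let halflineD (x y : R) : halfline x -> halfline y -> halfline (x + y).
Proof. by rewrite /halfline/= !in_itv/= !andbT; exact: addr_ge0. Qed.

Let convE a1 a2 b1 b2 x y : halfline x -> halfline y ->
  conv a1 a2 b1 b2 x y = pconv a1 a2 b1 b2 (x, y).
Proof.
move=> hx hy; have hxy := halflineD hx hy.
by rewrite /pconv/= !patchE !mem_set.
Qed.

Let measurable_pconv (a1 a2 b1 b2 : R -> R) :
  measurable_fun halfline a1 -> measurable_fun halfline a2 ->
  measurable_fun halfline b1 -> measurable_fun halfline b2 ->
  measurable_fun [set: R * R] (pconv a1 a2 b1 b2).
Proof.
move=> /(measurable_restrictT _ mH) ma1 /(measurable_restrictT _ mH) ma2.
move=> /(measurable_restrictT _ mH) mb1 /(measurable_restrictT _ mH) mb2.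
have mD : measurable_fun [set: R * R] (fun z : R * R => z.1 + z.2).
  by apply: measurable_funD; [exact: measurable_fst|exact: measurable_snd].
have m2 : measurable_fun [set: R * R] (fun z : R * R => z.2).
  exact: measurable_snd.
by apply: measurable_funD; apply: measurable_funM;
  exact: measurableT_comp.
Qed.

Lemma measurable_conv1 (a1 a2 b1 b2 : R -> R) (x : R) :
  measurable_fun halfline a1 -> measurable_fun halfline a2 ->
  measurable_fun halfline b1 -> measurable_fun halfline b2 ->
  halfline x ->
  measurable_fun halfline (fun y => a1 (x + y) * b1 y + a2 (x + y) * b2 y).
Proof.
move=> ma1 ma2 mb1 mb2 hx.
apply: (@eq_measurable_fun _ _ _ _ _ (fun y => pconv a1 a2 b1 b2 (x, y))).
  by move=> y /set_mem hy; rewrite -convE.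
apply: measurable_funTS.
have /measurableT_comp := measurable_pconv ma1 ma2 mb1 mb2.
by apply; exact: pair1_measurable.
Qed.

Lemma measurable_conv (a1 a2 b1 b2 : R -> R) :
  measurable_fun halfline a1 -> measurable_fun halfline a2 ->
  measurable_fun halfline b1 -> measurable_fun halfline b2 ->
  measurable_fun halfline (fun x => \int[mu]_(y in halfline)
    (a1 (x + y) * b1 y + a2 (x + y) * b2 y)).
Proof.
move=> ma1 ma2 mb1 mb2.
pose U (z : R * R) := (pconv a1 a2 b1 b2 z)%:E.
have mU : measurable_fun [set: R * R] U.
  by apply/measurable_EFinP; exact: measurable_pconv.
apply: (@eq_measurable_fun _ _ _ _ _
  (fun x => fine (fubini_F mu U^\+%E x - fubini_F mu U^\-%E x)%E)).
  move=> x /set_mem hx; rewrite /Rintegral; congr fine.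
  rewrite integral_mkcond.
  rewrite [X in integral mu setT X](_ : _ = fun y => U (x, y)); last first.
    apply/funext => y; rewrite patchE /U; case: ifPn => [/set_mem hy|hy].
      by rewrite -convE.
    by rewrite /pconv/= !patchE (negbTE hy) !mulr0 addr0.
  rewrite integralE; congr (_ - _)%E; apply: eq_integral => y _.
    by rewrite !funeposE.
  by rewrite !funenegE.
apply: measurable_funTS.
apply: (measurableT_comp (fine_measurable measurableT)).
by apply: emeasurable_funB; apply: measurable_fun_fubini_tonelli_F => //;
  [exact: measurable_funepos|exact: measurable_funeneg].
Qed.

Lemma Rintegral_bound (u q : R -> R) (K I : R) :
  measurable_fun halfline u -> measurable_fun halfline q ->
  (forall y, halfline y -> 0 <= q y) -> 0 <= K ->
  (\forall y \ae mu, halfline y -> `|u y| <= K * q y) ->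
  (\int[mu]_(y in halfline) (q y)%:E <= I%:E)%E ->
  `|\int[mu]_(y in halfline) u y| <= K * I.
Proof.
move=> mesu mq q0 K0 uq qI.
have mEu : measurable_fun halfline (fun y => (u y)%:E).
  exact/measurable_EFinP.
have mEq : measurable_fun halfline (fun y => (q y)%:E).
  exact/measurable_EFinP.
have B : (`|\int[mu]_(y in halfline) (u y)%:E| <= (K * I)%:E)%E.
  apply: (le_trans (le_abse_integral mu mH mEu)).
  apply: (@le_trans _ _ (\int[mu]_(y in halfline) (K%:E * (q y)%:E))%E).
    apply: ae_ge0_le_integral => //.
    - exact: mH.
    - exact: measurableT_comp.
    - by move=> y hy; rewrite mule_ge0 ?lee_fin ?q0.
    - by apply: emeasurable_funM => //; exact: measurable_cst.
  have Eq0 y : halfline y -> (0 <= (q y)%:E)%E by rewrite lee_fin; exact: q0.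
  rewrite (ge0_integralZl_EFin mu mH Eq0 mEq K0).
  by rewrite EFinM lee_wpmul2l.
have fin : (\int[mu]_(y in halfline) (u y)%:E)%E \is a fin_num.
  by rewrite fin_num_abs (le_lt_trans B)// ltry.
by rewrite -lee_fin /Rintegral -fine_abse// fineK// abse_fin_num.
Qed.

Lemma L1_weight_bound w (phi : L1 w) :
  [/\ cmeasurable phi,
      measurable_fun halfline (fun y => normc (phi y) * w y) &
      exists2 I : R, 0 <= I &
      (\int[mu]_(x in halfline) (normc (phi x) * w x)%:E <= I%:E)%E].
Proof.
case: phi => phi /=; rewrite inE => -[[mR mI] fi]; split => //.
  apply: measurable_funM; last first.
    exact: (subspace_continuous_measurable_fun mH (@weight_cont _ w)).
  rewrite [X in measurable_fun _ X](_ : _ = fun y =>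
    Num.sqrt (complex.Re (phi y) ^+ 2 + complex.Im (phi y) ^+ 2)); last first.
    by apply/funext => y; case: (phi y).
  have msqrt : measurable_fun [set: R] (@Num.sqrt R).
    by apply: continuous_measurable_fun; exact: sqrt_continuous.
  apply: (measurableT_comp msqrt).
  by apply: measurable_funD; exact: measurable_funX.
have i0 : (0 <= \int[mu]_(x in halfline) (normc (phi x) * w x)%:E)%E.
  apply: integral_ge0 => x; rewrite /halfline/= in_itv/= andbT => x0.
  by rewrite lee_fin mulr_ge0 ?normc_ge0// ltW// weight_gt0.
exists (fine (\int[mu]_(x in halfline) (normc (phi x) * w x)%:E)).
  exact: fine_ge0.
by rewrite fineK// ge0_fin_numE.
Qed.

Lemma ract_in_L0inf w (f : L0inf w) (phi : L1 w) :
  (fun x => cintegral (fun y => f (x + y) * phi y)) \in L0inf_pred w.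
Proof.
have /L0infP[[mf1 mf2] [M M0 fM] tf] := valP f.
have [[mp1 mp2] mq [I I0 qI]] := L1_weight_bound phi.
have q0 (y : R) : halfline y -> 0 <= normc (phi y) * w y.
  rewrite /halfline/= in_itv/= andbT => y0.
  by rewrite mulr_ge0 ?normc_ge0// ltW// weight_gt0.
have RE x : complex.Re (cintegral (fun y => f (x + y) * phi y)) =
    \int[mu]_(y in halfline)
      (complex.Re (f (x + y)) * complex.Re (phi y) +
       (- complex.Im (f (x + y))) * complex.Im (phi y)).
  by rewrite /=; apply: eq_Rintegral => y _; rewrite ReM mulNr.
have IE x : complex.Im (cintegral (fun y => f (x + y) * phi y)) =
    \int[mu]_(y in halfline)
      (complex.Re (f (x + y)) * complex.Im (phi y) +
       complex.Im (f (x + y)) * complex.Re (phi y)).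
  by rewrite /=; apply: eq_Rintegral => y _; rewrite ImM.
have mf2N : measurable_fun halfline (fun y => - complex.Im (f y)).
  exact: measurable_funN.
have bound x N : halfline x -> 0 <= N ->
    (\forall z \ae mu, x <= z -> normc (f z) <= N * w z) ->
    normc (cintegral (fun y => f (x + y) * phi y)) <= 2 * N * I * w x.
  move=> hx N0 fN.
  have x0 : 0 <= x by move: hx; rewrite /halfline/= in_itv/= andbT.
  have K0 : 0 <= N * w x by rewrite mulr_ge0// ltW// weight_gt0.
  have hb : \forall y \ae mu, halfline y ->
      normc (f (x + y) * phi y) <= N * w x * (normc (phi y) * w y).
    have := ae_translate x fN; apply: ae_mono => y Hy hy.
    have y0 : 0 <= y by move: hy; rewrite /halfline/= in_itv/= andbT.
    rewrite normcM [normc (phi y) * _]mulrC mulrA.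
    rewrite ler_wpM2r ?normc_ge0// (le_trans (Hy _)) ?lerDl//.
    by rewrite -mulrA ler_wpM2l// weightD.
  have -> : 2 * N * I * w x = 2 * (N * w x * I) by rewrite mulrAC -!mulrA.
  rewrite [2 * _]mulr_natl mulr2n.
  rewrite (le_trans (normc_le_ReIm _))// RE IE lerD//.
  - apply: (Rintegral_bound (measurable_conv1 mf1 mf2N mp1 mp2 hx) mq) => //.
    move: hb; apply: ae_mono => y /[apply]; apply: le_trans.
    by rewrite mulNr -ReM normc_Re.
  - apply: (Rintegral_bound (measurable_conv1 mf1 mf2 mp2 mp1 hx) mq) => //.
    move: hb; apply: ae_mono => y /[apply]; apply: le_trans.
    by rewrite -ImM normc_Im.
apply/L0infP; split.
- split.
    by rewrite (funext RE); exact: (measurable_conv mf1 mf2N mp1 mp2).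
  by rewrite (funext IE); exact: (measurable_conv mf1 mf2 mp2 mp1).
- exists (2 * M * I); first by rewrite !mulr_ge0.
  apply: aeW => x hx; apply: bound => //.
  move: fM; apply: ae_mono => z Hz xz; apply: Hz.
  move: hx; rewrite /halfline/= !in_itv/= !andbT => x0; exact: le_trans xz.
- move=> e e0.
  have d0 : 0 < e / (2 * (I + 1)) by rewrite divr_gt0// mulr_gt0// ltr_wpDl.
  have [X X0 fX] := tf _ d0; exists X => //.
  apply: aeW => x Xx; have x0 := le_lt_trans X0 Xx.
  have hx : halfline x by rewrite /halfline/= in_itv/= andbT ltW.
  apply: (le_trans (bound _ _ hx (ltW d0) _)).
    by move: fX; apply: ae_mono => z Hz xz; apply: Hz; exact: lt_le_trans xz.
  rewrite ler_wpM2r//; first by rewrite ltW// weight_gt0// ltW.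
  have I1 : 0 < I + 1 by rewrite ltr_wpDl.
  rewrite invfM mulrCA mulVKf// -mulrA ler_piMr ?(ltW e0)//.
  by rewrite mulrC ler_pdivrMr ?mul1r ?lerDl.
Qed.

End convolution.

Section dual_space.
Context {R : realType}.
Variable w : weight R.

(* f phi, with (f phi) x = \int_0^oo f (x + y) phi y dy *)
Definition ract (f : L0inf w) (phi : L1 w) : L0inf w :=
  MkL0inf (ract_in_L0inf f phi).

Definition L0inf_norm (f : L0inf w) : R := fine (wess_sup w halfline f).

(* L0inf w consists of functions, not of a.e.-classes, so that L0inf_norm is a
   seminorm vanishing exactly on the a.e. null functions. A bounded functional
   is constant on a.e.-classes (L0inf_dual_ae), hence L0inf_dual w is also the
   dual of the Banach space of a.e.-classes. *)
Definition L0inf_dual_pred : {pred L0inf w -> R[i]} := mem [set m |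
  scalar m /\ exists C : R, forall f, normc (m f) <= C * L0inf_norm f].

Lemma L0inf_dual_submod_closed : submod_closed L0inf_dual_pred.
Proof.
split.
  rewrite inE; split; first by move=> a f g /=; rewrite mulr0 addr0.
  by exists 0 => f; rewrite mul0r le_eqVlt; apply/orP; left; apply/eqP/normc0.
move=> a m n; rewrite !inE => -[lm [C mC]] [ln [K nK]]; split.
  move=> b f g; rewrite -![(a *: m + n) _]/(a * m _ + n _) lm ln !mulrDr.
  by rewrite !mulrA [a * b]mulrC addrACA.
exists (normc a * C + K) => f.
rewrite (le_trans (normc_leD _ _))// mulrDl lerD ?nK//.
by rewrite normcM -mulrA ler_wpM2l ?normc_ge0 ?mC.
Qed.

End dual_space.

Record L0inf_dual (R : realType) (w : weight R) := MkL0inf_dual {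
  L0inf_dual_fun :> L0inf w -> R[i] ;
  _ : L0inf_dual_fun \in @L0inf_dual_pred R w }.

HB.instance Definition _ (R : realType) (w : weight R) :=
  [isSub for @L0inf_dual_fun R w].
HB.instance Definition _ (R : realType) (w : weight R) :=
  [Choice of L0inf_dual w by <:].
HB.instance Definition _ (R : realType) (w : weight R) :=
  GRing.isSubmodClosed.Build R[i] (L0inf w -> R[i]) (@L0inf_dual_pred R w)
    (@L0inf_dual_submod_closed R w).
HB.instance Definition _ (R : realType) (w : weight R) :=
  [SubChoice_isSubLmodule of L0inf_dual w by <:].

Section arens.
Context {R : realType} {w : weight R}.
Local Notation A := (L0inf_dual w).
Implicit Types (m n : A) (f g : L0inf w).

Lemma L0inf_dual_ae m f g :
  (\forall x \ae lebesgue_measure, halfline x -> f x = g x) -> m f = m g.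
Proof.
move=> fg; have := valP m; rewrite inE => -[lm [C mC]].
have n0 : L0inf_norm (f - g) = 0.
  suff e0 : wess_sup w halfline (f - g : L0inf w) = 0%E.
    by rewrite /L0inf_norm e0.
  apply/eqP; rewrite eq_le wess_sup_ge0// andbT.
  apply/(wess_supP w _ _ (lexx 0)) => //; move: fg; apply: ae_mono => x + hx.
  move=> /(_ hx) fgx; rewrite mul0r.
  rewrite (_ : normc _ = normc (f x - g x))//.
  by rewrite fgx subrr le_eqVlt; apply/orP; left; apply/eqP/normc0.
have := mC (f - g); rewrite n0 mulr0 => h.
have /eq0_normc : normc (m (f - g)) = 0.
  by apply/eqP; rewrite eq_le h normc_ge0.
have -> : m (f - g) = m f - m g.
  by rewrite addrC -scaleN1r (lm (-1) g f) mulN1r addrC.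
by move=> /eqP; rewrite subr_eq0 => /eqP.
Qed.

(* The element n f of L_0^oo(w). It exists and is unique up to a.e. equality
   (duality between L^1(w) and L^oo(w)), and which representative is picked is
   immaterial by L0inf_dual_ae. *)
Definition arens_act n f : L0inf w :=
  xget 0 [set g : L0inf w | forall phi : L1 w,
    cintegral (fun x => g x * phi x) = n (ract f phi)].

(* (m n) f = m (n f). insubd only packs the function f |-> m (n f), which is
   linear and bounded, as an element of the dual. *)
Definition arens_mul m n : A := insubd (0 : A) (fun f => m (arens_act n f)).

End arens.

Notation "m ** n" := (arens_mul m n) (at level 40, left associativity).

Section theta_maps.
Context {R : realType} {w : weight R}.
Local Notation A := (L0inf_dual w).
Implicit Types (theta d D T : A -> A) (m n r z : A).

Definition in_center z := forall m, z ** m = m ** z.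

Definition in_ran r := forall m, m ** r = 0.

Definition multiplicative_map theta :=
  forall m n, theta (m ** n) = theta m ** theta n.

Definition theta_derivation theta d :=
  forall m n, d (m ** n) = d m ** theta n + theta m ** d n.

Definition theta_generalized_derivation theta D d :=
  theta_derivation theta d /\
  forall m n, D (m ** n) = theta m ** D n + d m ** theta n.

Definition theta_right_centralizer theta T :=
  forall m n, T (m ** n) = theta m ** T n.

Definition theta_commuting theta T :=
  forall m, T m ** theta m = theta m ** T m.

Definition theta_centralizing theta T :=
  forall m, in_center (T m ** theta m - theta m ** T m).

End theta_maps.

(* Main.v *)
(* The exponentials e_k(x) = exp(-(k+1)x) yield characters m |-> m(e_k) of A.
   For each N the closed span of the e_k, k >= N, contains every f phi with phi
   bounded, because the indicator of [0, a[ is a limit in L^1(dx) of functions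
   1 - (1 - exp(-Jx))^M; so an element which kills e_k for all k >= N belongs to
   ran(A). Moreover A has a right unit u, an ultralimit of the means over
   [0, 1/k].

   (i) The idempotent theta(u) takes values 0 or 1 at the e_k, and eventually
   the same one, as |e_k - e_(k+1)| <= 1/(k+1). If it is 0, then theta(u) is in
   ran(A) and theta and D vanish. If it is 1, then evaluating D(u r) = 0 at e_k
   gives D(r)(e_k) = 0 for large k.

   (ii) The commutator z of D(m) and theta(m) is killed by all characters, so z
   is in ran(A); if it is central, then z = z u = u z = 0.

   (iii) One may assume theta = id. Put c = D(u). Polarizing the commutation of
   D(m) with m gives d(m) = u(mc) + u d(m) - cm. A gliding hump argument shows
   that m |-> u d(m) is bounded for every derivation d, so here d is bounded.
   If b(e_k) = 0, then d^n(b^n)(e_k) = n! (d(b)(e_k))^n, which forces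
   d(b)(e_k) = 0; hence d maps A into ran(A). The formula now yields d = 0 on
   ran(A) and d(u) = 0, so that d(m) = d(um) + d(m - um) = 0. *)
From Pilot Require Import Defs.
From HB Require Import structures.
From mathcomp Require Import all_boot all_order all_algebra.
From mathcomp Require Import all_classical all_reals all_analysis.
From mathcomp Require Import measurable_realfun complex.
From mathcomp Require Import ring lra.

Set Implicit Arguments.
Unset Strict Implicit.
Unset Printing Implicit Defensive.

Import Order.TTheory GRing.Theory Num.Theory.
Import numFieldNormedType.Exports.
Import ComplexField.Normc.
Import Pilot.Defs.

Local Open Scope classical_set_scope.
Local Open Scope ring_scope.
Local Open Scope complex_scope.

#[local] Arguments normc : simpl never.

(** * Complex integrals on the half-line *)

Section complex_integral.
Context {R : realType}.
Implicit Types (f g : R -> R[i]) (q r : R -> R).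
Local Notation mu := (@lebesgue_measure R).
Local Notation mH := measurable_halfline.

(** The obstacle is that [D] and [d] come without continuity, while the factorial growth argument of
    (iii) needs a bounded derivation. The gliding hump controls [d m] only at exponentials, hence on
    the functions [ract f p] with [p] bounded. These are continuous, so a general element of
    L_0^oo(w), such as an indicator, is not a limit of them. What they do determine is
    [arens_act (d m) f], that is, the product [u ** d m]. The rest of [d m] is recovered from
    commutation, which expresses [d m] through [u ** d m] and products with the fixed element [c].
    Tails k >= N are allowed because the idempotent settles only eventually, and because the hump
    argument leaves finitely many characters out of control. Nothing is lost: the cutoff 1 - (1 -
    exp(-Jx))^M involves only multiples of J, and J may be taken beyond N. The constants 2 and 4
    have one origin: complex integrals are estimated through real and imaginary parts, at the cost
    of a factor 2 each time. The product is therefore submultiplicative up to a factor 4. *)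

Lemma normc_real (a : R) : normc a%:C = `|a|.
Proof. by rewrite /normc /= expr0n addr0 sqrtr_sqr. Qed.

Lemma cmeasurable_normc f : cmeasurable f ->
  measurable_fun halfline (fun x => normc (f x)).
Proof.
move=> [mR mI].
rewrite [X in measurable_fun _ X](_ : _ = fun y =>
    Num.sqrt (complex.Re (f y) ^+ 2 + complex.Im (f y) ^+ 2)); last first.
  by apply/funext => y; case: (f y).
have msqrt : measurable_fun [set: R] (@Num.sqrt R).
  by apply: continuous_measurable_fun; exact: sqrt_continuous.
apply: (measurableT_comp msqrt).
by apply: measurable_funD; exact: measurable_funX.
Qed.

Lemma cmeasurable_lin (a : R[i]) f g : cmeasurable f -> cmeasurable g ->
  cmeasurable (fun x => a * f x + g x).
Proof.
move=> [mf1 mf2] [mg1 mg2]; split.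
  rewrite [X in measurable_fun _ X](_ : _ = (fun x => (complex.Re a * complex.Re (f x) -
                 complex.Im a * complex.Im (f x)) + complex.Re (g x))).
    apply: measurable_funD => //; apply: measurable_funB => //;
      (apply: measurable_funM => //; exact: measurable_cst).
  by apply/funext => x; rewrite ReD ReM.
rewrite [X in measurable_fun _ X](_ : _ = (fun x => (complex.Re a * complex.Im (f x) +
               complex.Im a * complex.Re (f x)) + complex.Im (g x))).
  apply: measurable_funD => //; apply: measurable_funD => //;
    (apply: measurable_funM => //; exact: measurable_cst).
by apply/funext => x; rewrite ImD ImM.
Qed.

Lemma cmeasurable_mul f g : cmeasurable f -> cmeasurable g ->
  cmeasurable (fun x => f x * g x).
Proof.
move=> [mf1 mf2] [mg1 mg2]; split.
  rewrite [X in measurable_fun _ X](_ : _ = (fun x =>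
    complex.Re (f x) * complex.Re (g x) - complex.Im (f x) * complex.Im (g x))).
    by apply: measurable_funB; exact: measurable_funM.
  by apply/funext => x; rewrite ReM.
rewrite [X in measurable_fun _ X](_ : _ = (fun x =>
    complex.Re (f x) * complex.Im (g x) + complex.Im (f x) * complex.Re (g x))).
  by apply: measurable_funD; exact: measurable_funM.
by apply/funext => x; rewrite ImM.
Qed.

Lemma cmeasurable_real q : measurable_fun halfline q ->
  cmeasurable (fun x => (q x)%:C).
Proof. by move=> mq; split => //; exact: measurable_cst. Qed.

Lemma cmeasurable_cst (a : R[i]) : cmeasurable (fun=> a : R[i]).
Proof. by split; exact: measurable_cst. Qed.

Definition cintegrable f := cmeasurable f /\
  (\int[mu]_(x in halfline) (normc (f x))%:E < +oo)%E.

Lemma cintegrable_Re f : cintegrable f ->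
  mu.-integrable halfline (EFin \o (fun x => complex.Re (f x))).
Proof.
move=> [[mR mI] fi].
have mE := iffRL (measurable_EFinP _ _) mR.
apply/integrableP; split => //.
apply: le_lt_trans fi; apply: ge0_le_integral => //; first exact: mH.
- exact: measurableT_comp.
- by apply/measurable_EFinP; exact: cmeasurable_normc.
- by move=> x _; rewrite lee_fin normc_Re.
Qed.

Lemma cintegrable_Im f : cintegrable f ->
  mu.-integrable halfline (EFin \o (fun x => complex.Im (f x))).
Proof.
move=> [[mR mI] fi].
have mE := iffRL (measurable_EFinP _ _) mI.
apply/integrableP; split => //.
apply: le_lt_trans fi; apply: ge0_le_integral => //; first exact: mH.
- exact: measurableT_comp.
- by apply/measurable_EFinP; exact: cmeasurable_normc.
- by move=> x _; rewrite lee_fin normc_Im.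
Qed.

Lemma cintegrable_le f q : cmeasurable f -> measurable_fun halfline q ->
  (forall y, halfline y -> 0 <= q y) ->
  (\forall y \ae mu, halfline y -> normc (f y) <= q y) ->
  (\int[mu]_(y in halfline) (q y)%:E < +oo)%E -> cintegrable f.
Proof.
move=> mf mq q0 fq qi; split => //; apply: le_lt_trans qi.
apply: ae_ge0_le_integral => //; first exact: mH.
- by move=> x _; rewrite lee_fin normc_ge0.
- by apply/measurable_EFinP; exact: cmeasurable_normc.
- exact/measurable_EFinP.
Qed.

(** The two parts of the integral are bounded separately by I; this is the source of the factor 2 in
    the later norm estimates. *)
Lemma cintegral_bound f q (I : R) : cmeasurable f -> measurable_fun halfline q ->
  (forall y, halfline y -> 0 <= q y) ->
  (\forall y \ae mu, halfline y -> normc (f y) <= q y) ->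
  (\int[mu]_(y in halfline) (q y)%:E <= I%:E)%E ->
  normc (cintegral f) <= 2 * I.
Proof.
move=> [mR mI] mq q0 fq qI.
have -> : 2 * I = 1 * I + 1 * I by rewrite !mul1r mulr_natl mulr2n.
rewrite (le_trans (normc_le_ReIm _))// lerD//=.
- apply: (Rintegral_bound _ mq) => //; move: fq; apply: ae_mono => y /[apply].
  by rewrite mul1r; apply: le_trans; exact: normc_Re.
- apply: (Rintegral_bound _ mq) => //; move: fq; apply: ae_mono => y /[apply].
  by rewrite mul1r; apply: le_trans; exact: normc_Im.
Qed.

Lemma cintegral_lin (a : R[i]) f g : cintegrable f -> cintegrable g ->
  cintegral (fun x => a * f x + g x) = a * cintegral f + cintegral g.
Proof.
move=> fi gi.
have fR := cintegrable_Re fi; have fI := cintegrable_Im fi.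
have gR := cintegrable_Re gi; have gI := cintegrable_Im gi.
have iZ (k : R) (q : R -> R) : mu.-integrable halfline (EFin \o q) ->
    mu.-integrable halfline (EFin \o (fun x => k * q x)).
  by move=> qi; rewrite [X in integrable _ _ X](_ : _ = fun x => (k%:E * (EFin \o q) x)%E) //;
    exact: (@integrableZl _ _ _ mu halfline mH k (EFin \o q)).
have iD (q r : R -> R) : mu.-integrable halfline (EFin \o q) ->
    mu.-integrable halfline (EFin \o r) ->
    mu.-integrable halfline (EFin \o (fun x => q x + r x)).
  by move=> qi ri; exact: (@integrableD _ _ _ mu halfline mH _ _ qi ri).
have iB (q r : R -> R) : mu.-integrable halfline (EFin \o q) ->
    mu.-integrable halfline (EFin \o r) ->
    mu.-integrable halfline (EFin \o (fun x => q x - r x)).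
  by move=> qi ri; exact: (@integrableB _ _ _ mu halfline mH _ _ qi ri).
apply/eqP; rewrite eq_complex ReD ImD ReM ImM /=; apply/andP; split; apply/eqP.
  under eq_Rintegral do rewrite ReD ReM.
  rewrite (@RintegralD _ _ _ mu halfline _ _ mH); [|exact/iB/iZ/fI/iZ/fR|exact: gR].
  rewrite (@RintegralB _ _ _ mu halfline _ _ mH); [|exact/iZ/fR|exact/iZ/fI].
  by rewrite (@RintegralZl _ _ _ mu halfline _ _ mH)// (@RintegralZl _ _ _ mu halfline _ _ mH).
under eq_Rintegral do rewrite ImD ImM.
rewrite (@RintegralD _ _ _ mu halfline _ _ mH); [|exact/iD/iZ/fR/iZ/fI|exact: gI].
rewrite (@RintegralD _ _ _ mu halfline _ _ mH); [|exact/iZ/fI|exact/iZ/fR].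
by rewrite (@RintegralZl _ _ _ mu halfline _ _ mH)// (@RintegralZl _ _ _ mu halfline _ _ mH).
Qed.

Lemma eq_cintegral f g : (forall x, halfline x -> f x = g x) ->
  cintegral f = cintegral g.
Proof.
by move=> fg; congr Complex; apply: eq_Rintegral => x /set_mem hx; rewrite fg.
Qed.

End complex_integral.

Import HBNNSimple.

(** * Density and duality in weighted L^1 spaces *)

Section weighted_density.
Context {R : realType}.
Implicit Types (f g : R -> R[i]) (E : set R).
Local Notation mu := (@lebesgue_measure R).
Local Notation mH := measurable_halfline.

Definition ind E (x : R) : R[i] := (\1_E x)%:C.

Arguments ind : simpl never.

Definition wnorm1 (rho : R -> R) f : \bar R :=
  \int[mu]_(x in halfline) (normc (f x) * rho x)%:E.

Lemma halflineE (x : R) : halfline x = (0 <= x) :> Prop.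
Proof. by rewrite /halfline/= in_itv/= andbT. Qed.

Lemma ind_in E x : E x -> ind E x = 1.
Proof. by move=> Ex; rewrite /ind indicE mem_set. Qed.

Lemma ind_out E x : ~ E x -> ind E x = 0.
Proof. by move=> Ex; rewrite /ind indicE memNset. Qed.

Lemma normc_ind E x : normc (ind E x) = \1_E x.
Proof. by rewrite normc_real ger0_norm. Qed.

Lemma cmeasurable_ind E : measurable E -> cmeasurable (ind E).
Proof. by move=> mE; apply: cmeasurable_real; exact: measurable_funTS. Qed.

Lemma cmeasurableB f g : cmeasurable f -> cmeasurable g ->
  cmeasurable (fun x => f x - g x).
Proof.
move=> mf mg; have := cmeasurable_lin (-1) mg mf.
by congr cmeasurable; apply/funext => x; rewrite mulN1r addrC.
Qed.

Lemma wnorm1_dominated (rho : R -> R) f (g : nat -> R -> R[i]) (h : R -> R) :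
  measurable_fun halfline rho -> (forall x, halfline x -> 0 <= rho x) ->
  cmeasurable f -> (forall n, cmeasurable (g n)) ->
  measurable_fun halfline h ->
  (forall x, halfline x -> 0 <= h x) ->
  (\int[mu]_(x in halfline) (h x)%:E < +oo)%E ->
  (forall n x, halfline x -> normc (f x - g n x) * rho x <= h x) ->
  (\forall x \ae mu, halfline x -> (fun n => normc (f x - g n x)) @ \oo --> (0 : R)) ->
  forall e : R, 0 < e -> exists N, forall n, (N <= n)%N ->
    (wnorm1 rho (fun x => (f x - g n x)%R) <= e%:E)%E.
Proof.
move=> mrho rho0 mf mg mh h0 hi dom ptw e e0.
have mfg n : measurable_fun halfline (fun x => (normc (f x - g n x) * rho x)%:E).
  apply/measurable_EFinP; apply: measurable_funM => //.
  by apply: cmeasurable_normc; exact: cmeasurableB.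
have [] := @dominated_convergence _ _ _ mu halfline mH
  (fun n x => (normc (f x - g n x) * rho x)%:E) (cst 0%E) (EFin \o h) mfg.
- exact: measurable_cst.
- move: ptw; apply: ae_mono => x ptw hx; apply/fine_cvgP; split; first exact: nearW.
  rewrite (_ : fine \o _ = fun n => normc (f x - g n x) * rho x)//.
  by rewrite -[X in _ --> X](mul0r (rho x)); apply: cvgMl; exact: ptw.
- apply/integrableP; split; first exact/measurable_EFinP.
  apply: le_lt_trans hi; apply: ge0_le_integral => //; first exact: mH.
  + by apply: measurableT_comp => //; exact/measurable_EFinP.
  + exact/measurable_EFinP.
  + by move=> x hx; rewrite /= ger0_norm ?h0.
- apply: aeW => x n hx; rewrite /= lee_fin ger0_norm ?dom//.
  by rewrite mulr_ge0 ?normc_ge0 ?rho0.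
move=> _ _; rewrite integral_cst ?mul0e; last exact: mH.
move=> /fine_cvgP[fn /cvgrPdist_le/(_ _ e0) cv].
have [N _ HN] := filterI fn cv; exists N => n Nn.
have [fn' cv'] := HN n Nn.
have {}fn' : wnorm1 rho (fun x => (f x - g n x)%R) \is a fin_num by exact: fn'.
rewrite -(fineK fn') lee_fin (le_trans _ cv')//= sub0r normrN.
exact: ler_norm.
Qed.

Variables (rho : R -> R) (P Q : (R -> R[i]) -> Prop).
Hypothesis mrho : measurable_fun halfline rho.
Hypothesis rho_ge0 : forall x, halfline x -> 0 <= rho x.
Hypothesis rho_locb : forall X, 0 <= X -> exists B, forall x, 0 <= x <= X -> rho x <= B.
Hypothesis Q0 : Q (fun=> 0).
Hypothesis Qlin : forall (a : R[i]) f g, Q f -> Q g -> Q (fun x => a * f x + g x).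
Hypothesis Qclosed : forall f, P f -> cmeasurable f ->
  (forall e : R, 0 < e -> exists g, [/\ Q g, cmeasurable g &
    (wnorm1 rho (fun x => (f x - g x)%R) <= e%:E)%E]) -> Q f.
Hypothesis Pind : forall E X, measurable E -> E `<=` `[0, X[ -> P (ind E).
Hypothesis Qind : forall a, 0 <= a -> Q (ind `[0, a[).

Let Q_itv a : Q (ind `[0, a[).
Proof.
have [a0|a0] := leP 0 a; first exact: Qind.
rewrite (_ : ind _ = fun=> 0)//; apply/funext => x; apply: ind_out => /=.
by rewrite in_itv/= => /andP[x0 xa]; have := lt_trans (le_lt_trans x0 xa) a0; rewrite ltxx.
Qed.

Let bound_integrable X : 0 <= X -> exists2 h : R -> R,
  [/\ measurable_fun halfline h, (forall x, halfline x -> 0 <= h x) &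
  (\int[mu]_(x in halfline) (h x)%:E < +oo)%E] &
  forall x, halfline x -> \1_(`[0, X[%classic : set R) x * rho x <= h x.
Proof.
move=> X0; have [B HB] := rho_locb X0.
have B0 : 0 <= B.
  have h0 : halfline (0 : R) by rewrite halflineE.
  by apply: (le_trans (rho_ge0 h0)); apply: HB; rewrite lexx.
exists (fun x => B * \1_(`[0, X[%classic : set R) x).
  split.
  - by apply: measurable_funM; [exact: measurable_cst|exact: measurable_funTS].
  - by move=> x _; rewrite mulr_ge0.
  - under eq_integral do rewrite EFinM.
    rewrite ge0_integralZl_EFin//; [|exact: mH|]; last first.
      by apply/measurable_EFinP; exact: measurable_funTS.
    rewrite integral_indic//; last exact: mH.
    rewrite lte_mul_pinfty//; apply: (@le_lt_trans _ _ (mu `[0, X[)).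
      by apply: le_measure => //; rewrite inE; [apply: measurableI => //; exact: mH|].
    by rewrite lebesgue_measure_itv/=; case: ifPn => // _; rewrite -EFinD ltry.
move=> x; rewrite halflineE => x0; rewrite indicE.
case: (boolP (x \in _)) => [/set_mem/=|_]; last by rewrite mul0r mulr0.
by rewrite in_itv/= => /andP[_ xX]; rewrite mul1r mulr1 HB// x0 ltW.
Qed.

(** Dynkin's theorem: the rays []-oo, a[] are a generating pi-system, and the sets whose trace on
    [0, X[ has its indicator in [Q] form a lambda-system. Linearity gives complements, closedness
    and dominated convergence give disjoint unions. The cut at X provides an integrable majorant,
    [rho] being only locally bounded. *)
Let Q_ind_itv X E : 0 <= X -> measurable E -> Q (ind (E `&` `[0, X[)).
Proof.
move=> X0 mE.
pose PP : set_system R := fun E => Q (ind (E `&` `[0, X[)).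
suff key : forall S, <<s @RGenInftyO.G R >> S -> PP S.
  apply: key.
  exact: (eq_ind _ (fun M : set_system R => M E) mE _ (RGenInftyO.measurableE R)).
apply: (@dynkin_induction _ (measurableTypeR R) (@RGenInftyO.G R) PP).
- exact: RGenInftyO.measurableE.
- move=> _ _ [a ->] [b ->]; exists (Num.min a b).
  by apply/seteqP; split=> x /=; rewrite !in_itv/= lt_min; [case=> -> ->|case/andP=> -> ->].
- by rewrite /PP setTI.
- move=> _ [a ->]; rewrite /PP.
  rewrite (_ : _ `&` _ = `[0, Num.min a X[%classic)//.
  by apply/seteqP; split=> x /=; rewrite !in_itv/= lt_min; [case=> -> /andP[-> ->]|case/and3P=> -> -> ->].
- move=> S mS QS; rewrite /PP.
  have := Qlin (-1) QS (Q_itv X); congr Q; apply/funext => x.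
  rewrite mulN1r /ind -rmorphN -rmorphD; congr (_%:C); rewrite !indicE !in_setI in_setC.
  by case: (x \in S); case: (x \in _) => //=; lra.
- move=> F mF tF QF; rewrite /PP.
  pose G n := (\big[setU/set0]_(k < n) F k) `&` `[0, X[%classic.
  have mG n : measurable (G n) by apply: measurableI => //; exact: bigsetU_measurable.
  have QG n : Q (ind (G n)).
    elim: n => [|n IH].
      rewrite /G big_ord0 set0I (_ : ind set0 = fun=> 0)//.
      by apply/funext => x; exact: ind_out.
    have := Qlin 1 IH (QF n); congr Q; apply/funext => x; rewrite mul1r.
    rewrite /ind -rmorphD; congr (_%:C); rewrite !indicE /G big_ord_recr/= !in_setI in_setU.
    case: (boolP (x \in F n)) => [/set_mem xn|_]; last by rewrite orbF addr0.
    have -> : x \in \big[setU/set0]_(k < n) F k = false.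
      apply/negbTE/negP => /set_mem; rewrite -bigcup_mkord => -[k /= kn xk].
      have kn' : k = n by apply: tF => //; exists x.
      by rewrite kn' ltnn in kn.
    by rewrite /= add0r.
  have mU : measurable (\bigcup_k F k `&` `[0, X[%classic).
    by apply: measurableI => //; exact: bigcupT_measurable.
  apply: Qclosed.
  + by apply: Pind => //; exact: subIsetr.
  + exact: cmeasurable_ind.
  move=> e e0; have [h [mh h0 hi] rh] := bound_integrable X0.
  have subG n x : G n x -> (\bigcup_k F k `&` `[0, X[%classic) x.
    by rewrite /G -bigcup_mkord => -[[k _ Fk] xX]; split => //; exists k.
  have [||n Hn] := wnorm1_dominated mrho rho_ge0 (cmeasurable_ind mU)
      (fun n => cmeasurable_ind (mG n)) mh h0 hi _ _ e0; last first.
  * exists (ind (G n)); split => //; first exact: (cmeasurable_ind (mG n)).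
    exact: Hn.
  * apply: aeW => x hx.
    suff : \forall n \near \oo, normc (ind (\bigcup_k F k `&` `[0, X[%classic) x - ind (G n) x) = 0.
      exact: cvg_near_cst.
    have [[[k _ Fk] xX]|nx] := pselect ((\bigcup_k F k `&` `[0, X[%classic) x).
      exists k.+1 => // n kn; rewrite !ind_in ?subrr ?normc0//.
        by split => //; rewrite -bigcup_mkord; exists k.
      by split => //; exists k.
    by apply: nearW => n; rewrite !ind_out ?subrr ?normc0// => /subG.
  * move=> n x hx; apply: le_trans (rh x hx); apply: ler_wpM2r; first exact: rho_ge0.
    have [xG|nG] := pselect (G n x).
      by rewrite (ind_in xG) (ind_in (subG _ _ xG)) subrr normc0.
    rewrite (ind_out nG) subr0 normc_ind !indicE in_setI.
    by case: (x \in `[0, X[%classic); rewrite ?andbT ?andbF// ler_nat leq_b1.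
Qed.

Let Q_sum n (c : nat -> R[i]) (F : nat -> R -> R[i]) : (forall i, Q (F i)) ->
  Q (fun x => \sum_(i < n) c i * F i x).
Proof.
move=> QF; elim: n => [|n IH].
  by under eq_fun do rewrite big_ord0.
by under eq_fun do rewrite big_ord_recr/= addrC; exact: Qlin.
Qed.

Let dense_ge0 (q : R -> R) : measurable_fun halfline q ->
  (forall x, halfline x -> 0 <= q x) ->
  (\int[mu]_(x in halfline) (q x * rho x)%:E < +oo)%E ->
  forall e : R, 0 < e -> exists g, [/\ Q g, cmeasurable g &
    (wnorm1 rho (fun x => ((q x)%:C - g x)%R) <= e%:E)%E].
Proof.
move=> mq q0 qi e e0.
have mEq : measurable_fun halfline (EFin \o q) by exact/measurable_EFinP.
have Eq0 x : halfline x -> (0 <= (EFin \o q) x)%E by rewrite lee_fin; exact: q0.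
pose s n : {nnsfun R >-> R} := nnsfun_approx mH mEq n.
(* The cut at n is needed because only indicators of bounded sets are known to lie in [Q]; it
   disappears in the limit. *)
pose g n (x : R) : R[i] := (s n x * \1_(`[0, n%:R[%classic : set R) x)%:C.
have gE n x : g n x = \sum_(i < size (finmap.enum_fset (fset_set (range (s n)))))
    ((finmap.enum_fset (fset_set (range (s n))))`_i)%:C *
      ind (s n @^-1` [set (finmap.enum_fset (fset_set (range (s n))))`_i] `&` `[0, n%:R[%classic) x.
  rewrite /g {1}fimfunEord big_distrl rmorph_sum/=; apply: eq_bigr => i _.
  by rewrite /ind -rmorphM/= -mulrA; congr (_%:C); congr (_ * _); rewrite indicI.
have mg n : cmeasurable (g n).
  apply: cmeasurable_real; apply: measurable_funTS.
  by apply: measurable_funM => //; exact: measurable_indic.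
have Qg n : Q (g n).
  pose l := finmap.enum_fset (fset_set (range (s n))).
  have := @Q_sum (size l) (fun i => (l`_i)%:C)
    (fun i => ind (s n @^-1` [set l`_i] `&` `[0, n%:R[%classic)).
  rewrite (_ : (fun x => _) = g n); last by apply/funext => x; rewrite gE.
  by apply=> i; apply: Q_ind_itv => //; exact: measurable_funPTI.
have sq n x : halfline x -> s n x <= q x.
  by move=> hx; rewrite /s nnsfun_approxE -lee_fin (le_approx n Eq0).
have gq n x : halfline x -> 0 <= s n x * \1_(`[0, n%:R[%classic : set R) x <= q x.
  move=> hx; apply/andP; split; first by rewrite mulr_ge0.
  apply: le_trans (sq n x hx); rewrite indicE.
  by case: (_ \in _); rewrite ?mulr1 ?mulr0.
have [|||||n Hn] := @wnorm1_dominated rho (fun x => (q x)%:C) g (fun x => q x * rho x)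
  mrho rho_ge0 _ mg _ _ qi _ _ _ e0; last by exists (g n); split => //; exact: Hn.
- exact: cmeasurable_real.
- exact: measurable_funM.
- by move=> x hx; rewrite mulr_ge0 ?q0 ?rho_ge0.
- move=> n x hx; apply: ler_wpM2r; first exact: rho_ge0.
  rewrite /g -rmorphB normc_real.
  by have /andP[g0 gl] := gq n x hx; rewrite ger0_norm ?subr_ge0// lerBlDr lerDl.
- apply: aeW => x hx.
  have cs : s ^~ x @ \oo --> q x.
    have /fine_cvgP[_] := cvg_nnsfun_approx mH mEq Eq0 hx.
    by apply: cvg_trans; apply: near_eq_cvg; exact: nearW.
  have cs' : (fun n => q x - s n x) @ \oo --> (0 : R).
    by rewrite -(subrr (q x)); apply: cvgB => //; exact: cvg_cst.
  have H : (fun n => `|q x - s n x|) @ \oo --> (0 : R).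
    by rewrite -(normr0 R); exact: cvg_norm cs'.
  apply: cvg_trans H; apply: near_eq_cvg.
  near=> n.
  rewrite /g indicE mem_set; first by rewrite mulr1 -rmorphB normc_real.
  rewrite /= in_itv/=; have := hx; rewrite halflineE => ->/=.
  have : (Num.bound x < n)%N by near: n; exact: nbhs_infty_gt.
  rewrite -(ltr_nat R); apply: lt_trans; apply: archi_boundP.
  by rewrite -halflineE.
Unshelve. all: by end_near. Qed.

Theorem weighted_L1_density f : P f -> cmeasurable f -> (wnorm1 rho f < +oo)%E -> Q f.
Proof.
move=> Pf mf fi; apply: Qclosed => // e e0.
have [mR mI] := mf.
have e4 : 0 < e / 4 by rewrite divr_gt0.
have part (p : R -> R) (k : R -> R) : measurable_fun halfline p -> 
    (forall x, k x = Num.max (p x) 0) -> (forall x, `|p x| <= normc (f x)) ->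
    exists g, [/\ Q g, cmeasurable g &
      (wnorm1 rho (fun x => ((k x)%:C - g x)%R) <= (e / 4)%:E)%E].
  move=> mp kE pf.
  have mk : measurable_fun halfline k.
    by rewrite (funext kE); apply: measurable_maxr => //; exact: measurable_cst.
  apply: dense_ge0 => //.
    by move=> x _; rewrite kE le_max lexx orbT.
  apply: le_lt_trans fi; apply: ge0_le_integral => //; first exact: mH.
  - by move=> x hx; rewrite lee_fin mulr_ge0 ?rho_ge0// kE le_max lexx orbT.
  - by apply/measurable_EFinP; apply: measurable_funM.
  - by apply/measurable_EFinP; apply: measurable_funM => //; exact: cmeasurable_normc.
  - move=> x hx; rewrite lee_fin ler_wpM2r ?rho_ge0//; apply: le_trans (pf x).
    by rewrite kE ge_max normr_ge0 ler_norm.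
pose r1 x := Num.max (complex.Re (f x)) 0.
pose r2 x := Num.max (- complex.Re (f x)) 0.
pose i1 x := Num.max (complex.Im (f x)) 0.
pose i2 x := Num.max (- complex.Im (f x)) 0.
have [g1 [Q1 m1 n1]] := part _ r1 mR (fun=> erefl) (fun x => normc_Re (f x)).
have [g2 [Q2 m2 n2]] : exists g, [/\ Q g, cmeasurable g &
      (wnorm1 rho (fun x => ((r2 x)%:C - g x)%R) <= (e / 4)%:E)%E].
  apply: (part (fun x => - complex.Re (f x))) => //; first exact: measurable_funN.
  by move=> x; rewrite normrN normc_Re.
have [g3 [Q3 m3 n3]] := part _ i1 mI (fun=> erefl) (fun x => normc_Im (f x)).
have [g4 [Q4 m4 n4]] : exists g, [/\ Q g, cmeasurable g &
      (wnorm1 rho (fun x => ((i2 x)%:C - g x)%R) <= (e / 4)%:E)%E].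
  apply: (part (fun x => - complex.Im (f x))) => //; first exact: measurable_funN.
  by move=> x; rewrite normrN normc_Im.
(* Mirrors f = r1 - r2 + i (i1 - i2), each of the four parts being approximated within e / 4. *)
exists (fun x => 'i * g3 x + (- 'i * g4 x + (-1 * g2 x + g1 x))).
split.
- by do 3 apply: Qlin => //.
- by do 3 apply: cmeasurable_lin => //.
have mk (p : R -> R) : measurable_fun halfline p ->
    measurable_fun halfline (fun x => Num.max (p x) 0).
  by move=> mp; apply: measurable_maxr => //; exact: measurable_cst.
have mm (k : R -> R) g : measurable_fun halfline k -> cmeasurable g ->
    measurable_fun halfline (fun x => (normc ((k x)%:C - g x) * rho x)%:E).
  move=> mk' mg; apply/measurable_EFinP; apply: measurable_funM => //.
  by apply: cmeasurable_normc; apply: cmeasurableB => //; exact: cmeasurable_real.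
have M1 := mm _ _ (mk _ mR) m1.
have M2 := mm _ _ (mk _ (measurable_funN mR)) m2.
have M3 := mm _ _ (mk _ mI) m3.
have M4 := mm _ _ (mk _ (measurable_funN mI)) m4.
have nn (k : R -> R) g x : halfline x -> (0 <= (normc ((k x)%:C - g x) * rho x)%:E)%E.
  by move=> hx; rewrite lee_fin mulr_ge0 ?normc_ge0 ?rho_ge0.
apply: (@le_trans _ _ (wnorm1 rho (fun x => ((r1 x)%:C - g1 x)%R) +
   (wnorm1 rho (fun x => ((r2 x)%:C - g2 x)%R) + (wnorm1 rho (fun x => ((i1 x)%:C - g3 x)%R)
   + wnorm1 rho (fun x => ((i2 x)%:C - g4 x)%R))))%E); last first.
  apply: (@le_trans _ _ ((e / 4)%:E + ((e / 4)%:E + ((e / 4)%:E + (e / 4)%:E)))%E).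
    by rewrite !leeD.
  by rewrite -!EFinD lee_fin; lra.
rewrite /wnorm1 -ge0_integralD//; [|exact: mH|exact: nn|exact: nn].
rewrite -ge0_integralD//; [|exact: mH|exact: nn|by move=> x hx; rewrite adde_ge0 ?nn|exact: emeasurable_funD].
rewrite -ge0_integralD//; [|exact: mH|exact: nn|by move=> x hx; rewrite !adde_ge0 ?nn|by do 2 apply: emeasurable_funD => //].
apply: ge0_le_integral => //; first exact: mH.
- by move=> x hx; rewrite lee_fin mulr_ge0 ?normc_ge0 ?rho_ge0.
- apply/measurable_EFinP; apply: measurable_funM => //.
  apply: cmeasurable_normc; apply: cmeasurableB => //.
  by do 3 apply: cmeasurable_lin => //.
- by do 3 apply: emeasurable_funD => //.
- move=> x hx; rewrite -!EFinD lee_fin -!mulrDl ler_wpM2r ?rho_ge0//.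
  have -> : f x - ('i * g3 x + (- 'i * g4 x + (-1 * g2 x + g1 x))) =
    ((r1 x)%:C - g1 x) + (- ((r2 x)%:C - g2 x) + ('i * ((i1 x)%:C - g3 x) + - 'i * ((i2 x)%:C - g4 x))).
    have fE : f x = (r1 x)%:C - (r2 x)%:C + 'i * ((i1 x)%:C - (i2 x)%:C).
      have maxB (a : R) : Num.max a 0 - Num.max (- a) 0 = a.
        by case: (leP a 0); case: (leP (-a) 0) => ? ?; lra.
      by rewrite -!rmorphB/= !maxB; case: (f x) => a b /=; simpc.
    by rewrite fE; ring.
  have ni : normc ('i : R[i]) = 1 by rewrite /normc/= expr0n expr1n add0r sqrtr1.
  have nN (z : R[i]) : normc (- z) = normc z by exact: normcN.
  rewrite (le_trans (normc_leD _ _))// lerD2l (le_trans (normc_leD _ _))// nN lerD2l.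
  by rewrite (le_trans (normc_leD _ _))// !normcM nN ni !mul1r.
Qed.

End weighted_density.

(** * Pointwise bounds from integral bounds, and densities of dominated charges *)

Section integral_comparison.
Context {R : realType}.
Implicit Types (h q : R -> R) (D E : set R).
Local Notation mu := (@lebesgue_measure R).
Local Notation mH := measurable_halfline.

Lemma indic_le1 E (x : R) : \1_E x <= 1 :> R.
Proof. by rewrite indicE; case: (_ \in _). Qed.

(** The inequality is tested on the set where it fails, cut at n to keep the integrals finite: there
    h - K q is positive with integral at most 0, so the set is null. *)
Lemma ae_le_of_integral_le h q (K : R) D :
  measurable D -> D `<=` halfline ->
  measurable_fun halfline h -> measurable_fun halfline q ->
  (forall X, mu.-integrable halfline (fun x => (h x * \1_(`[0, X[%classic : set R) x)%:E)) ->
  (forall X, mu.-integrable halfline (fun x => (q x * \1_(`[0, X[%classic : set R) x)%:E)) ->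
  (forall E X, measurable E -> E `<=` D -> E `<=` `[0, X[ ->
    \int[mu]_(x in halfline) (h x * \1_E x) <=
    K * \int[mu]_(x in halfline) (q x * \1_E x)) ->
  \forall y \ae mu, D y -> h y <= K * q y.
Proof.
move=> mD DH mh mq ih iq hq.
suff key n : \forall y \ae mu, D y -> y < n%:R -> h y <= K * q y.
  have := ae_foralln key; apply: ae_mono => y Hy Dy.
  have y0 : 0 <= y by have := DH _ Dy; rewrite halflineE.
  by apply: (Hy (Num.bound y)) => //; exact: archi_boundP.
have mKq : measurable_fun halfline (fun x => K * q x).
  by apply: measurable_funM => //; exact: measurable_cst.
pose E := D `&` `[0, n%:R[%classic `&` (halfline `&` [set x | K * q x < h x]).
have mE : measurable E.
  apply: measurableI; first exact: measurableI.
  rewrite (_ : [set x | K * q x < h x] = [set x | ((K * q x)%:E < (h x)%:E)%E])//.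
  by apply: measurable_lte; [exact: mH|exact/measurable_EFinP|exact/measurable_EFinP].
have mE1 : measurable_fun halfline (\1_E : R -> R) by exact: measurable_funTS.
have En x : \1_E x = \1_(`[0, n%:R[%classic : set R) x * \1_E x :> R.
  rewrite !indicE; case: (boolP (x \in E)) => [/set_mem[[_ xn] _]|_].
    by rewrite mem_set ?mulr1.
  by rewrite mulr0.
have iE (k : R -> R) : measurable_fun halfline k ->
    mu.-integrable halfline (fun x => (k x * \1_(`[0, n%:R[%classic : set R) x)%:E) ->
    mu.-integrable halfline (fun x => (k x * \1_E x)%:E).
  move=> mk /integrableP[mk' ki]; apply/integrableP; split.
    by apply/measurable_EFinP; exact: measurable_funM.
  apply: le_lt_trans ki; apply: ge0_le_integral => //; first exact: mH.
  - by apply: measurableT_comp => //; apply/measurable_EFinP; exact: measurable_funM.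
  - exact: measurableT_comp.
  - move=> x _; rewrite lee_fin En mulrA normrM ler_piMr// ger0_norm// indic_le1.
have ihE := iE _ mh (ih n%:R).
have iqE := iE _ mq (iq n%:R).
have EX : E `<=` `[0, n%:R[ by move=> x [[_ ?] _].
have ED : E `<=` D by move=> x [[? _] _].
have := hq E n%:R mE ED EX => le1.
have iKq : mu.-integrable halfline (fun x => (K * (q x * \1_E x))%:E).
  exact: (@integrableZl _ _ _ mu halfline mH K (fun x => (q x * \1_E x)%:E)).
pose k x := h x * \1_E x - K * (q x * \1_E x).
have ki : mu.-integrable halfline (EFin \o k).
  exact: (@integrableB _ _ _ mu halfline mH _ _ ihE iKq).
have k0 x : 0 <= k x.
  rewrite /k indicE; case: (boolP (x \in E)) => [/set_mem[_ [_ /= xn]]|_].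
    by rewrite !mulr1 subr_ge0 ltW.
  by rewrite !mulr0 subr0.
have int0 : \int[mu]_(x in halfline) k x <= 0.
  rewrite /k (@RintegralB _ _ _ mu halfline _ _ mH)//.
  by rewrite (@RintegralZl _ _ _ mu halfline _ _ mH)// subr_le0.
have int0' : (\int[mu]_(x in halfline) `|(k x)%:E| = 0)%E.
  transitivity (\int[mu]_(x in halfline) (EFin \o k) x)%E.
    by apply: eq_integral => x _; rewrite /= ger0_norm.
  have fk : (\int[mu]_(x in halfline) (EFin \o k) x)%E \is a fin_num by apply: (@integrable_fin_num _ _ _ mu halfline mH).
  apply/eqP; rewrite eq_le; apply/andP; split; last first.
    by apply: integral_ge0 => x _; rewrite lee_fin.
  by rewrite -(fineK fk) lee_fin.
have mk : measurable_fun halfline (EFin \o k) by case/integrableP : ki.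
have := iffLR (ae_eq_integral_abs mu mH mk) int0'.
apply: ae_mono => y ky Dy yn.
have y0 : 0 <= y by have := DH _ Dy; rewrite halflineE.
have hy : halfline y by exact: DH.
rewrite leNgt; apply/negP => lt1.
have Ey : E y by split; split => //=; rewrite in_itv/= y0.
have [] := ky hy; rewrite /k indicE mem_set// !mulr1 => /eqP.
by rewrite subr_eq0 => /eqP e; rewrite e ltxx in lt1.
Qed.

(** Radon-Nikodym for a merely finitely additive [nu]: domination by the finite measure K q dx makes
    the tails of a disjoint union negligible, whence countable additivity, and it also gives
    absolute continuity. *)
Lemma charge_density (nu : set R -> R) q (K : R) : 0 <= K ->
  measurable_fun halfline q -> (forall x, halfline x -> 0 <= q x) ->
  (\int[mu]_(x in halfline) (q x)%:E < +oo)%E ->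
  (forall E F, measurable E -> measurable F -> E `&` F = set0 ->
     nu (E `|` F) = nu E + nu F) ->
  (forall E I, measurable E -> (wnorm1 q (ind E) <= I%:E)%E -> `|nu E| <= K * I) ->
  exists h : R -> R, [/\ measurable_fun halfline h,
    (\forall y \ae mu, halfline y -> `|h y| <= K * q y) &
    forall E, measurable E -> nu E = \int[mu]_(x in halfline) (h x * \1_E x)].
Proof.
move=> K0 mq q0 qi addnu bnu.
have nu_wn E : measurable E -> wnorm1 q (ind E) = 0%E -> nu E = 0.
  move=> mE E0; apply/eqP; rewrite -normr_le0 -(mulr0 K); apply: bnu => //.
  by rewrite E0.
have wn_dom E : measurable E -> (wnorm1 q (ind E) < +oo)%E.
  move=> mE; apply: le_lt_trans qi; apply: ge0_le_integral => //; first exact: mH.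
  - by move=> x hx; rewrite lee_fin mulr_ge0 ?normc_ge0 ?q0.
  - apply/measurable_EFinP; apply: measurable_funM => //.
    by apply: cmeasurable_normc; exact: cmeasurable_ind.
  - exact/measurable_EFinP.
  - move=> x hx; rewrite lee_fin normc_ind indicE.
    by case: (_ \in _); rewrite ?mul1r ?mul0r ?q0.
have nu0 : nu set0 = 0.
  apply: nu_wn => //; apply: integral0_eq => x _.
  by rewrite normc_ind indic0 mul0r.
pose nuE : set (measurableTypeR R) -> \bar R := fun E => (nu E)%:E.
have nuE0 : nuE set0 = 0%E by rewrite /nuE nu0.
have nuEfin E : measurable E -> nuE E \is a fin_num by [].
have nuEsig : semi_sigma_additive nuE.
  move=> F mF tF mUF.
  pose U n := \big[setU/set0]_(k < n) F k.
  have mU n : measurable (U n) by exact: bigsetU_measurable.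
  have US n : U n `<=` \bigcup_k F k.
    by rewrite /U -bigcup_mkord => x [k _ xk]; exists k.
  have nuU n : nu (U n) = \sum_(0 <= k < n) nu (F k).
    elim: n => [|n IH]; first by rewrite /U big_ord0 big_nil nu0.
    rewrite big_nat_recr//= -IH /U big_ord_recr/= (addnu _ _ (mU n) (mF n))//.
    apply/seteqP; split => // x [+ xn]; rewrite /U -bigcup_mkord => -[k /= kn xk].
    have kn' : k = n by apply: tF => //; exists x.
    by rewrite kn' ltnn in kn.
  have mI : measurable (\bigcup_k F k) by exact: bigcupT_measurable.
  have sumE n : (\sum_(0 <= i < n) nuE (F i))%E = (nu (U n))%:E.
    by rewrite nuU sumEFin.
  rewrite (_ : (fun n => _) = (fun n => (nu (U n))%:E)); last exact/funext.
  apply/fine_cvgP; split; first exact: nearW.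
  apply/cvgrPdist_le => e e0.
  have e1 : 0 < e / (K + 1) by rewrite divr_gt0// ltr_wpDl.
  have [||N HN] := @wnorm1_dominated _ q (ind (\bigcup_k F k)) (fun n => ind (U n)) q
     mq q0 (cmeasurable_ind mI) (fun n => cmeasurable_ind (mU n)) mq q0 qi _ _ _ e1.
  + move=> n x hx; rewrite ler_piMl ?q0//.
    have [xU|xU] := pselect (U n x).
      by rewrite (ind_in xU) (ind_in (US _ _ xU)) subrr normc0.
    by rewrite (ind_out xU) subr0 normc_ind indicE; case: (_ \in _).
  + apply: aeW => x hx; apply: cvg_near_cst.
    have [[k _ xk]|xU] := pselect ((\bigcup_k F k) x).
      exists k.+1 => // n kn.
      have xU : U n x by rewrite /U -bigcup_mkord; exists k.
      by rewrite (ind_in xU) (ind_in (US _ _ xU)) subrr normc0.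
    apply: nearW => n.
    have xn : ~ U n x by move=> /US.
    by rewrite (ind_out xU) (ind_out xn) subr0 normc0.
  + exists N => // n /= Nn.
    have mUn : measurable (\bigcup_k F k `\` U n) by exact: measurableD.
    have -> : nu (\bigcup_k F k) - nu (U n) = nu (\bigcup_k F k `\` U n).
      have {1}-> : \bigcup_k F k = U n `|` (\bigcup_k F k `\` U n).
        apply/seteqP; split => [x Fx|x [/US//|[]//]].
        by have [xU|xU] := pselect (U n x); [left|right].
      rewrite (addnu _ _ (mU n) mUn)//; first by rewrite addrAC subrr add0r.
      by apply/seteqP; split => // x [xU [_]].
    have := bnu _ (e / (K + 1)) mUn.
    move=> /(_ _)/le_trans; apply.
      apply: le_trans (HN n Nn); rewrite le_eqVlt; apply/orP; left; apply/eqP.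
      apply: eq_integral => x _; congr (_ * _)%:E.
      have [xU|xU] := pselect (U n x).
        rewrite (ind_in xU) (ind_in (US _ _ xU)) subrr ind_out ?normc0//.
        by move=> [].
      rewrite (ind_out xU) subr0.
      have [xF|xF] := pselect ((\bigcup_k F k) x).
        by rewrite !ind_in.
      by rewrite !ind_out// => -[].
    rewrite mulrCA ger_pMr// ler_pdivrMr ?mul1r ?lerDl//.
    by rewrite ltr_wpDl.
pose nuC : {charge set (measurableTypeR R) -> \bar R} :=
  HB.pack nuE (isCharge.Build _ _ _ nuE nuE0 nuEfin nuEsig).
have dom : nuC `<< mu.
  move=> N N0 E mE EN; have E0 := N0 E mE EN.
  rewrite /nuC/= /nuE nu_wn// /wnorm1.
  rewrite (ae_eq_integral (cst 0%E)) ?integral0//; first exact: mH.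
  - apply/measurable_EFinP; apply: measurable_funM => //.
    by apply: cmeasurable_normc; exact: cmeasurable_ind.
  - exists E; split => // x /= /not_implyP[_].
    by apply: contra_notP => xE; rewrite ind_out// normc0 mul0r.
have hri := Radon_Nikodym_integrable dom.
have hrfin x := Radon_Nikodym_fin_num x dom.
have hrE := Radon_Nikodym_integral dom.
pose hr := Radon_Nikodym nuC mu.
pose h x := fine (hr x).
have hhr x : (h x)%:E = hr x by rewrite fineK//; exact: hrfin.
have hi : mu.-integrable halfline (EFin \o h).
  rewrite (_ : EFin \o h = hr); last by apply/funext => x; exact: hhr.
  by apply: integrableS hri => //; exact: mH.
have mh : measurable_fun halfline h.
  by case/integrableP : hi => /measurable_EFinP.
have nuh E : measurable E -> nu E = \int[mu]_(x in halfline) (h x * \1_E x).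
  move=> mE.
  have mEH : measurable (halfline `&` E) by apply: measurableI => //; exact: mH.
  have mED : measurable (E `\` halfline) by apply: measurableD => //; exact: mH.
  (* [wnorm1] integrates over the half-line only, so [nu] vanishes on sets of negative reals. *)
  have -> : nu E = nu (halfline `&` E).
    rewrite -{1}(setUIDK E halfline) addnu//; last 2 first.
    - by rewrite setIC.
    - by apply/seteqP; split => // x [[_ ?] []].
    rewrite [X in _ + X]nu_wn// ?addr0 1?setIC//.
    apply: integral0_eq => x hx; rewrite ind_out ?normc0 ?mul0r//.
    by move=> [].
  have cnd : (\int[mu]_(x in halfline `&` E) hr x =
      \int[mu]_(x in halfline) (h x * \1_E x)%:E)%E.
    rewrite integral_mkcondr; apply: eq_integral => x _; rewrite patchE indicE.
    by case: (_ \in _); rewrite ?mulr1 ?mulr0// hhr.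
  have nuE' : (nu (halfline `&` E))%:E = (\int[mu]_(x in halfline) (h x * \1_E x)%:E)%E.
    by rewrite -cnd -hrE.
  by apply: EFin_inj; rewrite nuE' /Rintegral fineK// -nuE'.
have loc (k : R -> R) X : mu.-integrable halfline (EFin \o k) ->
   mu.-integrable halfline (fun x => (k x * \1_(`[0, X[%classic : set R) x)%:E).
  move=> /integrableP[/measurable_EFinP mk ki]; apply/integrableP.
  have mk1 : measurable_fun halfline (fun x => (k x * \1_(`[0, X[%classic : set R) x)%:E).
    by apply/measurable_EFinP; apply: (measurable_funM mk); exact: measurable_funTS.
  split => //; apply: le_lt_trans ki; apply: ge0_le_integral => //; first exact: mH.
  - exact: measurableT_comp.
  - by apply: measurableT_comp => //; exact/measurable_EFinP.
  - move=> x _; rewrite lee_fin normrM ler_piMr// ger0_norm// indic_le1.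
have iq : mu.-integrable halfline (EFin \o q).
  apply/integrableP; split; first exact/measurable_EFinP.
  apply: le_lt_trans qi; rewrite le_eqVlt; apply/orP; left; apply/eqP.
  by apply: eq_integral => x /set_mem hx; rewrite /= ger0_norm ?q0.
have bd E : measurable E -> `|nu E| <= K * \int[mu]_(x in halfline) (q x * \1_E x).
  move=> mE; apply: bnu => //; rewrite /Rintegral fineK.
    rewrite le_eqVlt; apply/orP; left; apply/eqP; apply: eq_integral => x _.
    by rewrite normc_ind mulrC.
  rewrite (_ : (\int[mu]_(x in _) _)%E = wnorm1 q (ind E)); last first.
    by apply: eq_integral => x _; rewrite normc_ind mulrC.
  rewrite ge0_fin_numE ?wn_dom//.
  by apply: integral_ge0 => x hx; rewrite lee_fin mulr_ge0 ?normc_ge0 ?q0.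
have B1 : \forall y \ae mu, halfline y -> h y <= K * q y.
  apply: ae_le_of_integral_le => //; first exact: mH.
  - by move=> X; exact: loc.
  - by move=> X; exact: loc.
  - by move=> E X mE _ _; rewrite -nuh// (le_trans (ler_norm _))// bd.
have B2 : \forall y \ae mu, halfline y -> -1 * h y <= K * q y.
  apply: (@ae_le_of_integral_le (fun y => -1 * h y)) => //; first exact: mH.
  - by apply: measurable_funM => //; exact: measurable_cst.
  - move=> X; apply: (loc (fun y => -1 * h y)).
    exact: (@integrableZl _ _ _ mu halfline mH (-1) (EFin \o h) hi).
  - by move=> X; exact: loc.
  - move=> E X mE _ EX; apply: le_trans (bd E mE).
    under eq_Rintegral do rewrite -mulrA.
    rewrite (@RintegralZl _ _ _ mu halfline _ _ mH).
      by rewrite -nuh// mulN1r -normrN ler_norm.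
    have := loc h X hi.
    move=> /integrableP[mk ki]; apply/integrableP; split.
      by apply/measurable_EFinP; apply: (measurable_funM mh); exact: measurable_funTS.
    apply: le_lt_trans ki; apply: ge0_le_integral => //; first exact: mH.
    + apply: measurableT_comp => //; apply/measurable_EFinP.
      by apply: (measurable_funM mh); exact: measurable_funTS.
    + exact: measurableT_comp.
    + move=> x _; rewrite lee_fin !normrM ler_wpM2l// !indicE.
      case: (boolP (x \in E)) => [/set_mem/EX/mem_set ->//|_].
      by rewrite normr0.
exists h; split => //.
have := ae_and B1 B2; apply: ae_mono => y [b1 b2] hy.
by rewrite ler_norml b1// lerNl -mulN1r b2.
Qed.

End integral_comparison.

(** * Weighted bounds and the action of L^1(w) *)

Section weighted_functions.
Context {R : realType} (w : weight R).
Implicit Types (f g : R -> R[i]) (E : set R).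
Local Notation mu := (@lebesgue_measure R).
Local Notation mH := measurable_halfline.

Lemma measurable_expR_halfline (r : R) :
  measurable_fun halfline (fun x : R => expR (r * x)).
Proof. by apply: measurable_funTS; apply: measurableT_comp. Qed.

Lemma integral_expR (r : R) : 0 < r ->
  (\int[mu]_(x in halfline) (expR (- r * x))%:E = (r^-1)%:E)%E.
Proof.
move=> r0; have := integral_exponential_pdf r0.
rewrite /exponential_pdf/=.
have -> : (fun x : R => ((fun x => r * expR (- r * x)) \_ `[0, +oo[ x)%:E) =
  (fun x => (r * expR (- r * x))%:E) \_ halfline.
  by apply/funext => x; rewrite !patchE; case: ifPn.
rewrite -integral_mkcond => e1.
have e2 : (\int[mu]_(x in halfline) (r * expR (- r * x))%:E =
   r%:E * \int[mu]_(x in halfline) (expR (- r * x))%:E)%E.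
  under eq_integral do rewrite EFinM.
  rewrite ge0_integralZl_EFin//.
  - exact: mH.
  - by apply/measurable_EFinP; exact: measurable_expR_halfline.
  - exact: ltW.
move: e1; rewrite e2 => /(congr1 (fun z => (r^-1)%:E * z)%E).
by rewrite muleA -EFinM mulVf ?gt_eqF// mul1e mule1.
Qed.

Lemma measurable_weight : measurable_fun halfline w.
Proof. exact: (subspace_continuous_measurable_fun mH (@weight_cont _ w)). Qed.

Lemma weight_ge0 x : halfline x -> 0 <= w x.
Proof. by rewrite halflineE => x0; rewrite ltW// weight_gt0. Qed.

Lemma weight_locb (X : R) : 0 <= X -> exists B, forall x, 0 <= x <= X -> w x <= B.
Proof.
move=> X0.
have cw : {within `[0, X], continuous w}.
  apply: continuous_subspaceW (@weight_cont _ w) => x /=.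
  by rewrite !in_itv/= andbT => /andP[].
have [c _ Hc] := EVT_max X0 cw; exists (w c) => x x0X; apply: Hc.
by rewrite in_itv/=.
Qed.

Lemma wnorm1_lin_lty (rho : R -> R) (a : R[i]) f g :
  measurable_fun halfline rho -> (forall x, halfline x -> 0 <= rho x) ->
  cmeasurable f -> cmeasurable g ->
  (wnorm1 rho f < +oo -> wnorm1 rho g < +oo ->
   wnorm1 rho (fun x => (a * f x + g x)%R) < +oo)%E.
Proof.
move=> mrho rho0 mf mg fi gi.
have mf' := cmeasurable_normc mf; have mg' := cmeasurable_normc mg.
have mfr : measurable_fun halfline (fun x => (normc (f x) * rho x)%:E).
  by apply/measurable_EFinP; exact: measurable_funM.
have mgr : measurable_fun halfline (fun x => (normc (g x) * rho x)%:E).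
  by apply/measurable_EFinP; exact: measurable_funM.
have f0 x : halfline x -> (0 <= (normc (f x) * rho x)%:E)%E.
  by move=> hx; rewrite lee_fin mulr_ge0 ?normc_ge0 ?rho0.
have g0 x : halfline x -> (0 <= (normc (g x) * rho x)%:E)%E.
  by move=> hx; rewrite lee_fin mulr_ge0 ?normc_ge0 ?rho0.
have a0 := normc_ge0 a.
apply: (@le_lt_trans _ _ ((normc a)%:E * wnorm1 rho f + wnorm1 rho g)%E); last first.
  by rewrite lte_add_pinfty// lte_mul_pinfty// lee_fin.
rewrite /wnorm1 -ge0_integralZl_EFin//; [|exact: mH].
rewrite -ge0_integralD//; [|exact: mH|by move=> x hx; rewrite mule_ge0 ?f0// lee_fin|
  by apply: emeasurable_funM => //; exact: measurable_cst].
apply: ge0_le_integral => //; first exact: mH.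
- by move=> x hx; rewrite lee_fin mulr_ge0 ?normc_ge0 ?rho0.
- apply/measurable_EFinP; apply: measurable_funM => //.
  by apply: cmeasurable_normc; exact: cmeasurable_lin.
- apply: emeasurable_funD => //; apply: emeasurable_funM => //; exact: measurable_cst.
- move=> x hx; rewrite -EFinM -EFinD lee_fin mulrA -mulrDl ler_wpM2r ?rho0//.
  by rewrite (le_trans (normc_leD _ _))// normcM.
Qed.

Lemma eq_wnorm1 (rho : R -> R) f g : (forall x, halfline x -> f x = g x) ->
  wnorm1 rho f = wnorm1 rho g.
Proof. by move=> fg; apply: eq_integral => x /set_mem hx; rewrite fg. Qed.

Lemma wnorm1_ge0 (rho : R -> R) f : (forall x, halfline x -> 0 <= rho x) ->
  (0 <= wnorm1 rho f)%E.
Proof.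
by move=> rho0; apply: integral_ge0 => x hx; rewrite lee_fin mulr_ge0 ?normc_ge0 ?rho0.
Qed.

(** The norm bound of L_0^oo(w) for an arbitrary function, so that it can be used before membership
    in [L0inf w] is known. *)
Definition wbounded f (M : R) :=
  \forall y \ae mu, halfline y -> normc (f y) <= M * w y.

Lemma L0inf_norm_ge0 (f : L0inf w) : 0 <= L0inf_norm f.
Proof. by rewrite fine_ge0// wess_sup_ge0. Qed.

Lemma L0inf_norm_wbounded (f : L0inf w) : wbounded f (L0inf_norm f).
Proof.
have := valP f; rewrite inE => -[_ bf _].
apply/wess_supP => //; first exact: L0inf_norm_ge0.
by rewrite fineK// ge0_fin_numE// wess_sup_ge0.
Qed.

Lemma L0inf_norm_le (f : L0inf w) M : 0 <= M -> wbounded f M -> L0inf_norm f <= M.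
Proof.
move=> M0 fM.
have le1 : (wess_sup w halfline f <= M%:E)%E by apply/wess_supP.
by rewrite -lee_fin fineK// ge0_fin_numE ?wess_sup_ge0// (le_lt_trans le1)// ltry.
Qed.

Lemma cmeasurable_L0inf (f : L0inf w) : cmeasurable f.
Proof. by have := valP f; rewrite inE => -[]. Qed.

Lemma cmeasurable_L1 (p : L1 w) : cmeasurable p.
Proof. by have := valP p; rewrite inE => -[]. Qed.

Lemma wnorm1_L1 (p : L1 w) : (wnorm1 w p < +oo)%E.
Proof. by have := valP p; rewrite inE => -[]. Qed.

Lemma L1_ex f : cmeasurable f -> (wnorm1 w f < +oo)%E -> exists p : L1 w, p = f :> (R -> R[i]).
Proof.
move=> mf fi; have fL : f \in L1_pred w by rewrite inE.
by exists (MkL1 fL).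
Qed.

(** [L1 w] carries no module structure; linearity on it is always expressed with an [r] that agrees
    pointwise with the combination. *)
Lemma L1_lin_ex (a : R[i]) (p q : L1 w) :
  exists r : L1 w, r = (fun x => a * p x + q x) :> (R -> R[i]).
Proof.
apply: L1_ex; first by apply: cmeasurable_lin; exact: cmeasurable_L1.
apply: wnorm1_lin_lty; try exact: cmeasurable_L1; try exact: wnorm1_L1.
  exact: measurable_weight.
exact: weight_ge0.
Qed.

Lemma wboundedS f M N : M <= N -> wbounded f M -> wbounded f N.
Proof.
move=> MN; apply: ae_mono => y Hy hy; apply: le_trans (Hy hy) _.
by rewrite ler_wpM2r// weight_ge0.
Qed.

Lemma wbounded_lin (a : R[i]) f g M N : wbounded f M -> wbounded g N ->
  wbounded (fun x => a * f x + g x) (normc a * M + N).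
Proof.
move=> fM gN; have := ae_and fM gN; apply: ae_mono => y [fy gy] hy.
rewrite (le_trans (normc_leD _ _))// mulrDl lerD ?gy//.
by rewrite normcM -mulrA ler_wpM2l ?normc_ge0 ?fy.
Qed.

Lemma cmeasurable_shift f x : halfline x -> cmeasurable f ->
  cmeasurable (fun y => f (x + y)).
Proof.
move=> hx [mR mI].
have m1 : measurable_fun halfline (fun _ : R => 1 : R) by exact: measurable_cst.
have m0 : measurable_fun halfline (fun _ : R => 0 : R) by exact: measurable_cst.
have key (k : R -> R) : measurable_fun halfline k ->
    measurable_fun halfline (fun y => k (x + y)).
  move=> mk; have := measurable_conv1 mk mk m1 m0 hx.
  by congr measurable_fun; apply/funext => y; rewrite mulr1 mulr0 addr0.
by split; [exact: (key _ mR)|exact: (key _ mI)].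
Qed.

Lemma wbounded_shift f M x : 0 <= M -> halfline x -> wbounded f M ->
  wbounded (fun y => f (x + y)) (M * w x).
Proof.
rewrite halflineE => M0 x0 fM; have := ae_translate x fM; apply: ae_mono => y Hy.
rewrite halflineE => y0; rewrite (le_trans (Hy _)) ?halflineE ?addr_ge0//.
by rewrite -mulrA ler_wpM2l// weightD.
Qed.

Lemma cintegrable_mul f M p : 0 <= M -> cmeasurable f -> wbounded f M ->
  cmeasurable p -> (wnorm1 w p < +oo)%E -> cintegrable (fun x => f x * p x).
Proof.
move=> M0 mf fM mp pi; have mn := cmeasurable_normc mp.
have mpw : measurable_fun halfline (fun x => normc (p x) * w x).
  by apply: measurable_funM => //; exact: measurable_weight.
apply: (@cintegrable_le _ _ (fun x => M * (normc (p x) * w x))).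
- exact: cmeasurable_mul.
- by apply: measurable_funM => //; exact: measurable_cst.
- by move=> y hy; rewrite !mulr_ge0 ?normc_ge0 ?weight_ge0.
- move: fM; apply: ae_mono => y Hy hy.
  by rewrite normcM [normc (p y) * _]mulrC mulrA ler_wpM2r ?normc_ge0 ?Hy.
under eq_integral do rewrite EFinM.
rewrite ge0_integralZl_EFin//; [|exact: mH| |exact/measurable_EFinP].
  by rewrite lte_mul_pinfty// lee_fin.
by move=> x hx; rewrite lee_fin mulr_ge0 ?normc_ge0 ?weight_ge0.
Qed.

Lemma cintegral_mul_le f M p I : 0 <= M -> cmeasurable f -> wbounded f M ->
  cmeasurable p -> (wnorm1 w p <= I%:E)%E ->
  normc (cintegral (fun x => f x * p x)) <= 2 * (M * I).
Proof.
move=> M0 mf fM mp pI; have mn := cmeasurable_normc mp.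
have mpw : measurable_fun halfline (fun x => normc (p x) * w x).
  by apply: measurable_funM => //; exact: measurable_weight.
apply: (@cintegral_bound _ _ (fun x => M * (normc (p x) * w x))).
- exact: cmeasurable_mul.
- by apply: measurable_funM => //; exact: measurable_cst.
- by move=> y hy; rewrite !mulr_ge0 ?normc_ge0 ?weight_ge0.
- move: fM; apply: ae_mono => y Hy hy.
  by rewrite normcM [normc (p y) * _]mulrC mulrA ler_wpM2r ?normc_ge0 ?Hy.
under eq_integral do rewrite EFinM.
rewrite ge0_integralZl_EFin//; [|exact: mH| |exact/measurable_EFinP].
  by rewrite EFinM lee_wpmul2l// lee_fin.
by move=> x hx; rewrite lee_fin mulr_ge0 ?normc_ge0 ?weight_ge0.
Qed.

Lemma ract_wbounded (f : L0inf w) (p : L1 w) M I : 0 <= M -> wbounded f M ->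
  (wnorm1 w p <= I%:E)%E -> wbounded (ract f p) (2 * (M * I)).
Proof.
move=> M0 fM pI; apply: aeW => x hx.
rewrite -[leLHS]/(normc (cintegral (fun y => f (x + y) * p y))).
rewrite (_ : _ * w x = 2 * (M * w x * I)); last by ring.
apply: cintegral_mul_le => //; last exact: cmeasurable_L1.
- by rewrite mulr_ge0// weight_ge0.
- by apply: cmeasurable_shift => //; exact: cmeasurable_L0inf.
- exact: wbounded_shift.
Qed.

Lemma ract_linl (a : R[i]) (f g h : L0inf w) (p : L1 w) :
  (forall x, halfline x -> h x = a * f x + g x) ->
  forall x, halfline x -> ract h p x = a * ract f p x + ract g p x.
Proof.
move=> hE x hx.
have ci (k : L0inf w) : cintegrable (fun y => k (x + y) * p y).
  apply: cintegrable_mul; last 4 first.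
  - by apply: cmeasurable_shift => //; exact: cmeasurable_L0inf.
  - by apply: wbounded_shift; [exact: L0inf_norm_ge0|by []|exact: L0inf_norm_wbounded].
  - exact: cmeasurable_L1.
  - exact: wnorm1_L1.
  by rewrite mulr_ge0 ?L0inf_norm_ge0 ?weight_ge0.
rewrite -[LHS]/(cintegral (fun y => h (x + y) * p y)).
rewrite -[ract f p x]/(cintegral (fun y => f (x + y) * p y)).
rewrite -[ract g p x]/(cintegral (fun y => g (x + y) * p y)).
rewrite -cintegral_lin//; apply: eq_cintegral => y hy; rewrite hE ?mulrDl ?mulrA//.
by move: hx hy; rewrite !halflineE; exact: addr_ge0.
Qed.

Lemma ract_linr (a : R[i]) (f : L0inf w) (p q r : L1 w) :
  (forall x, halfline x -> r x = a * p x + q x) ->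
  forall x, halfline x -> ract f r x = a * ract f p x + ract f q x.
Proof.
move=> rE x hx.
have ci (k : L1 w) : cintegrable (fun y => f (x + y) * k y).
  apply: cintegrable_mul; last 4 first.
  - by apply: cmeasurable_shift => //; exact: cmeasurable_L0inf.
  - by apply: wbounded_shift; [exact: L0inf_norm_ge0|by []|exact: L0inf_norm_wbounded].
  - exact: cmeasurable_L1.
  - exact: wnorm1_L1.
  by rewrite mulr_ge0 ?L0inf_norm_ge0 ?weight_ge0.
rewrite -[LHS]/(cintegral (fun y => f (x + y) * r y)).
rewrite -[ract f p x]/(cintegral (fun y => f (x + y) * p y)).
rewrite -[ract f q x]/(cintegral (fun y => f (x + y) * q y)).
rewrite -cintegral_lin//; apply: eq_cintegral => y hy; rewrite rE// mulrDr.
by rewrite mulrCA.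
Qed.

End weighted_functions.

(** * The dual of L^1(w), and bounded functionals on L_0^oo(w) *)

Section dual.
Context {R : realType} (w : weight R).
Implicit Types (f g : R -> R[i]) (E : set R).
Local Notation mu := (@lebesgue_measure R).
Local Notation mH := measurable_halfline.

(** Multiplication by [psi] carries L^1(q dx), q = exp(-x), isometrically onto L^1(w). On the finite
    measure q dx all indicators are integrable, so l yields two charges, one for each part; their
    densities give the representing function, and [weighted_L1_density] extends the formula from the
    indicators of [0, a[. *)
Theorem L1_dual_repr (l : L1 w -> R[i]) (K : R) : 0 <= K ->
  (forall (a : R[i]) (p q r : L1 w), (forall x, halfline x -> r x = a * p x + q x) ->
     l r = a * l p + l q) ->
  (forall (p : L1 w) I, (wnorm1 w p <= I%:E)%E -> normc (l p) <= K * I) ->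
  exists g : R -> R[i], [/\ cmeasurable g, wbounded w g (2 * K) &
    forall p : L1 w, cintegral (fun x => g x * p x) = l p].
Proof.
move=> K0 llin lbd.
pose q (x : R) := expR (- 1 * x).
have mq : measurable_fun halfline q by exact: measurable_expR_halfline.
have q0 x : halfline x -> 0 <= q x by move=> _; exact: expR_ge0.
have qi : (\int[mu]_(x in halfline) (q x)%:E < +oo)%E.
  by rewrite integral_expR// ltry.
(* Chosen so that [psi] = exp(-u) = exp(-x) / w on the half-line. *)
pose u (x : R) := x + ln (w x).
have mlnw : measurable_fun halfline (fun x => ln (w x)).
  by apply: (measurableT_comp (@measurable_ln R)); exact: measurable_weight.
have mu' : measurable_fun halfline u by exact: measurable_funD.
pose psi x := expR (- u x); pose psiV x := expR (u x).
have mpsiV : measurable_fun halfline psiV.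
  exact: (measurableT_comp (@measurable_expR R)).
have mpsi : measurable_fun halfline psi.
  by apply: (measurableT_comp (@measurable_expR R)); exact: measurable_funN.
have psiK x : psi x * psiV x = 1 by rewrite /psi /psiV -expRD addNr expR0.
have psiw x : halfline x -> psi x * w x = q x.
  rewrite halflineE => x0; have w0 := weight_gt0 w x0.
  rewrite -{1}[w x]lnK ?posrE// -expRD; congr expR.
  by rewrite /u; ring.
have psi0 x : 0 <= psi x by exact: expR_ge0.
have wn_psi f : wnorm1 w (fun x => (psi x)%:C * f x) = wnorm1 q f.
  apply: eq_integral => x /set_mem hx.
  by rewrite normcM normc_real ger0_norm// mulrAC psiw// mulrC.
have cpsi : cmeasurable (fun x => (psi x)%:C) by exact: cmeasurable_real.
have cpsiV : cmeasurable (fun x => (psiV x)%:C) by exact: cmeasurable_real.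
have ex f : cmeasurable f -> (wnorm1 q f < +oo)%E ->
    exists p : L1 w, p = (fun x => (psi x)%:C * f x) :> (R -> R[i]).
  by move=> mf fi; apply: L1_ex; [exact: cmeasurable_mul|rewrite wn_psi].
have ind_fin E : measurable E -> (wnorm1 q (ind E) < +oo)%E.
  move=> mE; apply: le_lt_trans qi; apply: ge0_le_integral => //; first exact: mH.
  - by move=> x hx; rewrite lee_fin mulr_ge0 ?normc_ge0 ?q0.
  - apply/measurable_EFinP; apply: measurable_funM => //.
    by apply: cmeasurable_normc; exact: cmeasurable_ind.
  - exact/measurable_EFinP.
  - by move=> x hx; rewrite lee_fin normc_ind ler_piMl ?q0// indic_le1.
(* A choice for every set is needed to define [Ph]; a non-measurable set gets the indicator of the
   empty set as a default. *)
have pick (E : set R) : exists p : L1 w, measurable E ->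
    p = (fun x => (psi x)%:C * ind E x) :> (R -> R[i]).
  have [mE|nE] := pselect (measurable E).
    by have [p pE] := ex _ (cmeasurable_ind mE) (ind_fin _ mE); exists p.
  have m0 : measurable (set0 : set R) by [].
  by have [p pE] := ex _ (cmeasurable_ind m0) (ind_fin _ m0); exists p.
pose Ph E := sval (cid (pick E)).
have PhE E : measurable E -> Ph E = (fun x => (psi x)%:C * ind E x) :> (R -> R[i]).
  by move=> mE; exact: (svalP (cid (pick E)) mE).
have lD E F : measurable E -> measurable F -> E `&` F = set0 ->
    l (Ph (E `|` F)) = l (Ph E) + l (Ph F).
  move=> mE mF EF; rewrite -[l (Ph E)]mul1r; apply: llin => x hx.
  rewrite !PhE//; last exact: measurableU.
  rewrite mul1r -mulrDr; congr (_ * _); rewrite /ind -rmorphD; congr (_%:C).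
  rewrite !indicE in_setU; case: (boolP (x \in E)) => [/set_mem xE|_]; last by rewrite add0r.
  case: (boolP (x \in F)) => [/set_mem xF|_]; last by rewrite addr0.
  have : (E `&` F) x by [].
  by rewrite EF.
have lB E I : measurable E -> (wnorm1 q (ind E) <= I%:E)%E -> normc (l (Ph E)) <= K * I.
  by move=> mE EI; apply: lbd; rewrite PhE// wn_psi.
have [hR [mhR bR RE]] := @charge_density R (fun E => complex.Re (l (Ph E))) q K K0 mq q0 qi
  (fun E F mE mF EF => etrans (congr1 (@complex.Re R) (lD E F mE mF EF)) (Defs.ReD _ _))
  (fun E I mE EI => le_trans (normc_Re _) (lB E I mE EI)).
have [hI [mhI bI IE]] := @charge_density R (fun E => complex.Im (l (Ph E))) q K K0 mq q0 qi
  (fun E F mE mF EF => etrans (congr1 (@complex.Im R) (lD E F mE mF EF)) (Defs.ImD _ _))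
  (fun E I mE EI => le_trans (normc_Im _) (lB E I mE EI)).
pose g0 x : R[i] := Complex (hR x) (hI x).
have mg0 : cmeasurable g0 by split.
have bg0 : \forall y \ae mu, halfline y -> normc (g0 y) <= 2 * K * q y.
  have := ae_and bR bI; apply: ae_mono => y [b1 b2] hy.
  rewrite (le_trans (normc_le_ReIm _))//=.
  rewrite (_ : 2 * K * q y = K * q y + K * q y) ?lerD ?b1 ?b2//.
  by rewrite -mulrA mulr_natl mulr2n.
have ig0 f : cmeasurable f -> (wnorm1 q f < +oo)%E -> cintegrable (fun x => g0 x * f x).
  move=> mf fi; have mn := cmeasurable_normc mf.
  apply: (@cintegrable_le _ _ (fun x => 2 * K * (normc (f x) * q x))).
  - exact: cmeasurable_mul.
  - by apply: measurable_funM => //; exact: measurable_funM.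
  - by move=> y hy; rewrite !mulr_ge0 ?normc_ge0 ?q0.
  - move: bg0; apply: ae_mono => y Hy hy.
    by rewrite normcM [normc (f y) * _]mulrC mulrA ler_wpM2r ?normc_ge0 ?Hy.
  under eq_integral do rewrite EFinM.
  rewrite ge0_integralZl_EFin//; [|exact: mH| | |].
  - by rewrite lte_mul_pinfty// lee_fin mulr_ge0.
  - by move=> x hx; rewrite lee_fin mulr_ge0 ?normc_ge0 ?q0.
  - by apply/measurable_EFinP; exact: measurable_funM.
  - by rewrite mulr_ge0.
have lg0 f I : cmeasurable f -> (wnorm1 q f <= I%:E)%E ->
    normc (cintegral (fun x => g0 x * f x)) <= 2 * (2 * K * I).
  move=> mf fi; have mn := cmeasurable_normc mf.
  apply: (@cintegral_bound _ _ (fun x => 2 * K * (normc (f x) * q x))).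
  - exact: cmeasurable_mul.
  - by apply: measurable_funM => //; exact: measurable_funM.
  - by move=> y hy; rewrite !mulr_ge0 ?normc_ge0 ?q0.
  - move: bg0; apply: ae_mono => y Hy hy.
    by rewrite normcM [normc (f y) * _]mulrC mulrA ler_wpM2r ?normc_ge0 ?Hy.
  under eq_integral do rewrite EFinM.
  rewrite ge0_integralZl_EFin//; [|exact: mH| | |].
  - by rewrite [X in (_ <= X)%E]EFinM lee_wpmul2l// lee_fin mulr_ge0.
  - by move=> x hx; rewrite lee_fin mulr_ge0 ?normc_ge0 ?q0.
  - by apply/measurable_EFinP; exact: measurable_funM.
  - by rewrite mulr_ge0.
pose Q f := [/\ cmeasurable f, (wnorm1 q f < +oo)%E & exists2 p : L1 w,
  p = (fun x => (psi x)%:C * f x) :> (R -> R[i]) & l p = cintegral (fun x => g0 x * f x)].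
have Qlin (a : R[i]) f1 f2 : Q f1 -> Q f2 -> Q (fun x => a * f1 x + f2 x).
  move=> [m1 i1 [p1 p1E l1]] [m2 i2 [p2 p2E l2]].
  have m12 := cmeasurable_lin a m1 m2.
  have i12 := wnorm1_lin_lty a mq q0 m1 m2 i1 i2.
  split => //; have [p pE] := ex _ m12 i12; exists p => //.
  rewrite (llin a p1 p2 p); last first.
    by move=> x _; rewrite pE p1E p2E mulrDr mulrCA.
  rewrite l1 l2 -cintegral_lin; [|exact: ig0|exact: ig0].
  by apply: eq_cintegral => x _; rewrite mulrDr mulrCA.
have Qall : forall f, (wnorm1 q f < +oo)%E -> cmeasurable f -> (wnorm1 q f < +oo)%E -> Q f.
  apply: (@weighted_L1_density R q (fun f => (wnorm1 q f < +oo)%E) Q mq q0) => //.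
  - move=> X X0; exists 1 => x /andP[x0 _].
    by rewrite /q mulN1r expRN invf_le1 ?expR_gt0// -expR0 ler_expR.
  - have m0 : cmeasurable (fun=> 0 : R[i]) by exact: cmeasurable_cst.
    have i0 : wnorm1 q (fun=> 0) = 0%E.
      by apply: integral0_eq => x _; rewrite normc0 mul0r.
    split; [by []|by rewrite i0 ltry|].
    have [p pE] := ex _ m0 (eq_ind_r (fun z => (z < +oo)%E) (ltry 0) i0).
    exists p => //.
    have -> : l p = 0.
      apply: eq0_normc; apply/eqP; rewrite eq_le normc_ge0 andbT -(mulr0 K).
      by apply: lbd; rewrite pE wn_psi i0.
    apply/esym/eq0_normc/eqP; rewrite eq_le normc_ge0 andbT.
    by have := lg0 _ 0 m0; rewrite i0 !mulr0; apply.
  - move=> f fi mf appr; split => //.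
    have [p pE] := ex _ mf fi; exists p => //.
    apply/eqP; rewrite -subr_eq0; apply/eqP; apply: eq0_normc; apply/eqP.
    rewrite eq_le normc_ge0 andbT; apply/ler_addgt0Pr => e e0; rewrite add0r.
    (* K comes from the bound on [l], 4 * K from the bound [lg0] on the integral, and 1 keeps the
       denominator positive. *)
    have d0 : 0 < e / (K + 4 * K + 1) by rewrite divr_gt0// ltr_wpDl// addr_ge0// mulr_ge0.
    have [g [[mg gi [pg pgE lgE]] _ fg]] := appr _ d0.
    set d := e / _ in d0 fg.
    have [r rE] : exists r : L1 w, r = (fun x => -1 * pg x + p x) :> (R -> R[i]).
      exact: L1_lin_ex.
    have lr := llin (-1) pg p r (fun x _ => congr1 (@^~ x) rE).
    have b1 : normc (l r) <= K * d.
      apply: lbd; rewrite (@eq_wnorm1 _ w _ (fun x => (psi x)%:C * (f x - g x))) ?wn_psi// => x _.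
      by rewrite rE pgE pE mulrBr mulN1r addrC.
    have mfg : cmeasurable (fun x => f x - g x) by exact: cmeasurableB.
    have b2 := lg0 _ d mfg fg.
    have -> : l p - cintegral (fun x => g0 x * f x) = l r - cintegral (fun x => g0 x * (f x - g x)).
      rewrite lr lgE.
      rewrite (@eq_cintegral _ (fun x => g0 x * (f x - g x)) (fun x => -1 * (g0 x * g x) + g0 x * f x)); last first.
        by move=> x _; ring.
      rewrite cintegral_lin; [|exact: ig0|exact: ig0].
      by ring.
    rewrite (le_trans (normc_leD _ _))// normcN.
    apply: (@le_trans _ _ (K * d + 2 * (2 * K * d))); first by rewrite lerD.
    rewrite (_ : _ + _ = (K + 4 * K) * d); last by ring.
    rewrite /d mulrCA ger_pMr// ler_pdivrMr ?mul1r ?lerDl//.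
    by rewrite ltr_wpDl// addr_ge0// mulr_ge0.
  - by move=> E X mE _; exact: ind_fin.
  - move=> a a0; have ma : measurable (`[0, a[%classic : set R) by [].
    split; [exact: cmeasurable_ind|exact: ind_fin|].
    exists (Ph `[0, a[%classic); first exact: PhE.
    have := RE _ ma; have := IE _ ma.
    case: (l _) => x y /= -> ->; congr Complex; apply: eq_Rintegral => z _.
      by rewrite ReM /= mulr0 subr0.
    by rewrite ImM /= mulr0 add0r.
exists (fun x => (psiV x)%:C * g0 x); split.
- exact: cmeasurable_mul.
- move: bg0; apply: ae_mono => y Hy hy.
  rewrite normcM normc_real ger0_norm ?expR_ge0//.
  apply: (le_trans (ler_wpM2l (expR_ge0 _) (Hy hy))).
  by rewrite -psiw// mulrCA [X in _ * X]mulrA [psiV y * _]mulrC psiK mul1r.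
- move=> p; pose f x := (psiV x)%:C * p x.
  have mf : cmeasurable f by apply: cmeasurable_mul => //; exact: cmeasurable_L1.
  have pf x : (psi x)%:C * f x = p x by rewrite /f mulrA -rmorphM psiK mul1r.
  have fi : (wnorm1 q f < +oo)%E.
    rewrite -wn_psi (_ : wnorm1 w _ = wnorm1 w p) ?wnorm1_L1//.
    by apply: eq_wnorm1 => x _; exact: pf.
  have [_ _ [p' p'E lp']] := Qall f fi mf fi.
  have -> : l p = l p'.
    congr l; apply/val_inj => /=; rewrite p'E; apply/funext => x; by rewrite pf.
  by rewrite lp'; apply: eq_cintegral => x hx; rewrite /f; ring.
Qed.

Lemma dual_lin (m : L0inf_dual w) (a : R[i]) (f g : L0inf w) :
  m (a *: f + g) = a * m f + m g.
Proof. by have := valP m; rewrite inE => -[lm _]; exact: lm. Qed.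

Lemma dual_eq (m : L0inf_dual w) (a : R[i]) (f g h : L0inf w) :
  (\forall x \ae mu, halfline x -> h x = a * f x + g x) ->
  m h = a * m f + m g.
Proof.
by move=> hE; rewrite -dual_lin; apply: L0inf_dual_ae; exact: hE.
Qed.

(** The operator norm is at most C. The a.e. bound M in place of [L0inf_norm f] lets estimates be
    chained through [wbounded], and [m] may be a plain map not yet known to be in the dual. *)
Definition dual_le (m : L0inf w -> R[i]) (C : R) :=
  forall (f : L0inf w) M, 0 <= M -> wbounded w f M -> normc (m f) <= C * M.

Lemma dual_bounded (m : L0inf_dual w) : exists2 C, 0 <= C & dual_le m C.
Proof.
have := valP m; rewrite inE => -[_ [C mC]].
exists (Num.max C 0); first by rewrite le_max lexx orbT.
move=> f M M0 fM; apply: le_trans (mC f) _.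
apply: (@le_trans _ _ (Num.max C 0 * L0inf_norm f)).
  by rewrite ler_wpM2r ?L0inf_norm_ge0// le_max lexx.
by rewrite ler_wpM2l ?le_max ?lexx ?orbT// L0inf_norm_le.
Qed.

Lemma dual_in (m : L0inf w -> R[i]) (C : R) :
  (forall (a : R[i]) (f g : L0inf w), m (a *: f + g) = a * m f + m g) ->
  dual_le m C -> m \in @L0inf_dual_pred R w.
Proof.
move=> mlin mC; rewrite inE; split; first exact: mlin.
by exists C => f; apply: mC; [exact: L0inf_norm_ge0|exact: L0inf_norm_wbounded].
Qed.

Lemma L0inf_ex f (M : R) : cmeasurable f -> 0 <= M -> wbounded w f M ->
  (forall e : R, 0 < e -> exists2 X : R, 0 <= X &
     \forall y \ae mu, X < y -> normc (f y) <= e * w y) ->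
  exists F : L0inf w, F = f :> (R -> R[i]).
Proof.
move=> mf M0 fM tf.
have fP : f \in L0inf_pred w by apply/L0infP; split => //; exists M.
by exists (MkL0inf fP).
Qed.

Lemma L0inf_tail (f : L0inf w) (e : R) : 0 < e -> exists2 X : R, 0 <= X &
     \forall y \ae mu, X < y -> normc (f y) <= e * w y.
Proof. by have /L0infP[_ _ tf] := valP f; exact: tf. Qed.

End dual.

(** * The first Arens product *)

Section arens_product.
Context {R : realType} {w : weight R}.
Implicit Types (f g : L0inf w) (m n : L0inf_dual w) (p q : L1 w) (E : set R).
Local Notation mu := (@lebesgue_measure R).
Local Notation mH := measurable_halfline.

Lemma cintegral0 : cintegral (fun=> 0 : R[i]) = 0 :> R[i].
Proof. by rewrite /cintegral /Rintegral /= !integral0. Qed.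

Lemma wnorm1_ind_fin E X : measurable E -> E `<=` `[0, X[ ->
  (wnorm1 w (ind E) < +oo)%E.
Proof.
move=> mE EX.
have [X0|X0] := leP 0 X; last first.
  have E0 x : ~ E x.
    move=> /EX /=; rewrite in_itv/= => /andP[x0 xX].
    by have := lt_trans (le_lt_trans x0 xX) X0; rewrite ltxx.
  rewrite /wnorm1 integral0_eq ?ltry// => x _.
  by rewrite ind_out ?normc0 ?mul0r//; exact: E0.
have [B HB] := weight_locb w X0.
have B0 : 0 <= B.
  by apply: le_trans (HB 0 _); rewrite ?lexx// weight0 ler01.
apply: (@le_lt_trans _ _ (\int[mu]_(x in halfline) (B * \1_(`[0, X[%classic : set R) x)%:E)%E).
  apply: ge0_le_integral => //; first exact: mH.
  - by move=> x hx; rewrite lee_fin mulr_ge0 ?normc_ge0 ?weight_ge0.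
  - apply/measurable_EFinP; apply: measurable_funM; last exact: measurable_weight.
    by apply: cmeasurable_normc; exact: cmeasurable_ind.
  - apply/measurable_EFinP; apply: measurable_funM => //; exact: measurable_funTS.
  - move=> x hx; rewrite lee_fin normc_ind !indicE.
    case: (boolP (x \in E)) => [/set_mem/EX xX|_]; last by rewrite mul0r mulr_ge0.
    rewrite (mem_set xX) mul1r mulr1; apply: HB.
    by move: xX; rewrite /= in_itv/= => /andP[-> /ltW].
under eq_integral do rewrite EFinM.
rewrite ge0_integralZl_EFin//; [|exact: mH|]; last first.
  by apply/measurable_EFinP; exact: measurable_funTS.
rewrite integral_indic//; last exact: mH.
rewrite lte_mul_pinfty//; apply: (@le_lt_trans _ _ (mu `[0, X[)).
  by apply: le_measure => //; rewrite inE; [apply: measurableI => //; exact: mH|].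
by rewrite lebesgue_measure_itv/=; case: ifPn => // _; rewrite -EFinD ltry.
Qed.

Lemma L1_ind_ex E X : measurable E -> E `<=` `[0, X[ ->
  exists p, p = ind E :> (R -> R[i]).
Proof.
move=> mE EX; apply: L1_ex; first exact: cmeasurable_ind.
exact: wnorm1_ind_fin EX.
Qed.

(** Integral comparison is applied to the real parts of c g for c = 1, -1, i, -i. A general D is
    allowed because the decay of [arens_act n f] is obtained by testing on sets beyond X. *)
Lemma ae_normc_le_of_cintegral_le (g : R -> R[i]) (D : set R) (M K : R) :
  0 <= M -> cmeasurable g -> wbounded w g M ->
  measurable D -> D `<=` halfline -> 0 <= K ->
  (forall E X p I, measurable E -> E `<=` D -> E `<=` `[0, X[ ->
     p = ind E :> (R -> R[i]) -> (wnorm1 w p <= I%:E)%E ->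
     normc (cintegral (fun x => g x * p x)) <= K * I) ->
  \forall y \ae mu, D y -> normc (g y) <= 2 * K * w y.
Proof.
move=> M0 mg gM mD DH K0 hg.
have indI (k : R -> R) X : measurable_fun halfline k ->
    (\forall y \ae mu, halfline y -> `|k y| <= M * w y) ->
    mu.-integrable halfline (fun x => (k x * \1_(`[0, X[%classic : set R) x)%:E).
  move=> mk kM.
  have [p pE] := @L1_ind_ex `[0, X[ X (measurable_itv _) (@subset_refl _ _).
  have ci : cintegrable (fun x => (k x)%:C * p x).
    apply: (cintegrable_mul M0); [exact: cmeasurable_real| |exact: cmeasurable_L1|exact: wnorm1_L1].
    by move: kM; apply: ae_mono => y Hy hy; rewrite normc_real Hy.
  have := cintegrable_Re ci; congr (integrable _ _ _); apply/funext => x /=.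
  by rewrite pE Defs.ReM /= mul0r subr0.
have key (c : R[i]) : normc c = 1 ->
    \forall y \ae mu, D y -> complex.Re (c * g y) <= K * w y.
  move=> c1.
  have mcg : cmeasurable (fun y => c * g y).
    by apply: cmeasurable_mul => //; exact: cmeasurable_cst.
  apply: ae_le_of_integral_le => //.
  - by case: mcg.
  - exact: measurable_weight.
  - move=> X; apply: indI; first by case: mcg.
    move: gM; apply: ae_mono => y Hy hy; apply: le_trans (normc_Re _) _.
    by rewrite normcM c1 mul1r Hy.
  - move=> X.
    have [p pE] := @L1_ind_ex `[0, X[ X (measurable_itv _) (@subset_refl _ _).
    have ci : cintegrable (fun x => (w x)%:C * p x).
      apply: (@cintegrable_mul _ w _ 1); [by []| | |exact: cmeasurable_L1|exact: wnorm1_L1].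
        by apply: cmeasurable_real; exact: measurable_weight.
      by apply: aeW => y hy; rewrite normc_real ger0_norm ?mul1r// weight_ge0.
    have := cintegrable_Re ci; congr (integrable _ _ _); apply/funext => x /=.
    by rewrite pE Defs.ReM /= mul0r subr0.
  - move=> E X mE ED EX; have [p pE] := L1_ind_ex mE EX.
    have wI : (wnorm1 w p <= (\int[mu]_(x in halfline) (w x * \1_E x))%:E)%E.
      have e1 : (\int[mu]_(x in halfline) (w x * \1_E x)%:E)%E = wnorm1 w p.
        by apply: eq_integral => x _; rewrite pE normc_ind mulrC.
      rewrite /Rintegral e1 fineK// ge0_fin_numE ?wnorm1_L1// wnorm1_ge0//.
      exact: weight_ge0.
    apply: le_trans (hg E X p _ mE ED EX pE wI).
    have -> : \int[mu]_(x in halfline) (complex.Re (c * g x) * \1_E x) =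
        complex.Re (c * cintegral (fun x => g x * p x)).
      have ci : cintegrable (fun x => g x * p x).
        by apply: (cintegrable_mul M0 mg gM); [exact: cmeasurable_L1|exact: wnorm1_L1].
      have c0 : cintegrable (fun=> 0 : R[i]).
        split; first exact: cmeasurable_cst.
        by rewrite integral0_eq ?ltry// => x _; rewrite normc0.
      have := cintegral_lin c ci c0; rewrite cintegral0 addr0 => <-.
      by apply: eq_Rintegral => x _; rewrite addr0 mulrA pE [RHS]Defs.ReM /= mulr0 subr0.
    by rewrite (le_trans (ler_norm _))// (le_trans (normc_Re _))// normcM c1 mul1r.
have n1 : normc (1 : R[i]) = 1 by exact: normc1.
have ni : normc ('i : R[i]) = 1 by rewrite /normc/= expr0n expr1n add0r sqrtr1.
have B1 := key 1 n1.
have B2 : \forall y \ae mu, D y -> complex.Re (-1 * g y) <= K * w y.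
  by apply: key; rewrite normcN.
have B3 := key 'i ni.
have B4 : \forall y \ae mu, D y -> complex.Re (- 'i * g y) <= K * w y.
  by apply: key; rewrite normcN.
have := ae_and (ae_and B1 B2) (ae_and B3 B4); apply: ae_mono => y [[b1 b2] [b3 b4]] Dy.
rewrite (le_trans (normc_le_ReIm _))//.
rewrite (_ : 2 * K * w y = K * w y + K * w y); last by rewrite -mulrA mulr_natl mulr2n.
move: (b1 Dy) (b2 Dy) (b3 Dy) (b4 Dy).
case: (g y) => u v /= c1 c2 c3 c4.
by rewrite lerD// ler_norml; apply/andP; split; lra.
Qed.

(** The previous estimate with K = 0, applied to the difference. *)
Lemma L0inf_ae_eq f g : (forall E X p, measurable E -> E `<=` `[0, X[ ->
     p = ind E :> (R -> R[i]) ->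
     cintegral (fun x => f x * p x) = cintegral (fun x => g x * p x)) ->
  \forall x \ae mu, halfline x -> f x = g x.
Proof.
move=> fg.
have mfg : cmeasurable (fun x => -1 * g x + f x).
  by apply: cmeasurable_lin; exact: cmeasurable_L0inf.
have bfg := wbounded_lin (-1) (L0inf_norm_wbounded g) (L0inf_norm_wbounded f).
have M0 : 0 <= normc (-1 : R[i]) * L0inf_norm g + L0inf_norm f.
  by rewrite addr_ge0 ?mulr_ge0 ?normc_ge0 ?L0inf_norm_ge0.
have := ae_normc_le_of_cintegral_le M0 mfg bfg mH (@subset_refl _ _) (lexx 0).
move=> /(_ _)/wrap[].
  move=> E X p I mE _ EX pE _.
  have ci (k : L0inf w) : cintegrable (fun x => k x * p x).
    apply: (cintegrable_mul (L0inf_norm_ge0 k)); [exact: cmeasurable_L0inf|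
      exact: L0inf_norm_wbounded|exact: cmeasurable_L1|exact: wnorm1_L1].
  rewrite (@eq_cintegral _ _ (fun x => -1 * (g x * p x) + f x * p x)); last first.
    by move=> x _; rewrite mulrDl mulrA.
  by rewrite cintegral_lin// (fg E X p mE EX pE) mulN1r addNr normc0 mul0r.
apply: ae_mono => y Hy hy; have := Hy hy; rewrite mulr0 mul0r => le0.
have /eq0_normc : normc (-1 * g y + f y) = 0.
  by apply/eqP; rewrite eq_le le0 normc_ge0.
by rewrite mulN1r addrC => /eqP; rewrite subr_eq0 => /eqP.
Qed.

(** If p lives beyond X, then [ract f p] sees only f beyond X, so f may be replaced by its small
    tail g. This is what makes [arens_act n f] vanish at infinity. *)
Lemma ract_tail f (d X : R) : 0 <= d -> 0 <= X ->
  (\forall y \ae mu, X < y -> normc (f y) <= d * w y) ->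
  exists g, wbounded w g d /\ forall p E, p = ind E :> (R -> R[i]) -> E `<=` `]X, +oo[ ->
    forall x, halfline x -> ract f p x = ract g p x.
Proof.
move=> d0 X0 fd.
have mX : measurable (`]X, +oo[%classic : set R) by [].
have bg : wbounded w (fun x => f x * ind `]X, +oo[ x) d.
  move: fd; apply: ae_mono => y Hy hy.
  have [Xy|Xy] := pselect (`]X, +oo[%classic y).
    by rewrite ind_in// mulr1 Hy//; move: Xy; rewrite /= in_itv/= andbT.
  by rewrite ind_out// mulr0 normc0 mulr_ge0 ?weight_ge0.
have [|e e0|g gE] := @L0inf_ex _ w (fun x => f x * ind `]X, +oo[ x) d _ d0 bg.
- by apply: cmeasurable_mul; [exact: cmeasurable_L0inf|exact: cmeasurable_ind].
- have [Y Y0 HY] := L0inf_tail f e0; exists Y => //.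
  move: HY; apply: ae_mono => y Hy Yy; rewrite normcM normc_ind.
  by apply: le_trans (Hy Yy); rewrite ler_piMr ?normc_ge0// indic_le1.
- exists g; split; first by rewrite gE.
  move=> p E pE EX x hx.
  rewrite -[LHS]/(cintegral (fun y => f (x + y) * p y)).
  rewrite -[RHS]/(cintegral (fun y => g (x + y) * p y)).
  apply: eq_cintegral => y hy; rewrite gE pE.
  have [yE|yE] := pselect (E y); last by rewrite (ind_out yE) !mulr0.
  rewrite (ind_in yE) !mulr1 ind_in ?mulr1//.
  have /= := EX _ yE; rewrite !in_itv/= !andbT => Xy.
  by rewrite (lt_le_trans Xy)// lerDr -halflineE.
Qed.

Lemma dual_ract_linr n f (a : R[i]) p q (r : L1 w) :
  (forall x, halfline x -> r x = a * p x + q x) ->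
  n (ract f r) = a * n (ract f p) + n (ract f q).
Proof.
move=> rE; apply: dual_eq; apply: aeW => x hx; exact: ract_linr.
Qed.

Lemma dual_ract_linl n f g (h : L0inf w) (a : R[i]) p :
  (forall x, halfline x -> h x = a * f x + g x) ->
  n (ract h p) = a * n (ract f p) + n (ract g p).
Proof.
move=> hE; apply: dual_eq; apply: aeW => x hx; exact: ract_linl.
Qed.

Lemma dual_ract_le n f p (C M I : R) : 0 <= C -> dual_le n C -> 0 <= M ->
  wbounded w f M -> (wnorm1 w p <= I%:E)%E -> normc (n (ract f p)) <= 2 * C * M * I.
Proof.
move=> C0 nC M0 fM pI.
have I0 : 0 <= I.
  by rewrite -lee_fin (le_trans _ pI)// wnorm1_ge0//; exact: weight_ge0.
rewrite (_ : _ * I = C * (2 * (M * I))); last by ring.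
by apply: nC; [rewrite !mulr_ge0|exact: ract_wbounded].
Qed.

(** Duality represents p |-> n (ract f p) by a weighted bounded function. The remaining point is its
    decay: tested on sets beyond X, the functional depends on the tail of f alone. *)
Lemma arens_act_ex n f :
  exists g, forall p, cintegral (fun x => g x * p x) = n (ract f p).
Proof.
have [C C0 nC] := dual_bounded n.
have F0 := L0inf_norm_ge0 f; have fF := L0inf_norm_wbounded f.
have K0 : 0 <= 2 * C * L0inf_norm f by rewrite !mulr_ge0.
have [g [mg gb gE]] := @L1_dual_repr R w (fun p => n (ract f p)) _ K0
   (fun a p q r rE => dual_ract_linr n f rE)
   (fun p I pI => dual_ract_le C0 nC F0 fF pI).
have M0 : 0 <= 2 * (2 * C * L0inf_norm f) by rewrite !mulr_ge0.
have [e e0|G GE] := L0inf_ex mg M0 gb; last by exists G => p; rewrite GE gE.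
have C1 : 0 < 4 * C + 1 by rewrite ltr_wpDl// mulr_ge0.
(* 4 * C is the loss between the tail of f and that of g: a factor 2 * C for the functional, then 2
   for the pointwise bound. *)
have d0 : 0 < e / (4 * C + 1) by rewrite divr_gt0.
have [X X0 fX] := L0inf_tail f d0; exists X => //.
have [h [hd hE]] := ract_tail (ltW d0) X0 fX.
have mX : measurable (`]X, +oo[%classic : set R) by [].
have XH : `]X, +oo[%classic `<=` (halfline : set R).
  move=> x /=; rewrite in_itv/= andbT halflineE => Xx.
  by rewrite ltW// (le_lt_trans X0).
have Kd0 : 0 <= 2 * C * (e / (4 * C + 1)) by rewrite mulr_ge0 ?(ltW d0)// mulr_ge0.
have := ae_normc_le_of_cintegral_le M0 mg gb mX XH Kd0.
move=> /(_ _)/wrap[].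
  move=> E Y p I mE EX EY pE pI; rewrite gE.
  rewrite (@L0inf_dual_ae _ _ n (ract f p) (ract h p)).
    by apply: dual_ract_le => //; exact: ltW.
  by apply: aeW => x hx; exact: hE pE EX x hx.
apply: ae_mono => y Hy Xy.
have hy : `]X, +oo[%classic y by rewrite /= in_itv/= andbT.
apply: le_trans (Hy hy) _; rewrite ler_wpM2r ?weight_ge0//; first exact: XH.
have -> : 2 * (2 * C * (e / (4 * C + 1))) = 4 * C * (e / (4 * C + 1)).
  by rewrite !mulrA -natrM.
by rewrite mulrCA ger_pMr// ler_pdivrMr// mul1r lerDl.
Qed.

Lemma arens_actE n f p : cintegral (fun x => arens_act n f x * p x) = n (ract f p).
Proof.
have [g gE] := arens_act_ex n f.
have := @xgetPex _ 0 [set g : L0inf w | forall phi : L1 w,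
    cintegral (fun x => g x * phi x) = n (ract f phi)].
by move=> /(_ (ex_intro _ g gE)); apply.
Qed.

Lemma arens_act_unique n f g :
  (forall E X p, measurable E -> E `<=` `[0, X[ -> p = ind E :> (R -> R[i]) ->
     cintegral (fun x => g x * p x) = n (ract f p)) ->
  \forall x \ae mu, halfline x -> arens_act n f x = g x.
Proof.
move=> gE; apply: L0inf_ae_eq => E X p mE EX pE.
by rewrite arens_actE (gE E X p mE EX pE).
Qed.

Lemma arens_act_wbounded n f (C M : R) : 0 <= C ->  dual_le n C -> 0 <= M ->
  wbounded w f M -> wbounded w (arens_act n f) (4 * C * M).
Proof.
move=> C0 nC M0 fM.
have K0 : 0 <= 2 * C * M by rewrite !mulr_ge0.
have := ae_normc_le_of_cintegral_le (L0inf_norm_ge0 (arens_act n f))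
  (cmeasurable_L0inf _) (@L0inf_norm_wbounded _ _ (arens_act n f))
  mH (@subset_refl _ _) K0.
move=> /(_ _)/wrap[].
  by move=> E X p I _ _ _ _ pI; rewrite arens_actE; exact: dual_ract_le.
by rewrite (_ : 2 * (2 * C * M) = 4 * C * M)//; ring.
Qed.

Lemma cintegral_L0inf_lin (a : R[i]) f g p :
  cintegral (fun x => (a *: f + g) x * p x) =
  a * cintegral (fun x => f x * p x) + cintegral (fun x => g x * p x).
Proof.
have ci (k : L0inf w) : cintegrable (fun x => k x * p x).
  apply: (cintegrable_mul (L0inf_norm_ge0 k)); [exact: cmeasurable_L0inf|
    exact: L0inf_norm_wbounded|exact: cmeasurable_L1|exact: wnorm1_L1].
rewrite -cintegral_lin//; apply: eq_cintegral => x _.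
by rewrite -[(a *: f + g) x]/(a * f x + g x) mulrDl mulrA.
Qed.

Lemma arens_act_linr n (a : R[i]) f g : \forall x \ae mu, halfline x ->
  arens_act n (a *: f + g) x = a * arens_act n f x + arens_act n g x.
Proof.
apply: (@arens_act_unique n (a *: f + g) (a *: arens_act n f + arens_act n g)).
move=> E X p mE EX pE; rewrite cintegral_L0inf_lin !arens_actE.
by apply/esym/dual_ract_linl.
Qed.

Lemma arens_act_linl (a : R[i]) m n f : \forall x \ae mu, halfline x ->
  arens_act (a *: m + n) f x = a * arens_act m f x + arens_act n f x.
Proof.
apply: (@arens_act_unique (a *: m + n) f (a *: arens_act m f + arens_act n f)).
by move=> E X p mE EX pE; rewrite cintegral_L0inf_lin !arens_actE.
Qed.

Lemma arens_mulE m n f : (m ** n) f = m (arens_act n f).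
Proof.
have [C C0 mC] := dual_bounded m; have [K K0 nK] := dual_bounded n.
rewrite /arens_mul.
have mnP : (fun f => m (arens_act n f)) \in @L0inf_dual_pred R w.
  apply: (@dual_in _ _ _ (C * (4 * K))).
    by move=> a g h; apply: dual_eq; exact: arens_act_linr.
  move=> g M M0 gM; rewrite -mulrA; apply: mC; first by rewrite !mulr_ge0.
  exact: arens_act_wbounded.
by rewrite -[LHS]/(val (insubd _ _) f) insubdK.
Qed.

Lemma dual_val_inj m n : (forall f, m f = n f) -> m = n.
Proof. by move=> mn; apply/val_inj/funext. Qed.

Lemma arens_mul_linl (a : R[i]) m1 m2 n :
  (a *: m1 + m2) ** n = a *: (m1 ** n) + m2 ** n.
Proof.
apply: dual_val_inj => f; rewrite arens_mulE.
by rewrite -[RHS]/(a * (m1 ** n) f + (m2 ** n) f) !arens_mulE.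
Qed.

Lemma arens_mul_linr (a : R[i]) m n1 n2 :
  m ** (a *: n1 + n2) = a *: (m ** n1) + m ** n2.
Proof.
apply: dual_val_inj => f; rewrite arens_mulE.
rewrite -[RHS]/(a * (m ** n1) f + (m ** n2) f) !arens_mulE.
by apply: dual_eq; exact: arens_act_linl.
Qed.

Lemma arens_mul_le m n (C K : R) : 0 <= K -> dual_le m C -> dual_le n K ->
  dual_le (m ** n) (4 * C * K).
Proof.
move=> K0 mC nK f M M0 fM; rewrite arens_mulE.
rewrite (_ : _ * M = C * (4 * K * M)); last by ring.
by apply: mC; [rewrite !mulr_ge0|exact: arens_act_wbounded].
Qed.

End arens_product.

(** * The characters given by exponentials *)

Section shift.
Context {R : realType}.
Local Notation mu := (@lebesgue_measure R).
Local Notation mH := measurable_halfline.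

Let shift (x : R) : measurableTypeR R -> measurableTypeR R := fun y => x + y.

Let measurable_shift x : measurable_fun [set: measurableTypeR R] (shift x).
Proof. exact: measurable_funD. Qed.

Let pushforward_shift x (A : set R) : measurable A ->
  pushforward mu (shift x) A = mu A.
Proof.
move=> mA; apply/esym.
apply: (@lebesgue_measure_unique _ (pushforward mu (shift x))) => // _ [[a b]] _ <-.
rewrite /pushforward/=.
rewrite [X in _ = lebesgue_measure X](_ : _ = `]a - x, b - x]%classic); last first.
  by apply/seteqP; split=> y /=; rewrite !in_itv/= ltrBlDl lerBrDl.
rewrite !lebesgue_measure_itv/= !lte_fin ltrD2r; case: ifPn => // _.
by rewrite -!EFinD opprB addrA subrK.
Qed.

Lemma ge0_integral_shift (k : R -> R) (x : R) : measurable_fun halfline k ->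
  (forall y, halfline y -> 0 <= k y) -> 0 <= x ->
  (\int[mu]_(y in halfline) (k (x + y))%:E =
   \int[mu]_(y in `[x, +oo[) (k y)%:E)%E.
Proof.
move=> mk k0 x0.
have mx : measurable (`[x, +oo[%classic : set R) by [].
have xH : `[x, +oo[%classic `<=` (halfline : set R).
  by move=> y /=; rewrite in_itv/= andbT halflineE; exact: le_trans.
have mk' : measurable_fun `[x, +oo[ (EFin \o k).
  by apply/measurable_EFinP; apply: measurable_funS mk => //; exact: mH.
have := @ge0_integral_pushforward _ _ _ _ _ (shift x) (measurable_shift x) mu
  `[x, +oo[ (EFin \o k) mx mk'.
move=> /(_ _)/wrap[].
  by move=> y /set_mem/xH hy; rewrite lee_fin k0.
rewrite (_ : shift x @^-1` `[x, +oo[ = halfline); last first.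
  by apply/seteqP; split => y; rewrite halflineE /shift/= in_itv/= andbT lerDl.
move=> <-.
by apply: eq_measure_integral => A mA _; exact: pushforward_shift.
Qed.

Lemma ge0_integral_shift_le (k : R -> R) (x : R) : measurable_fun halfline k ->
  (forall y, halfline y -> 0 <= k y) -> 0 <= x ->
  (\int[mu]_(y in halfline) (k (x + y))%:E <=
   \int[mu]_(y in halfline) (k y)%:E)%E.
Proof.
move=> mk k0 x0; rewrite ge0_integral_shift//.
apply: ge0_subset_integral => //; first exact: mH.
- exact/measurable_EFinP.
- by move=> y /=; rewrite in_itv/= andbT halflineE; exact: le_trans.
Qed.

End shift.

Section exponentials.
Context {R : realType} {w : weight R}.
Implicit Types (f g : L0inf w) (m n : L0inf_dual w) (p q : L1 w) (E : set R).
Local Notation mu := (@lebesgue_measure R).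
Local Notation mH := measurable_halfline.

Lemma expR_tail (e : R) : 0 < e -> exists2 X : R, 0 <= X &
  forall x, X < x -> expR (- x) <= e.
Proof.
move=> e0; exists e^-1; first by rewrite invr_ge0 ltW.
move=> x ex; have x0 : 0 < x by apply: lt_trans ex; rewrite invr_gt0.
rewrite expRN invf_ple ?posrE ?expR_gt0// (le_trans (ltW ex))//.
by rewrite (le_trans _ (expR_ge1Dx x))// lerDr.
Qed.

Lemma normc_expR (x : R) : normc (expR x)%:C = expR x.
Proof. by rewrite normc_real ger0_norm// expR_ge0. Qed.

Lemma expo_ex (k : nat) :
  exists f, f = (fun x => (expR (- k.+1%:R * x))%:C) :> (R -> R[i]).
Proof.
have le1 (x : R) : 0 <= x -> expR (- k.+1%:R * x) <= 1.
  by move=> x0; rewrite -expR0 ler_expR mulNr oppr_le0 mulr_ge0.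
apply: (@L0inf_ex _ _ _ 1) => //.
- by apply: cmeasurable_real; exact: measurable_expR_halfline.
- apply: aeW => x; rewrite halflineE => x0.
  by rewrite normc_expR mul1r (le_trans (le1 x x0))// weight_ge1.
- move=> e e0; have [X X0 HX] := expR_tail e0; exists X => //.
  apply: aeW => x Xx; have x0 := ltW (le_lt_trans X0 Xx).
  rewrite normc_expR; apply: (@le_trans _ _ e).
    apply: le_trans (HX _ Xx); rewrite ler_expR mulNr lerN2 ler_peMl//.
    by rewrite ler1n.
  by rewrite ler_peMr ?weight_ge1// ltW.
Qed.

(** The rates start at 1 because the constant function 1 need not vanish at infinity relative to w,
    for instance when w = 1. *)
Definition expo k : L0inf w := sval (cid (expo_ex k)).

Lemma expoE k x : expo k x = (expR (- k.+1%:R * x))%:C.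
Proof. by rewrite (svalP (cid (expo_ex k))). Qed.

Lemma wbounded_expo k : wbounded w (expo k) 1.
Proof.
apply: aeW => x; rewrite halflineE => x0.
rewrite expoE normc_expR mul1r (le_trans _ (weight_ge1 w x0))//.
by rewrite -expR0 ler_expR mulNr oppr_le0 mulr_ge0.
Qed.

(** By 1 + t <= exp t used twice, exp(-(k+1)x) (1 - exp(-x)) <= x exp(-(k+1)x) <= 1 / (k+1). *)
Lemma wbounded_expoB k : wbounded w (fun x => -1 * expo k.+1 x + expo k x) (k.+1%:R)^-1.
Proof.
apply: aeW => x; rewrite halflineE => x0.
have k0 : 0 < k.+1%:R :> R by [].
have -> : -1 * expo k.+1 x + expo k x =
   (expR (- k.+1%:R * x) * (1 - expR (- x)))%:C.
  rewrite !expoE mulN1r addrC -rmorphB; congr (_%:C).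
  by rewrite mulrBr mulr1 -expRD; congr (_ - expR _); rewrite -[k.+2]addn1 natrD; ring.
have x1 : 0 <= 1 - expR (- x) by rewrite subr_ge0 -expR0 ler_expR oppr_le0.
rewrite normc_real ger0_norm ?mulr_ge0 ?expR_ge0//.
apply: (@le_trans _ _ (k.+1%:R)^-1); last by rewrite ler_peMr ?weight_ge1// invr_ge0 ltW.
apply: (@le_trans _ _ (expR (- k.+1%:R * x) * x)).
  by rewrite ler_wpM2l ?expR_ge0// lerBlDr -lerBlDl (le_trans _ (expR_ge1Dx _)).
rewrite mulNr expRN mulrC ler_pdivrMr ?expR_gt0// ler_pdivlMl//.
rewrite (le_trans _ (expR_ge1Dx _))//.
by rewrite lerDr.
Qed.

Lemma cintegrable_L0inf f p : cintegrable (fun x => f x * p x).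
Proof.
by apply: (cintegrable_mul (L0inf_norm_ge0 f)); [exact: cmeasurable_L0inf|
  exact: L0inf_norm_wbounded|exact: cmeasurable_L1|exact: wnorm1_L1].
Qed.

Lemma cintegrable0 : cintegrable (fun=> 0 : R[i]).
Proof.
split; first exact: cmeasurable_cst.
by rewrite integral0_eq ?ltry// => x _; rewrite normc0.
Qed.

Lemma dual0 m : m 0 = 0.
Proof.
have := dual_lin m (-1) 0 0; rewrite scaler0 addr0 => /eqP.
by rewrite mulN1r addNr => /eqP.
Qed.

(** Since e_k(x + y) = e_k(x) e_k(y), the exponential is an eigenvector of every [ract _ p], hence
    up to null sets of every [arens_act m]; multiplicativity at e_k follows in [expo_mult]. *)
Lemma ract_expo k p x : halfline x ->
  ract (expo k) p x = cintegral (fun y => expo k y * p y) * expo k x.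
Proof.
move=> hx; rewrite -[LHS]/(cintegral (fun y => expo k (x + y) * p y)).
have := cintegral_lin (expo k x) (cintegrable_L0inf (expo k) p) cintegrable0.
rewrite cintegral0 addr0 mulrC => <-; apply: eq_cintegral => y _.
by rewrite addr0 mulrA !expoE -rmorphM -expRD -mulrDr.
Qed.

Lemma arens_act_expo m k : \forall x \ae mu, halfline x ->
  arens_act m (expo k) x = m (expo k) * expo k x.
Proof.
apply: (@arens_act_unique _ _ _ _ (m (expo k) *: expo k)) => E X p mE EX pE.
have -> : m (ract (expo k) p) = cintegral (fun y => expo k y * p y) * m (expo k) + m 0.
  by apply: dual_eq; apply: aeW => x hx; rewrite ract_expo// [(0 : L0inf w) x]/(0) addr0.
have := cintegral_lin (m (expo k)) (cintegrable_L0inf (expo k) p) cintegrable0.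
rewrite cintegral0 dual0 !addr0 mulrC => <-; apply: eq_cintegral => y _.
by rewrite addr0 mulrA.
Qed.

Lemma expo_mult m n k : (m ** n) (expo k) = m (expo k) * n (expo k).
Proof.
rewrite arens_mulE (@dual_eq _ _ m (n (expo k)) (expo k) 0).
  by rewrite dual0 addr0 mulrC.
have := arens_act_expo n k; apply: ae_mono => x + hx => /(_ hx) ->.
by rewrite [(0 : L0inf w) x]/(0) addr0.
Qed.

End exponentials.

(** * Approximate step functions made of exponentials *)

Section cutoff.
Context {R : realType}.

Lemma onem_exprn_le (T : R) (M : nat) : 0 <= T <= 1 -> 1 - (1 - T) ^+ M <= M%:R * T.
Proof.
move=> /andP[T0 T1]; elim: M => [|M IH]; first by rewrite expr0 subrr mul0r.
have h : (1 - T) ^+ M <= 1 by rewrite exprn_ile1 ?subr_ge0// lerBlDr lerDl.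
rewrite exprS -natr1 mulrDl mul1r; nra.
Qed.

Lemma exprn_onem_le (T : R) (M : nat) : 0 <= T <= 1 ->
  (1 - T) ^+ M <= (1 + M%:R * T)^-1.
Proof.
move=> /andP[T0 T1].
apply: (@le_trans _ _ (expR (- T) ^+ M)).
  by apply: lerXn2r; rewrite ?nnegrE ?subr_ge0 ?expR_ge0// expR_ge1Dx.
rewrite -expRM_natl mulrN expRN lef_pV2 ?posrE ?expR_gt0 ?expR_ge1Dx//.
by rewrite ltr_wpDr// mulr_ge0.
Qed.

(** M T is close to exp(J (a - x)), which is huge left of a and tiny right of a. The two previous
    bounds on (1 - T)^M thus make 1 - (1 - T)^M a step at a. Rounding up gives L <= M <= 2 L for L =
    exp(J a) >= 1, whence the factor 2. *)
Lemma cutoff_bounds (a x : R) (J : nat) : 0 <= a -> 0 <= x ->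
  let M := (Num.truncn (expR (J%:R * a))).+1 in
  let T := expR (- J%:R * x) in
  (x < a -> (1 - T) ^+ M <= expR (- (a - x)) ^+ J) /\
  (a <= x -> 1 - (1 - T) ^+ M <= 2 * expR (- (x - a)) ^+ J).
Proof.
move=> a0 x0 M T; set L := expR (J%:R * a) in M *.
have L0 : 0 < L by exact: expR_gt0.
have LM : L <= M%:R by rewrite ltW// truncnS_gt.
have T01 : 0 <= T <= 1.
  by rewrite expR_ge0 -expR0 ler_expR mulNr oppr_le0 mulr_ge0.
have T0 : 0 < T by exact: expR_gt0.
split=> xa.
  apply: le_trans (exprn_onem_le M T01) _.
  rewrite -expRM_natl mulrN expRN lef_pV2 ?posrE ?expR_gt0 ?ltr_wpDr ?mulr_ge0//; last exact: ltW.
  apply: (@le_trans _ _ (L * T)).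
    by rewrite /L /T -expRD mulrBr mulNr.
  by rewrite (@le_trans _ _ (M%:R * T))// ?lerDr// ler_wpM2r// ltW.
have xa0 : 0 <= x - a by rewrite subr_ge0.
have TL : L * T = expR (- (x - a)) ^+ J.
  by rewrite -expRM_natl /L /T -expRD; congr expR; ring.
apply: le_trans (onem_exprn_le M T01) _; rewrite -TL mulrA ler_wpM2r ?(ltW T0)//.
have L1 : 1 <= L by rewrite -expR0 ler_expR mulr_ge0.
have : (Num.truncn L)%:R <= L by rewrite truncn_le ltW.
by rewrite /M -natr1; lra.
Qed.

End cutoff.

(** * Density of tails of exponentials *)

Section exponential_density.
Context {R : realType} {w : weight R}.
Implicit Types (f g : L0inf w) (m : L0inf_dual w) (p q : L1 w) (E : set R).
Local Notation mu := (@lebesgue_measure R).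
Local Notation mH := measurable_halfline.

Lemma L0inf_linE (a : R[i]) f g (x : R) : (a *: f + g) x = a * f x + g x.
Proof. by []. Qed.

Lemma L0inf_ind_ex E X : measurable E -> E `<=` `[0, X[ ->
  exists f, f = ind E :> (R -> R[i]).
Proof.
move=> mE EX; apply: (@L0inf_ex _ _ _ 1) => //; first exact: cmeasurable_ind.
- apply: aeW => y; rewrite halflineE => y0; rewrite mul1r normc_ind.
  by rewrite (le_trans (indic_le1 _ _))// weight_ge1.
- move=> e e0; exists (Num.max 0 X); first by rewrite le_max lexx.
  apply: aeW => y; rewrite gt_max => /andP[y0 Xy]; rewrite ind_out.
    by rewrite normc0 mulr_ge0 ?(ltW e0)// ltW// weight_gt0// ltW.
  by move=> /EX /=; rewrite in_itv/= => /andP[_ /(lt_trans Xy)]; rewrite ltxx.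
Qed.

Lemma ract_expo_ex k p : exists c : R[i],
  forall x, halfline x -> ract (expo k) p x = c * (expo k : L0inf w) x.
Proof.
exists (cintegral (fun y => (expo k : L0inf w) y * p y)) => x hx.
by rewrite (ract_expo k p hx).
Qed.

(** [W] is later the kernel of a functional, or the set of functions at which a derivation is
    bounded on the unit ball. Boundedness of p makes G |-> [ract G p] continuous from L^1(dx) to the
    weighted sup norm, so it suffices to approximate in L^1(dx), where indicators are within
    reach. *)
Theorem expo_density (N : nat) (W : L0inf w -> Prop) :
  W 0 -> (forall a f g, W f -> W g -> W (a *: f + g)) ->
  (forall f, (forall e : R, 0 < e ->
     exists2 g, W g & wbounded w (fun x => f x - g x) e) -> W f) ->
  (forall k, (N <= k)%N -> W (expo k)) ->
  forall f p (B : R), (forall x, halfline x -> normc (p x) <= B) -> W (ract f p).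
Proof.
move=> W0 Wlin Wcl Wexpo f p B pB.
have H0 : halfline (0 : R) by rewrite halflineE.
have B0 : 0 <= B := le_trans (normc_ge0 _) (pB _ H0).
have Wae f1 f2 : (forall x, halfline x -> f1 x = f2 x) -> W f1 -> W f2.
  move=> f12 Wf1; apply: Wcl => e e0; exists f1 => //; apply: aeW => x hx.
  by rewrite f12// subrr normc0 mulr_ge0 ?(ltW e0) ?weight_ge0.
pose S (f : R -> R[i]) := exists2 G : L0inf w, G = f :> (R -> R[i]) & W (ract G p).
have S0 : S (fun=> 0).
  exists 0 => //; apply: Wae W0 => x hx.
  rewrite -[RHS]/(cintegral (fun y => 0 * p y)).
  transitivity (cintegral (fun=> 0 : R[i])); first by rewrite cintegral0.
  by apply: eq_cintegral => y _; rewrite mul0r.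
have Slin (a : R[i]) (f1 f2 : R -> R[i]) : S f1 -> S f2 -> S (fun x => a * f1 x + f2 x).
  move=> [G1 G1E W1] [G2 G2E W2]; exists (a *: G1 + G2); first by rewrite -G1E -G2E.
  apply: Wae (Wlin a _ _ W1 W2) => x hx.
  by apply/esym; exact: (@ract_linl _ _ a G1 G2).
have Sexp i : (N < i)%N -> S (fun x => (expR (- i%:R * x))%:C).
  case: i => // i Ni; have [c cE] := ract_expo_ex i p.
  have GE : @expo R w i = (fun x => (expR (- i.+1%:R * x))%:C) :> (R -> R[i]).
    by apply/funext => x; rewrite expoE.
  have W1 : W (c *: expo i + 0) by apply: Wlin => //; exact: Wexpo.
  exists (expo i) => //; apply: Wae W1 => x hx.
  by rewrite L0inf_linE (cE x hx) [(0 : L0inf w) x]/(0) addr0.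
have est (G : L0inf w) (I : R) : (wnorm1 (fun=> 1%R) G <= I%:E)%E -> wbounded w (ract G p) (2 * (B * I)).
  move=> GI; apply: aeW => x hx; have x0 : 0 <= x by rewrite -halflineE.
  have I0 : 0 <= I.
    by rewrite -lee_fin (le_trans _ GI)// wnorm1_ge0// => ? _; exact: ler01.
  apply: (@le_trans _ _ (2 * (B * I))); last first.
    by rewrite ler_peMr ?weight_ge1// !mulr_ge0.
  have mG := cmeasurable_L0inf G; have mGx := cmeasurable_shift hx mG.
  have mnG := cmeasurable_normc mG; have mnGx := cmeasurable_normc mGx.
  apply: (@cintegral_bound _ _ (fun y => B * normc (G (x + y)))).
  - by apply: cmeasurable_mul => //; exact: cmeasurable_L1.
  - by apply: measurable_funM.
  - by move=> y hy; rewrite mulr_ge0 ?normc_ge0.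
  - by apply: aeW => y hy; rewrite normcM mulrC ler_wpM2r ?normc_ge0 ?pB.
  under eq_integral do rewrite EFinM.
  rewrite ge0_integralZl_EFin//; [|exact: mH|by move=> y _; rewrite lee_fin normc_ge0|exact/measurable_EFinP].
  rewrite EFinM lee_wpmul2l ?lee_fin//; apply: le_trans GI.
  apply: le_trans (ge0_integral_shift_le mnG _ x0) _.
    by move=> y _; exact: normc_ge0.
  rewrite le_eqVlt; apply/orP; left; apply/eqP.
  by apply: eq_integral => y _; rewrite mulr1.
(* Only i = 0 is wanted; the other i serve the induction. With T = exp(-jx), 1 - (1 - T)^(M+1) is (1
   - (1 - T)^M) - T (1 - (1 - T)^M) + T, in which the only new exponential has rate i + j > N. *)
have Spow j M i : (N < j)%N -> S (fun x => (expR (- i%:R * x) * (1 - (1 - expR (- j%:R * x)) ^+ M))%:C).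
  move=> Nj; elim: M i => [|M IH] i.
    by move: S0; congr S; apply/funext => x; rewrite expr0 subrr mulr0.
  have Nij : (N < i + j)%N by rewrite (leq_trans Nj)// leq_addl.
  have := Slin (-1) _ _ (IH (i + j)%N) (Slin 1 _ _ (IH i) (Sexp _ Nij)).
  congr S; apply/funext => x; rewrite mulN1r mul1r -rmorphN -!rmorphD; congr (_%:C).
  by rewrite natrD opprD mulrDl expRD exprS; ring.
have mone : measurable_fun halfline (fun _ : R => 1 : R) by exact: measurable_cst.
have one0 (x : R) : halfline x -> (0 : R) <= 1 by [].
have Scl (h : R -> R[i]) : h \in L0inf_pred w -> cmeasurable h ->
  (forall e : R, 0 < e -> exists g : R -> R[i], [/\ S g, cmeasurable g &
    (wnorm1 (fun=> 1%R) (fun x => (h x - g x)%R) <= e%:E)%E]) -> S h.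
  move=> hP mh happ; exists (MkL0inf hP) => //; apply: Wcl => e e0.
  have d0 : 0 < e / (2 * B + 1) by rewrite divr_gt0// ltr_wpDl// mulr_ge0.
  have [g [[G GE WG] mg hg]] := happ _ d0.
  exists (ract G p) => //.
  have := @est (-1 *: G + MkL0inf hP) (e / (2 * B + 1)).
  move=> /(_ _)/wrap[].
    rewrite (_ : wnorm1 _ _ = wnorm1 (fun=> 1%R) (fun x => (h x - g x)%R))//.
    apply: eq_wnorm1 => x _; rewrite -GE.
    by rewrite L0inf_linE mulN1r addrC.
  apply: ae_mono => x Hx hx; have := Hx hx.
  rewrite (@ract_linl _ _ (-1) G (MkL0inf hP))// mulN1r addrC => /le_trans; apply.
  rewrite ler_wpM2r ?weight_ge0// mulrA mulrCA ger_pMr// ler_pdivrMr ?mul1r ?lerDl//.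
  by rewrite ltr_wpDl// mulr_ge0.
have indP E X : measurable E -> E `<=` `[0, X[ -> ind E \in L0inf_pred w.
  by move=> mE EX; have [F <-] := L0inf_ind_ex mE EX; exact: (valP F).
have Sind a : 0 <= a -> S (ind `[0, a[).
  move=> a0; have ma : measurable (`[0, a[%classic : set R) by [].
  apply: Scl; [exact: indP (@subset_refl _ _)|exact: cmeasurable_ind|].
  move=> e e0.
  (* The shift by N + 1 keeps all the rates beyond N, and [J j] >= 1 is what allows a majorant
     independent of j. *)
  pose J j := (j + N.+1)%N; pose M j := (Num.truncn (expR ((J j)%:R * a))).+1.
  pose g j (x : R) : R[i] := (1 - (1 - expR (- (J j)%:R * x)) ^+ (M j))%:C.
  have Sg j : S (g j).
    have JN : (N < J j)%N by rewrite /J addnS ltnS leq_addl.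
    have := @Spow (J j) (M j) 0%N JN.
    by congr S; apply/funext => x; rewrite mulNr mul0r oppr0 expR0 mul1r.
  have mg j : cmeasurable (g j).
    apply: cmeasurable_real; apply: measurable_funB; first exact: measurable_cst.
    apply: measurable_funX; apply: measurable_funB; first exact: measurable_cst.
    exact: measurable_expR_halfline.
  have gE x j : halfline x -> [/\ x < a -> normc (ind `[0, a[ x - g j x) <= expR (- (a - x)) ^+ J j
      & a <= x -> normc (ind `[0, a[ x - g j x) <= 2 * expR (- (x - a)) ^+ J j].
    rewrite halflineE => x0; have [h1 h2] := cutoff_bounds (J j) a0 x0.
    have T0 : 0 < expR (- (J j)%:R * x) by exact: expR_gt0.
    have T1 : expR (- (J j)%:R * x) <= 1.
      by rewrite -expR0 ler_expR mulNr oppr_le0 mulr_ge0.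
    have P0 : 0 <= (1 - expR (- (J j)%:R * x)) ^+ (M j) by rewrite exprn_ge0 ?subr_ge0.
    have P1 : (1 - expR (- (J j)%:R * x)) ^+ (M j) <= 1.
      by rewrite exprn_ile1 ?subr_ge0// lerBlDr lerDl ltW.
    split=> xa.
      rewrite ind_in /= ?in_itv/= ?x0// /g -[1]/(1%:C) -rmorphB normc_real opprB addrC subrK.
      by rewrite ger0_norm// h1.
    rewrite ind_out /= ?in_itv/=; last by rewrite x0/= ltNge xa.
    by rewrite sub0r normcN /g normc_real ger0_norm ?subr_ge0// h2.
  (* h(x) = 2 exp(-(x - a)): at least 1 left of a, and at least 2 exp(-(x - a))^J right of a as J >=
     1. *)
  pose h (x : R) := 2 * expR a * expR (- 1 * x).
  have mh : measurable_fun halfline h.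
    by apply: measurable_funM => //; exact: measurable_expR_halfline.
  have h0 x : halfline x -> 0 <= h x by move=> _; rewrite !mulr_ge0 ?expR_ge0.
  have hi : (\int[mu]_(x in halfline) (h x)%:E < +oo)%E.
    under eq_integral do rewrite EFinM.
    rewrite ge0_integralZl_EFin//; [|exact: mH|].
    - by rewrite integral_expR// -EFinM ltry.
    - by apply/measurable_EFinP; exact: measurable_expR_halfline.
  have [||K HK] := @wnorm1_dominated _ (fun=> 1%R) (ind `[0, a[) g h mone one0
     (cmeasurable_ind ma) mg mh h0 hi _ _ e e0; last by exists (g K); split => //; exact: HK.
  - move=> n x hx; rewrite mulr1; have [g1 g2] := gE x n hx.
    have hE : h x = 2 * expR (- (x - a)).
      by rewrite /h -mulrA -expRD; congr (_ * expR _); ring.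
    have [xa|xa] := ltP x a.
      apply: le_trans (g1 xa) _; rewrite hE.
      apply: (@le_trans _ _ 1).
        by rewrite exprn_ile1 ?expR_ge0// -expR0 ler_expR oppr_le0 subr_ge0 ltW.
      have : 1 <= expR (- (x - a)) by rewrite -expR0 ler_expR opprB subr_ge0 ltW.
      lra.
    apply: le_trans (g2 xa) _; rewrite hE ler_wpM2l// /J addnS exprS.
    rewrite ler_piMr ?expR_ge0// exprn_ile1 ?expR_ge0//.
    by rewrite -expR0 ler_expR oppr_le0 subr_ge0.
  (* At x = a the cutoff bounds do not tend to 0; this null set is discarded. *)
  - have na : \forall x \ae mu, x != a.
      exists [set a]; split => //; first exact: lebesgue_measure_set1.
      by move=> x /= /negP; rewrite negbK => /eqP.
    move: na; apply: ae_mono => x xa hx.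
    pose z := expR (- `|x - a|).
    have z1 : `|z| < 1.
      by rewrite ger0_norm ?expR_ge0// -expR0 ltr_expR oppr_lt0 normr_gt0 subr_eq0.
    have cz : (fun n => geometric (2 * z ^+ N.+1) z n) @ \oo --> (0 : R) by exact: cvg_geometric.
    apply: (@squeeze_cvgr _ _ _ _ (fun=> 0) (fun n => geometric (2 * z ^+ N.+1) z n)) => //; last exact: cvg_cst.
    apply: nearW => n; rewrite normc_ge0/= -mulrA -exprD addnC -/(J n).
    have [g1 g2] := gE x n hx.
    have [lxa|lxa] := ltP x a.
      have zE : z = expR (- (a - x)) by congr expR; rewrite ltr0_norm ?subr_lt0//; ring.
      apply: le_trans (g1 lxa) _; rewrite -zE.
      by rewrite ler_peMl ?exprn_ge0 ?expR_ge0// ler1n.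
    by apply: le_trans (g2 lxa) _; rewrite /z ger0_norm ?subr_ge0.
have Sall : forall h, h \in L0inf_pred w -> cmeasurable h -> (wnorm1 (fun=> 1%R) h < +oo)%E -> S h.
  apply: (@weighted_L1_density R (fun=> 1%R) (fun h => h \in L0inf_pred w) S mone one0) => //.
  by move=> X X0; exists 1.
apply: Wcl => e e0.
pose I := fine (wnorm1 w p).
have I0 : 0 <= I by rewrite fine_ge0// wnorm1_ge0//; exact: weight_ge0.
have pI : (wnorm1 w p <= I%:E)%E.
  by rewrite fineK// ge0_fin_numE ?wnorm1_L1// wnorm1_ge0//; exact: weight_ge0.
have d0 : 0 < e / (2 * I + 1) by rewrite divr_gt0// ltr_wpDl// mulr_ge0.
(* f itself need not be in L^1(dx): it is cut at Y = X + 1, which makes it integrable and leaves a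
   remainder of small weighted norm. *)
have [X X0 fX] := L0inf_tail f d0.
pose Y := X + 1.
have mY : measurable (`[0, Y[%classic : set R) by [].
pose fY x := f x * ind `[0, Y[ x.
have mfY : cmeasurable fY by apply: cmeasurable_mul; [exact: cmeasurable_L0inf|exact: cmeasurable_ind].
have M0 := L0inf_norm_ge0 f; have fM := L0inf_norm_wbounded f.
have bfY : wbounded w fY (L0inf_norm f).
  move: fM; apply: ae_mono => y Hy hy; apply: le_trans (Hy hy).
  by rewrite normcM normc_ind ler_piMr ?normc_ge0// indic_le1.
have [F FE] : exists F : L0inf w, F = fY :> (R -> R[i]).
  apply: (@L0inf_ex _ _ _ (L0inf_norm f)) => // e' e'0.
  have [Z Z0 HZ] := L0inf_tail f e'0; exists Z => //.
  move: HZ; apply: ae_mono => y Hy Zy; apply: le_trans (Hy Zy).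
  by rewrite normcM normc_ind ler_piMr ?normc_ge0// indic_le1.
have WF : W (ract F p).
  have fYP : fY \in L0inf_pred w by rewrite -FE; exact: (valP F).
  have [|G GE WG] := Sall _ fYP mfY; last first.
    by rewrite (_ : F = G)//; apply/val_inj; rewrite /= FE GE.
  have [q qE] := @L1_ind_ex _ w _ _ mY (@subset_refl _ _).
  apply: (@le_lt_trans _ _ (\int[mu]_(x in halfline) (L0inf_norm f * (normc (ind `[0, Y[ x) * w x))%:E)%E).
    apply: ae_ge0_le_integral => //; first exact: mH.
    - by move=> x _; rewrite lee_fin mulr_ge0 ?normc_ge0.
    - by apply/measurable_EFinP; apply: measurable_funM => //; exact: cmeasurable_normc.
    - by move=> x hx; rewrite lee_fin !mulr_ge0 ?normc_ge0 ?weight_ge0.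
    - apply/measurable_EFinP; apply: measurable_funM => //; apply: measurable_funM.
        by apply: cmeasurable_normc; exact: cmeasurable_ind.
      exact: measurable_weight.
    - move: fM; apply: ae_mono => x Hx hx; rewrite lee_fin mulr1 normcM mulrC.
      by rewrite mulrCA ler_wpM2l ?normc_ge0// Hx.
  under eq_integral do rewrite EFinM.
  rewrite ge0_integralZl_EFin//; [|exact: mH| |].
  - by rewrite lte_mul_pinfty ?lee_fin//; have := wnorm1_L1 q; rewrite qE.
  - by move=> x hx; rewrite lee_fin mulr_ge0 ?normc_ge0 ?weight_ge0.
  - apply/measurable_EFinP; apply: measurable_funM; last exact: measurable_weight.
    by apply: cmeasurable_normc; exact: cmeasurable_ind.
exists (ract F p) => //.
have D1 : wbounded w (-1 *: F + f : L0inf w) (e / (2 * I + 1)).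
  move: fX; apply: ae_mono => y Hy hy.
  rewrite L0inf_linE FE /fY.
  have [yY|yY] := pselect (`[0, Y[%classic y).
    rewrite ind_in// mulr1 mulN1r addNr normc0 mulr_ge0 ?weight_ge0//; exact: ltW.
  rewrite ind_out// mulr0 mulr0 add0r Hy//.
  rewrite ltNge; apply/negP => yX; apply: yY => /=.
  have y0 : 0 <= y by move: hy; rewrite halflineE.
  by rewrite in_itv/= y0 (le_lt_trans yX)// ltrDl.
have := ract_wbounded (ltW d0) D1 pI; apply: ae_mono => x Hx hx; have := Hx hx.
rewrite (@ract_linl _ _ (-1) F f)// mulN1r addrC => /le_trans; apply.
have -> : 2 * (e / (2 * I + 1) * I) = e * (2 * I / (2 * I + 1)) by ring.
rewrite ler_wpM2r ?weight_ge0// ger_pMr// ler_pdivrMr ?mul1r ?lerDl//.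
by rewrite ltr_wpDl// mulr_ge0.
Qed.

(** The kernel of m is a closed subspace, so it contains every [ract f p] with p an indicator; these
    test functions force [arens_act m f] = 0 a.e. *)
Lemma in_ran_of_expo N m : (forall k, (N <= k)%N -> m (expo k) = 0) -> in_ran m.
Proof.
move=> mN n; apply: dual_val_inj => f; rewrite arens_mulE.
have [C C0 mC] := dual_bounded m.
have W q B : (forall x, halfline x -> normc (q x) <= B) -> m (ract f q) = 0.
  apply: (@expo_density N (fun f => m f = 0)) => //.
  - exact: dual0.
  - by move=> a g h mg mh; rewrite dual_lin mg mh mulr0 addr0.
  - move=> g gapp; apply: eq0_normc; apply/eqP; rewrite eq_le normc_ge0 andbT.
    apply/ler_addgt0Pr => e e0; rewrite add0r.
    have d0 : 0 < e / (C + 1) by rewrite divr_gt0// ltr_wpDl.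
    have [h mh gh] := gapp _ d0.
    have -> : m g = m (-1 *: h + g) by rewrite dual_lin mh mulr0 add0r.
    apply: (@le_trans _ _ (C * (e / (C + 1)))).
      apply: mC; first exact: ltW.
      move: gh; apply: ae_mono => y Hy hy; apply: le_trans (Hy hy).
      by rewrite L0inf_linE mulN1r addrC.
    by rewrite mulrCA ger_pMr// ler_pdivrMr ?mul1r ?lerDl// ltr_wpDl.
rewrite (@L0inf_dual_ae _ _ n _ 0) ?dual0//.
apply: arens_act_unique => E X q mE EX qE; rewrite (W q 1); last first.
  by move=> x _; rewrite qE normc_ind indic_le1.
by rewrite -[RHS]cintegral0; apply: eq_cintegral => x _; rewrite mul0r.
Qed.

End exponential_density.

(** * A right unit *)

Section shift_cintegral.
Context {R : realType}.
Local Notation mu := (@lebesgue_measure R).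
Local Notation mH := measurable_halfline.

Lemma Rintegral_shift (h : R -> R) (x : R) : measurable_fun halfline h -> 0 <= x ->
  (forall y, 0 <= y < x -> h y = 0) ->
  \int[mu]_(y in halfline) h (x + y) = \int[mu]_(y in halfline) h y.
Proof.
move=> mh x0 hx; congr fine.
have key (k : R -> R) : measurable_fun halfline k -> (forall y, 0 <= k y) ->
    (forall y, 0 <= y < x -> k y = 0) ->
    (\int[mu]_(y in halfline) (k (x + y))%:E = \int[mu]_(y in halfline) (k y)%:E)%E.
  move=> mk k0 kx; rewrite ge0_integral_shift//.
  rewrite integral_mkcond [RHS]integral_mkcond; apply: eq_integral => y _.
  rewrite !patchE; case: (boolP (y \in halfline)) => [/set_mem hy|/negP hy].
    case: ifPn => // /negP yx; rewrite kx//; apply/andP; split.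
      by move: hy; rewrite halflineE.
    by rewrite ltNge; apply/negP => xy; apply: yx; apply/mem_set; rewrite /= in_itv/= xy.
  case: ifPn => // /set_mem /=; rewrite in_itv/= andbT => xy; exfalso; apply: hy.
  by apply/mem_set; rewrite halflineE; exact: le_trans xy.
have mp : measurable_fun halfline (fun y => Num.max (h y) 0).
  by apply: measurable_maxr => //; exact: measurable_cst.
have mn : measurable_fun halfline (fun y => Num.max (- h y) 0).
  by apply: measurable_maxr; [exact: measurable_funN|exact: measurable_cst].
have max0 (z : R) : 0 <= Num.max z 0 by rewrite le_max lexx orbT.
rewrite integralE [RHS]integralE; congr (_ - _)%E.
  have := key _ mp (fun=> max0 _) (fun y yx => etrans (congr1 (Num.max ^~ 0) (hx y yx)) (maxxx 0)).
  by congr (_ = _); apply: eq_integral => y _; rewrite funeposE -EFin_max.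
have := key _ mn (fun=> max0 _).
move=> /(_ _)/wrap[].
  by move=> y /hx ->; rewrite oppr0 maxxx.
by congr (_ = _); apply: eq_integral => y _; rewrite funenegE -EFin_max.
Qed.

Lemma cintegral_shift (f : R -> R[i]) (x : R) : cmeasurable f -> 0 <= x ->
  (forall y, 0 <= y < x -> f y = 0) ->
  cintegral (fun y => f (x + y)) = cintegral f.
Proof.
move=> [mR mI] x0 fx; congr Complex.
  by apply: (@Rintegral_shift (fun y => complex.Re (f y))) => // y /fx ->.
by apply: (@Rintegral_shift (fun y => complex.Im (f y))) => // y /fx ->.
Qed.

End shift_cintegral.

(** * Generalized limits of bounded sequences *)

Section ultralimit.
Context {R : realType}.

(** The limit along an ultrafilter finer than [\oo]. It exists for bounded sequences by compactness
    of [-C, C], whence the boundedness assumptions; on other sequences [lim] may return a default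
    value. *)
Lemma ultralimit_ex : exists L : (nat -> R) -> R, [/\
  forall (a b : R) (s t : nat -> R) C D, (forall n, `|s n| <= C) -> (forall n, `|t n| <= D) ->
    L (fun n => a * s n + b * t n) = a * L s + b * L t,
  forall (s : nat -> R) C, (forall n, `|s n| <= C) -> `|L s| <= C &
  forall (s : nat -> R) l, s @ \oo --> l -> L s = l].
Proof.
have [G [GU FG]] := @ultraFilterLemma nat \oo _.
have sU (s : nat -> R) : UltraFilter (s @ G).
  constructor; first exact: fmap_proper_filter.
  move=> H HP sH; apply/seteqP; split => [A HA|]; last exact: sH.
  have [//|nA] := in_ultra_setVsetC (s @^-1` A) GU.
  have HF : Filter H by exact: (@filter_filter _ H HP).
  have H0 : H set0 by rewrite -(setICr A); apply: filterI => //; exact: sH.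
  by have [] := @filter_ex _ H HP _ H0.
have Gcvg (s : nat -> R) C : (forall n, `|s n| <= C) -> exists2 l : R, `|l| <= C & s @ G --> l.
  move=> sC.
  have := @segment_compact R (- C) C; rewrite compact_ultra => /(_ (s @ G) _ _)/wrap[].
    by apply: (@filterE _ G) => n /=; rewrite in_itv/= -ler_norml.
  move=> [l []]; rewrite /= in_itv/= -ler_norml => lC sl.
  by exists l.
exists (fun s => lim (s @ G)); split.
- move=> a b s t C D /Gcvg[l _ sl] /Gcvg[l' _ tl].
  rewrite (cvg_lim _ sl)// (cvg_lim _ tl)//; apply: cvg_lim => //.
  by apply: cvgD; apply: cvgMr.
- by move=> s C /Gcvg[l lC sl]; rewrite (cvg_lim _ sl).
- move=> s l sl; apply: cvg_lim => //; apply: cvg_trans sl.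
  by move=> A; exact: FG.
Qed.

Lemma cultralimit_ex : exists L : (nat -> R[i]) -> R[i], [/\
  forall (a : R[i]) (s t : nat -> R[i]) C D, (forall n, normc (s n) <= C) ->
    (forall n, normc (t n) <= D) -> L (fun n => a * s n + t n) = a * L s + L t,
  forall (s : nat -> R[i]) C, (forall n, normc (s n) <= C) -> normc (L s) <= 2 * C &
  forall (s : nat -> R[i]) l, (fun n => normc (s n - l)) @ \oo --> (0 : R) -> L s = l].
Proof.
have [L [Llin Lle Lcvg]] := ultralimit_ex.
pose cL s : R[i] := Complex (L (fun n => complex.Re (s n))) (L (fun n => complex.Im (s n))).
have cLRe s : complex.Re (cL s) = L (fun n => complex.Re (s n)) by [].
have cLIm s : complex.Im (cL s) = L (fun n => complex.Im (s n)) by [].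
have bR (s : nat -> R[i]) (C : R) n : normc (s n) <= C -> `|complex.Re (s n)| <= C.
  by apply: le_trans; exact: normc_Re.
have bI (s : nat -> R[i]) (C : R) n : normc (s n) <= C -> `|complex.Im (s n)| <= C.
  by apply: le_trans; exact: normc_Im.
exists cL; split.
- move=> a s t C D sC tD.
  have abD (x y : R) (s' t' : nat -> R) : (forall n, `|s' n| <= C) -> (forall n, `|t' n| <= C) ->
      forall n, `|x * s' n + y * t' n| <= `|x| * C + `|y| * C.
    move=> s'C t'C n; rewrite (le_trans (ler_normD _ _))// !normrM.
    by rewrite lerD// ler_wpM2l.
  have sR n := bR s C n (sC n); have sI n := bI s C n (sC n).
  have tR n := bR t D n (tD n); have tI n := bI t D n (tD n).
  apply/eqP; rewrite eq_complex Defs.ReD Defs.ImD Defs.ReM Defs.ImM !cLRe !cLIm.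
  apply/andP; split; apply/eqP.
    transitivity (L (fun n => 1 * (complex.Re a * complex.Re (s n) + (- complex.Im a) * complex.Im (s n)) + 1 * complex.Re (t n))).
      congr L; apply/funext => n; rewrite Defs.ReD Defs.ReM; ring.
    rewrite (Llin _ _ _ _ _ _ (abD _ _ _ _ sR sI) tR) (Llin _ _ _ _ _ _ sR sI); ring.
  transitivity (L (fun n => 1 * (complex.Re a * complex.Im (s n) + complex.Im a * complex.Re (s n)) + 1 * complex.Im (t n))).
    congr L; apply/funext => n; rewrite Defs.ImD Defs.ImM; ring.
  rewrite (Llin _ _ _ _ _ _ (abD _ _ _ _ sI sR) tI) (Llin _ _ _ _ _ _ sI sR); ring.
- move=> s C sC; rewrite (le_trans (normc_le_ReIm _))// cLRe cLIm.
  rewrite mulr_natl mulr2n lerD//; apply: Lle => n; [exact: bR|exact: bI].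
- move=> s l sl.
  have sq (s' : nat -> R) l' : (forall n, `|s' n - l'| <= normc (s n - l)) -> s' @ \oo --> l'.
    move=> Hs; apply/cvgrPdist_le => e e0.
    move/cvgrPdist_le : (sl) => /(_ e e0); apply: filterS => n.
    rewrite sub0r normrN => h; rewrite distrC (le_trans (Hs n))//.
    by rewrite (le_trans _ h)// ler_norm.
  have ReB (z t : R[i]) : complex.Re (z - t) = complex.Re z - complex.Re t.
    by case: z; case: t.
  have ImB (z t : R[i]) : complex.Im (z - t) = complex.Im z - complex.Im t.
    by case: z; case: t.
  apply/eqP; rewrite eq_complex cLRe cLIm (Lcvg _ (complex.Re l)); last first.
    by apply: sq => n; rewrite -ReB normc_Re.
  rewrite (Lcvg _ (complex.Im l)) ?eqxx//.
  by apply: sq => n; rewrite -ImB normc_Im.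
Qed.

End ultralimit.

Section right_unit.
Context {R : realType} {w : weight R}.
Implicit Types (f g : L0inf w) (m : L0inf_dual w) (p q : L1 w) (E : set R).
Local Notation mu := (@lebesgue_measure R).
Local Notation mH := measurable_halfline.

Lemma L1_functional_eq0 (l : L1 w -> R[i]) (K : R) : 0 <= K ->
  (forall (a : R[i]) p q (r : L1 w), (forall x, halfline x -> r x = a * p x + q x) ->
     l r = a * l p + l q) ->
  (forall p I, (wnorm1 w p <= I%:E)%E -> normc (l p) <= K * I) ->
  (forall a p, 0 <= a -> p = ind `[0, a[ :> (R -> R[i]) -> l p = 0) ->
  forall p, l p = 0.
Proof.
move=> K0 llin lbd lind p.
pose Q (f : R -> R[i]) := exists2 p : L1 w, p = f :> (R -> R[i]) & l p = 0.
suff Qall : forall f : R -> R[i], f \in L1_pred w -> cmeasurable f -> (wnorm1 w f < +oo)%E -> Q f.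
  have [q qp lq] := Qall _ (valP p) (cmeasurable_L1 p) (wnorm1_L1 p).
  by rewrite (_ : p = q)//; apply/val_inj; rewrite /= qp.
apply: (@weighted_L1_density R w (fun f : R -> R[i] => f \in L1_pred w) Q (measurable_weight w) (@weight_ge0 _ w)).
- exact: weight_locb.
- have z0 : wnorm1 w (fun=> 0) = 0%E by apply: integral0_eq => x _; rewrite normc0 mul0r.
  have [q qE] : exists q : L1 w, q = (fun=> 0) :> (R -> R[i]).
    by apply: L1_ex; [exact: cmeasurable_cst|rewrite z0 ltry].
  exists q => //; apply: eq0_normc; apply/eqP; rewrite eq_le normc_ge0 andbT -(mulr0 K).
  by apply: lbd; rewrite qE z0.
- move=> a f1 f2 [p1 p1E l1] [p2 p2E l2]; have [r rE] := L1_lin_ex a p1 p2.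
  exists r; first by rewrite rE p1E p2E.
  by rewrite (llin a p1 p2 r) ?l1 ?l2 ?mulr0 ?addr0// => x _; rewrite rE.
- move=> f fP mf fapp; exists (MkL1 fP) => //.
  apply: eq0_normc; apply/eqP; rewrite eq_le normc_ge0 andbT.
  apply/ler_addgt0Pr => e e0; rewrite add0r.
  have d0 : 0 < e / (K + 1) by rewrite divr_gt0// ltr_wpDl.
  have [g [[q qE lq] mg fg]] := fapp _ d0.
  have [r rE] := L1_lin_ex (-1) q (MkL1 fP).
  have -> : l (MkL1 fP) = l r.
    by rewrite (llin (-1) q (MkL1 fP) r) ?lq ?mulr0 ?add0r// => x _; rewrite rE.
  apply: (@le_trans _ _ (K * (e / (K + 1)))).
    apply: lbd; rewrite (_ : wnorm1 w r = wnorm1 w (fun x => (f x - g x)%R))//.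
    by apply: eq_wnorm1 => x _; rewrite rE qE mulN1r addrC.
  by rewrite mulrCA ger_pMr// ler_pdivrMr ?mul1r ?lerDl// ltr_wpDl.
- by move=> E X mE EX; have [q <-] := @L1_ind_ex _ w _ _ mE EX; exact: (valP q).
- move=> a a0; have ma : measurable (`[0, a[%classic : set R) by [].
  have [q qE] := @L1_ind_ex _ w _ _ ma (@subset_refl _ _).
  by exists q => //; exact: lind qE.
Qed.

Lemma cintegral_itv (a b : R) : 0 <= a -> a <= b ->
  (\int[mu]_(x in halfline) (\1_(`[a, b[%classic : set R) x)%:E = (b - a)%:E)%E.
Proof.
move=> a0 ab; rewrite integral_indic//; last exact: mH.
rewrite (_ : _ `&` _ = `[a, b[%classic); last first.
  apply/seteqP; split => x /=; first by case.
  move=> xab; split => //; move: xab; rewrite in_itv/= => /andP[ax _].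
  by rewrite halflineE (le_trans a0 ax).
transitivity (mu `[a, b[%classic) => //; rewrite lebesgue_measure_itv/= lte_fin; case: ltP => [_|ba]; first by rewrite EFinB.
by rewrite (_ : b = a) ?subrr//; apply/eqP; rewrite eq_le ba ab.
Qed.

(** The value at x is the integral of f over [x, x + a[. It differs from the value at 0 only through
    the windows [0, x[ and [a, a + x[, which stay inside [0, a + 1[, where w is at most B, as x <=
    1. *)
Lemma ract_ind_lipschitz f p (a : R) : 0 <= a -> p = ind `[0, a[ :> (R -> R[i]) ->
  exists2 c, 0 <= c & forall x, 0 <= x <= 1 -> normc (ract f p x - ract f p 0) <= c * x.
Proof.
move=> a0 pE.
have a1 : 0 <= a + 1 by rewrite addr_ge0.
have [B HB] := weight_locb w a1.
have B0 : 0 <= B by apply: le_trans (HB 0 _); rewrite ?weight0 ?ler01// lexx.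
exists (2 * L0inf_norm f * (2 * B)); first by rewrite !mulr_ge0 ?L0inf_norm_ge0.
move=> x /andP[x0 x1].
have indm (b c : R) : measurable (`[b, c[%classic : set R) by [].
have S1 : `[x, x + a[%classic `<=` (`[0, x + a[%classic : set R).
  by move=> y /=; rewrite !in_itv/= => /andP[xy ->]; rewrite (le_trans x0 xy).
have [q qE] := @L1_ind_ex _ w _ _ (indm x (x + a)) S1.
have gx z (r : L1 w) : 0 <= z -> r = ind `[z, z + a[ :> (R -> R[i]) ->
    ract f p z = cintegral (fun y => f y * r y).
  move=> z0 rE; rewrite -[LHS]/(cintegral (fun y => f (z + y) * p y)).
  rewrite -(@cintegral_shift _ (fun y => f y * r y) z)//.
  - apply: eq_cintegral => y hy; congr (_ * _); rewrite pE rE /ind !indicE !mem_setE.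
    by rewrite !in_itv/= lerDl ltrD2l.
  - by apply: cmeasurable_mul; [exact: cmeasurable_L0inf|exact: cmeasurable_L1].
  - move=> y /andP[_ yz]; rewrite rE ind_out ?mulr0//= in_itv/= => /andP[zy _].
    by have := lt_le_trans yz zy; rewrite ltxx.
have p0E : p = ind `[0, 0 + a[ :> (R -> R[i]) by rewrite add0r.
have [r rE] := L1_lin_ex (-1) p q.
have -> : ract f p x - ract f p 0 = cintegral (fun y => f y * r y).
  rewrite (gx x q x0 qE) (gx 0 p (lexx 0) p0E) rE.
  rewrite (@eq_cintegral _ (fun y => f y * (-1 * p y + q y))
    (fun y => -1 * (f y * p y) + f y * q y)); last first.
    by move=> y _; ring.
  by rewrite cintegral_lin ?mulN1r 1?addrC//; exact: cintegrable_L0inf.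
rewrite (_ : _ * x = 2 * (L0inf_norm f * (2 * B * x))); last by ring.
apply: cintegral_mul_le; [exact: L0inf_norm_ge0|exact: cmeasurable_L0inf|
  exact: L0inf_norm_wbounded|exact: cmeasurable_L1|].
apply: (@le_trans _ _ (\int[mu]_(y in halfline) (B * (\1_(`[0, x[%classic : set R) y
    + \1_(`[a, a + x[%classic : set R) y))%:E)%E).
  apply: ge0_le_integral => //; first exact: mH.
  - by move=> y hy; rewrite lee_fin mulr_ge0 ?normc_ge0 ?weight_ge0.
  - apply/measurable_EFinP; apply: measurable_funM; last exact: measurable_weight.
    by apply: cmeasurable_normc; exact: cmeasurable_L1.
  - apply/measurable_EFinP; apply: measurable_funM => //.
    by apply: measurable_funD; exact: measurable_funTS.
  - move=> y; rewrite halflineE => y0; rewrite lee_fin rE pE qE.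
    rewrite mulN1r addrC /ind -rmorphB normc_real !indicE !mem_setE !in_itv/= y0/=.
    have w0 := ltW (weight_gt0 w y0).
    have [ya|ya] := ltP y (a + 1); last first.
      rewrite (_ : (y < x + a) = false); last by apply/negbTE; rewrite -leNgt (le_trans _ ya)// addrC lerD2l.
      rewrite (_ : (y < a) = false); last by apply/negbTE; rewrite -leNgt (le_trans _ ya)// lerDl.
      by rewrite andbF subrr normr0 mul0r mulr_ge0.
    have wB : w y <= B by apply: HB; rewrite y0 ltW.
    rewrite [leRHS]mulrC ler_pM// [x <= y]leNgt [a <= y]leNgt [a + x]addrC.
    case: (ltP y x) => h1; case: (ltP y a) => h2; case: (ltP y (x + a)) => h3 /=;
      rewrite ?subrr ?subr0 ?sub0r ?normrN ?normr0 ?normr1 ?addr0 ?add0r//; lra.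
under eq_integral do rewrite EFinM.
rewrite ge0_integralZl_EFin//; [|exact: mH|]; last first.
  by apply/measurable_EFinP; apply: measurable_funD; exact: measurable_funTS.
under eq_integral do rewrite EFinD.
rewrite ge0_integralD//; [|exact: mH| |]; last 2 first.
- by apply/measurable_EFinP; exact: measurable_funTS.
- by apply/measurable_EFinP; exact: measurable_funTS.
rewrite !cintegral_itv// ?lerDl// -EFinD -EFinM lee_fin subr0 [a + x]addrC addrK.
by rewrite le_eqVlt; apply/orP; left; apply/eqP; ring.
Qed.

Lemma unit_average_ex (k : nat) : exists p,
  p = (fun x => (k.+1%:R)%:C * ind `[0, (k.+1%:R)^-1[ x) :> (R -> R[i]).
Proof.
have mk : measurable (`[0, (k.+1%:R)^-1[%classic : set R) by [].
have [q qE] := @L1_ind_ex _ w _ _ mk (@subset_refl _ _).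
have [r rE] := L1_lin_ex ((k.+1%:R)%:C - 1) q q.
exists r; rewrite rE qE; apply/funext => x.
by rewrite mulrBl mul1r subrK.
Qed.

(** It suffices that u (ract f p) is the integral of f p, for then [arens_act u f] = f a.e. When p
    is the indicator of [0, a[, [ract f p] is Lipschitz near 0, its value at 0 is that integral, and
    its means near 0 converge to it; [L1_functional_eq0] extends this to all p. The ultralimit
    defines u also where the means diverge. *)
Lemma right_unit_ex : exists u : L0inf_dual w, forall m, m ** u = m.
Proof.
have [L [Llin Lle Lcvg]] := @cultralimit_ex R.
pose P k : L1 w := sval (cid (unit_average_ex k)).
have PE k x : P k x = (k.+1%:R)%:C * ind `[0, (k.+1%:R)^-1[ x.
  by rewrite (svalP (cid (unit_average_ex k))).
pose v k f := cintegral (fun x => f x * P k x).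
have [B HB] := weight_locb w (@ler01 R).
have B0 : 0 <= B by apply: le_trans (HB 0 _); rewrite ?weight0 ?ler01// lexx.
have k0 k : 0 < k.+1%:R :> R by [].
have kV k : 0 <= (k.+1%:R)^-1 :> R by rewrite invr_ge0.
have kV1 k : (k.+1%:R)^-1 <= 1 :> R by rewrite invf_le1// ler1n.
have PB k : (wnorm1 w (P k) <= B%:E)%E.
  apply: (@le_trans _ _ (\int[mu]_(y in halfline) (B * k.+1%:R *
      (\1_(`[0, (k.+1%:R)^-1[%classic : set R) y))%:E)%E).
    apply: ge0_le_integral => //; first exact: mH.
    - by move=> y hy; rewrite lee_fin mulr_ge0 ?normc_ge0 ?weight_ge0.
    - apply/measurable_EFinP; apply: measurable_funM; last exact: measurable_weight.
      by apply: cmeasurable_normc; exact: cmeasurable_L1.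
    - by apply/measurable_EFinP; apply: measurable_funM => //; exact: measurable_funTS.
    - move=> y hy; rewrite lee_fin PE normcM normc_real normc_ind ger0_norm//.
      rewrite [B * _]mulrC -!mulrA ler_wpM2l// [leRHS]mulrC !indicE !mem_setE in_itv/=.
      case: andP => [[y0 yk]|]; last by rewrite !mul0r.
      by rewrite !mul1r HB// y0 ltW// (lt_le_trans yk).
  under eq_integral do rewrite EFinM.
  rewrite ge0_integralZl_EFin//; [|exact: mH| |].
  - by rewrite cintegral_itv// -EFinM subr0 mulfK// gt_eqF.
  - by apply/measurable_EFinP; exact: measurable_funTS.
  - by rewrite mulr_ge0.
have vle f M k : 0 <= M -> wbounded w f M -> normc (v k f) <= 2 * (M * B).
  by move=> M0 fM; exact: (cintegral_mul_le M0 (cmeasurable_L0inf f) fM (cmeasurable_L1 _) (PB k)).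
have vlin k a f g : v k (a *: f + g) = a * v k f + v k g by exact: cintegral_L0inf_lin.
pose ul f : R[i] := L (fun k => v k f).
have bv f k : normc (v k f) <= 2 * (L0inf_norm f * B).
  exact: vle (L0inf_norm_ge0 f) (@L0inf_norm_wbounded _ _ f).
have ullin (a : R[i]) f g : ul (a *: f + g) = a * ul f + ul g.
  by rewrite /ul -(Llin _ _ _ _ _ (bv f) (bv g)); congr L; apply/funext => k; rewrite vlin.
have ulle : dual_le ul (4 * B).
  move=> f M M0 fM; rewrite (_ : 4 * B * M = 2 * (2 * (M * B))); last by ring.
  by apply: Lle => k; exact: vle.
pose u : L0inf_dual w := MkL0inf_dual (dual_in ullin ulle).
have uE f : u f = ul f by [].
have B4 : 0 <= 4 * B by rewrite mulr_ge0.
have uact f p : u (ract f p) = cintegral (fun x => f x * p x).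
  apply/eqP; rewrite -subr_eq0; apply/eqP.
  pose l p := u (ract f p) - cintegral (fun x => f x * p x).
  rewrite -/(l p).
  have F0 := L0inf_norm_ge0 f; have fF := @L0inf_norm_wbounded _ _ f.
  apply: (@L1_functional_eq0 l (2 * (4 * B) * L0inf_norm f + 2 * L0inf_norm f)).
  - by rewrite addr_ge0// !mulr_ge0.
  - move=> a q1 q2 r rE; rewrite /l (dual_ract_linr u f rE).
    rewrite (@eq_cintegral _ (fun x => f x * r x) (fun x => a * (f x * q1 x) + f x * q2 x)); last first.
      by move=> x hx; rewrite rE// mulrDr mulrCA.
    rewrite cintegral_lin; [|exact: cintegrable_L0inf|exact: cintegrable_L0inf].
    by rewrite mulrBr opprD addrACA.
  - move=> q I qI; rewrite (le_trans (normc_leD _ _))// normcN mulrDl lerD//.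
      exact: dual_ract_le.
    by rewrite -mulrA; exact: (cintegral_mul_le F0 (cmeasurable_L0inf f) fF (cmeasurable_L1 _) qI).
  - move=> a q a0 qE; rewrite /l.
    have h0 : halfline (0 : R) by rewrite halflineE.
    have -> : cintegral (fun x => f x * q x) = ract f q 0.
      rewrite -[RHS]/(cintegral (fun y => f (0 + y) * q y)).
      by apply: eq_cintegral => y _; rewrite add0r.
    have [c c0 Hc] := ract_ind_lipschitz f a0 qE.
    set g := ract f q in Hc *.
    have vc k : normc (v k g - g 0) <= 2 * (c * (k.+1%:R)^-1).
      have gP : cintegrable (fun x => g x * P k x) by exact: cintegrable_L0inf.
      have cP : cintegrable (P k).
        have := @cintegrable_mul _ w (fun=> 1) 1 (P k) ler01 (cmeasurable_cst _).
        move=> /(_ _ (cmeasurable_L1 _) (wnorm1_L1 _))/wrap[].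
          by apply: aeW => y; rewrite halflineE => y0; rewrite normc1 mul1r weight_ge1.
        by congr cintegrable; apply/funext => x; rewrite mul1r.
      have P1 : cintegral (P k) = 1.
        have PR x : complex.Re (P k x) = k.+1%:R * \1_(`[0, (k.+1%:R)^-1[%classic : set R) x.
          by rewrite PE Defs.ReM /= mul0r subr0.
        have PI x : complex.Im (P k x) = 0.
          by rewrite PE Defs.ImM /= mul0r mulr0 addr0.
        apply/eqP; rewrite eq_complex /=; apply/andP; split; apply/eqP.
          under eq_Rintegral do rewrite PR.
          rewrite /Rintegral; under eq_integral do rewrite EFinM.
          rewrite ge0_integralZl_EFin//; [|exact: mH|].
            by rewrite cintegral_itv// -EFinM subr0 mulfV// gt_eqF.
          by apply/measurable_EFinP; exact: measurable_funTS.
        by under eq_Rintegral do rewrite PI; rewrite /Rintegral integral0.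
      have -> : v k g - g 0 = cintegral (fun x => - g 0 * P k x + g x * P k x).
        by rewrite cintegral_lin// P1 mulr1 addrC.
      apply: (@cintegral_bound _ _ (fun y => c * (\1_(`[0, (k.+1%:R)^-1[%classic : set R) y))).
      + apply: cmeasurable_lin; first exact: cmeasurable_L1.
        by case: gP.
      + by apply: measurable_funM => //; exact: measurable_funTS.
      + by move=> y _; rewrite mulr_ge0.
      + apply: aeW => y; rewrite halflineE => y0.
        rewrite -mulrDl normcM addrC PE normcM normc_real ger0_norm// normc_ind indicE mem_setE in_itv/= y0/=.
        case: ltP => [yk|_]; last by rewrite !mulr0.
        rewrite !mulr1; apply: (@le_trans _ _ (c * y * k.+1%:R)).
          by rewrite ler_wpM2r// Hc// y0 (le_trans (ltW yk)).
        by rewrite -mulrA ler_piMr// -ler_pdivlMr// mul1r ltW.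
      under eq_integral do rewrite EFinM.
      rewrite ge0_integralZl_EFin//; [|exact: mH|].
        by rewrite cintegral_itv// subr0.
      by apply/measurable_EFinP; exact: measurable_funTS.
    have c1 : (fun k => 2 * c * (k.+1%:R)^-1) @ \oo --> (0 : R).
      by rewrite -[X in _ --> X](mulr0 (2 * c)); apply: cvgMr; exact: cvg_harmonic.
    rewrite uE /ul (Lcvg _ (g 0)) ?subrr//.
    apply/cvgrPdist_le => e e0.
    move/cvgrPdist_le : (c1) => /(_ e e0); apply: filterS => k.
    rewrite !sub0r !normrN => h; rewrite ger0_norm ?normc_ge0// (le_trans (vc k))//.
    by rewrite mulrA (le_trans _ h)// ler_norm.
exists u => m; apply: dual_val_inj => f; rewrite arens_mulE.
apply: L0inf_dual_ae; apply: arens_act_unique => E X p _ _ _.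
by rewrite uact.
Qed.

End right_unit.

(** * Norm estimates, separation of the exponentials, idempotents *)

Section arens_algebra.
Context {R : realType} {w : weight R}.
Local Notation A := (L0inf_dual w).
Implicit Types (f g : L0inf w) (m n u : A) (p q : L1 w) (E : set R).
Local Notation mu := (@lebesgue_measure R).
Local Notation mH := measurable_halfline.

Lemma dual_linE (a : R[i]) m n f : (a *: m + n) f = a * m f + n f.
Proof. by []. Qed.

Lemma dualDE m n f : (m + n) f = m f + n f. Proof. by []. Qed.
Lemma dualBE m n f : (m - n) f = m f - n f. Proof. by []. Qed.
Lemma dualZE (a : R[i]) m f : (a *: m) f = a * m f. Proof. by []. Qed.
Lemma dual_0E f : (0 : A) f = 0. Proof. by []. Qed.

Lemma arens_mulDl m n u : (m + n) ** u = m ** u + n ** u.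
Proof. by rewrite -[m]scale1r arens_mul_linl !scale1r. Qed.

Lemma arens_mulDr m n u : u ** (m + n) = u ** m + u ** n.
Proof. by rewrite -[m]scale1r arens_mul_linr !scale1r. Qed.

Lemma arens_mul0l u : 0 ** u = 0.
Proof. by apply: (addrI (0 ** u)); rewrite -arens_mulDl !addr0. Qed.

Lemma arens_mul0r u : u ** 0 = 0.
Proof. by apply: (addrI (u ** 0)); rewrite -arens_mulDr !addr0. Qed.

Lemma dual_leS (m : L0inf w -> R[i]) (C K : R) : C <= K -> dual_le m C -> dual_le m K.
Proof. by move=> CK mC f M M0 fM; rewrite (le_trans (mC f M M0 fM))// ler_wpM2r. Qed.

Lemma dual_le_lin (a : R[i]) m n (C K : R) :
  dual_le m C -> dual_le n K -> dual_le (a *: m + n) (normc a * C + K).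
Proof.
move=> mC nK f M M0 fM; rewrite dual_linE (le_trans (normc_leD _ _))// mulrDl.
by rewrite lerD ?nK// normcM -mulrA ler_wpM2l ?normc_ge0 ?mC.
Qed.

Lemma dual_leZ (a : R[i]) m (C : R) : dual_le m C -> dual_le (a *: m) (normc a * C).
Proof.
by move=> mC f M M0 fM; rewrite dualZE normcM -mulrA ler_wpM2l ?normc_ge0 ?mC.
Qed.

Lemma dual_leD m n (C K : R) : dual_le m C -> dual_le n K -> dual_le (m + n) (C + K).
Proof.
by move=> /(dual_le_lin 1) /[apply]; rewrite scale1r normc1 mul1r.
Qed.

Lemma dual_leN m (C : R) : dual_le m C -> dual_le (- m) C.
Proof.
by move=> /(dual_leZ (-1)); rewrite scaleN1r normcN normc1 mul1r.
Qed.

Lemma dual_le_expo m (C : R) k : dual_le m C -> normc (m (expo k)) <= C.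
Proof. by move=> /(_ _ _ ler01 (@wbounded_expo _ w k)); rewrite mulr1. Qed.

Lemma dual_cintegral_ex p : exists m, forall f, m f = cintegral (fun x => f x * p x).
Proof.
have lin : forall (a : R[i]) f g, cintegral (fun x => (a *: f + g) x * p x) =
    a * cintegral (fun x => f x * p x) + cintegral (fun x => g x * p x).
  by move=> a f g; exact: cintegral_L0inf_lin.
have I0 : (0 <= wnorm1 w p)%E by apply: wnorm1_ge0; exact: weight_ge0.
have le : dual_le (fun f : L0inf w => cintegral (fun x => f x * p x)) (2 * fine (wnorm1 w p)).
  move=> f M M0 fM; rewrite -mulrA [fine _ * M]mulrC.
  apply: (cintegral_mul_le M0 (cmeasurable_L0inf f) fM (cmeasurable_L1 p)).
  by rewrite fineK// ge0_fin_numE ?wnorm1_L1.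
by exists (MkL0inf_dual (dual_in lin le)).
Qed.

(** Integration against L^1(w) already detects e_k. With m ** u = m, a single nonzero value m(e_k)
    yields u(e_k) = 1. *)
Lemma expo_neq0_ex k : exists m, m (expo k) != 0.
Proof.
apply: contrapT => no.
have all0 m : m (expo k) = 0 by apply/eqP; apply: contrapT => /negP m0; apply: no; exists m.
have := ae_normc_le_of_cintegral_le ler01 (cmeasurable_L0inf (expo k)) (@wbounded_expo _ w k)
  mH (@subset_refl _ _) (lexx 0).
move=> /(_ _)/wrap[].
  move=> E X p I _ _ _ _ _; rewrite mul0r; have [m mE] := dual_cintegral_ex p.
  by rewrite -mE all0 normc0.
move=> [N [mN N0 sub]].
have : (mu (`[0%R, 1%R]%classic : set R) <= mu N)%E.
  apply: le_measure; rewrite ?inE//.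
  move=> y; rewrite /= in_itv/= => /andP[y0 _]; apply: sub => /= H.
  have hy : halfline (y : R) by rewrite halflineE.
  move: (H hy); rewrite expoE normc_expR mulr0 mul0r leNgt expR_gt0//.
by rewrite N0 lebesgue_measure_itv/= lte_fin ltr01 oppr0 adde0 lee_fin ler10.
Qed.

Lemma right_unit_expo u : (forall m, m ** u = m) -> forall k, u (expo k) = 1.
Proof.
move=> ux k; have [m m0] := expo_neq0_ex k.
by apply: (mulfI m0); rewrite mulr1 -expo_mult ux.
Qed.

Lemma shift_ex f : exists g : L0inf w, g = (fun y => f (1 + y)) :> (R -> R[i]).
Proof.
have h1 : halfline (1 : R) by rewrite halflineE.
have w0 : 0 < w 1 by exact: weight_gt0.
apply: (@L0inf_ex _ _ _ (L0inf_norm f * w 1)).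
- by apply: cmeasurable_shift => //; exact: cmeasurable_L0inf.
- by rewrite mulr_ge0 ?L0inf_norm_ge0// ltW.
- by apply: wbounded_shift => //; [exact: L0inf_norm_ge0|exact: L0inf_norm_wbounded].
move=> e e0; have e1 : 0 < e / w 1 by rewrite divr_gt0.
have [X X0 HX] := L0inf_tail f e1; exists X => //.
have := ae_translate 1 HX; apply: ae_mono => y Hy Xy.
have y0 : 0 <= y by rewrite (le_trans X0)// ltW.
rewrite (le_trans (Hy _))//; first by rewrite (lt_le_trans Xy)// lerDr.
rewrite -mulrA ler_wpM2l//; first exact: ltW.
by rewrite mulrC ler_pdivrMr// mulrC weightD.
Qed.

(* Witness: the unit mass at 1, that is, a right unit applied to translates. *)
Lemma expo_separating_ex : exists m, injective (fun k => m (expo k)).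
Proof.
have [x ux] := @right_unit_ex R w.
have [C C0 xC] := dual_bounded x.
have h1 : halfline (1 : R) by rewrite halflineE.
pose S f : L0inf w := sval (cid (shift_ex f)).
have SE f y : S f y = f (1 + y) by rewrite (svalP (cid (shift_ex f))).
have lin : forall (a : R[i]) f g, x (S (a *: f + g)) = a * x (S f) + x (S g).
  move=> a f g; apply: dual_eq; apply: aeW => y _.
  by rewrite !SE L0inf_linE.
have le : dual_le (fun f : L0inf w => x (S f)) (C * w 1).
  move=> f M M0 fM; rewrite -mulrA [w 1 * M]mulrC; apply: xC.
    by rewrite mulr_ge0// weight_ge0.
  have := wbounded_shift M0 h1 fM; apply: ae_mono => y + hy => /(_ hy).
  by rewrite -SE.
exists (MkL0inf_dual (dual_in lin le)) => j k; rewrite /=.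
have key i : x (S (expo i)) = (expR (- i.+1%:R))%:C.
  rewrite (@dual_eq _ _ x (expR (- i.+1%:R))%:C (expo i) 0).
    by rewrite dual0 addr0 right_unit_expo// mulr1.
  apply: aeW => y _; rewrite SE !expoE [(0 : L0inf w) y]/(0) addr0 -rmorphM -expRD.
  by rewrite mulrDr mulr1.
rewrite !key => -[] /expR_inj /oppr_inj /eqP; rewrite eqr_nat => /eqP.
by case.
Qed.

Lemma idem_expo m : m ** m = m ->
  (exists N, forall k, (N <= k)%N -> m (expo k) = 0) \/
  (exists N, forall k, (N <= k)%N -> m (expo k) = 1).
Proof.
move=> mm; have [C C0 mC] := dual_bounded m.
have v k : m (expo k) = 0 \/ m (expo k) = 1.
  have /eqP := expo_mult m m k; rewrite mm -{1}[m (expo k)]mulr1 -subr_eq0 -mulrBr mulf_eq0.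
  by case/orP; [move/eqP; left|rewrite subr_eq0 => /eqP <-; right].
(* For k >= N consecutive values differ by at most C / (k + 1) < 1, too little to pass from 0 to
   1. *)
have [N HN] : exists N : nat, C < N%:R.
  by exists (Num.bound C); exact: archi_boundP.
have step k : (N <= k)%N -> m (expo k.+1) = m (expo k).
  move=> Nk.
  have kV : 0 <= (k.+1%:R)^-1 :> R by rewrite invr_ge0.
  have : normc (m (-1 *: expo k.+1 + expo k)) < 1.
    have wB : wbounded w (-1 *: expo k.+1 + expo k : L0inf w) (k.+1%:R)^-1.
      exact: wbounded_expoB.
    apply: le_lt_trans (mC _ _ kV wB) _.
    rewrite ltr_pdivrMr// mul1r (lt_trans HN)// ltr_nat ltnS//.
  rewrite dual_lin mulN1r.
  by case: (v k) => ->; case: (v k.+1) => ->; rewrite // ?oppr0 ?add0r ?addr0 ?normcN normc1 ltxx.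
have st k : (N <= k)%N -> m (expo k) = m (expo N).
  elim: k => [|k IH]; first by rewrite leqn0 => /eqP ->.
  by rewrite leq_eqVlt => /predU1P[<-//|]; rewrite ltnS => Nk; rewrite step ?IH.
by case: (v N) => vN; [left|right]; exists N => k Nk; rewrite st.
Qed.

End arens_algebra.

(** * Statements (i) and (ii) *)

Section generalized_derivation.
Context {R : realType} {w : weight R}.
Local Notation A := (L0inf_dual w).
Variables theta D d : {linear A -> A}.
Hypothesis theta_mul : multiplicative_map theta.
Hypothesis gder : theta_generalized_derivation theta D d.

Lemma ran_preserved r : in_ran r -> in_ran (D r).
Proof.
have [_ DM] := gder; have [u uE] := @right_unit_ex R w.
have pp : theta u ** theta u = theta u by rewrite -theta_mul uE.
move=> rr; case: (idem_expo pp) => -[N HN].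
  have t0 m : theta m = 0 by rewrite -(uE m) theta_mul (in_ran_of_expo HN).
  by move=> m; rewrite -(uE r) DM !t0 arens_mul0l arens_mul0r addr0 arens_mul0r.
have tr0 k : (N <= k)%N -> theta r (expo k) = 0.
  move=> Nk; have := expo_mult (theta u) (theta r) k.
  by rewrite -theta_mul rr linear0 HN// mul1r => <-.
apply: (@in_ran_of_expo _ _ N) => k Nk.
have := congr1 (fun m : A => m (expo k)) (DM u r).
rewrite rr linear0 dualDE !expo_mult HN// tr0// mulr0 addr0 mul1r => <-.
by rewrite dual_0E.
Qed.

Lemma centralizing_commuting : theta_centralizing theta D <-> theta_commuting theta D.
Proof.
have [u uE] := @right_unit_ex R w.
split=> H m; last first.
  by move=> n; rewrite H subrr arens_mul0l arens_mul0r.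
set z := D m ** theta m - theta m ** D m.
have zr : in_ran z.
  apply: (@in_ran_of_expo _ _ 0) => k _.
  by rewrite dualBE !expo_mult mulrC subrr.
apply/eqP; rewrite -subr_eq0 -/z; apply/eqP.
by rewrite -(uE z) (H m u) zr.
Qed.

End generalized_derivation.

(** * Gliding humps in the dual *)

Section gliding_hump.
Context {R : realType} {w : weight R}.
Local Notation A := (L0inf_dual w).
Implicit Types (f g : L0inf w) (m n x y : A) (T : A -> A).

(* Halving adjoints commute with pointwise limits of functionals. *)
Definition halving_adjoint T := exists S : L0inf w -> L0inf w,
  (forall m f, T m f = m (S f)) /\
  (forall f M, 0 <= M -> wbounded w f M -> wbounded w (S f) (M / 2)).

Lemma halving_adjoint_le T m C : halving_adjoint T -> dual_le m C -> dual_le (T m) (C / 2).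
Proof.
move=> [S [TE SM]] mC f M M0 fM; rewrite TE (_ : C / 2 * M = C * (M / 2)); last by ring.
by apply: mC; [rewrite divr_ge0|exact: SM].
Qed.

(** y k stands for x k + T k (x k.+1 + T k.+1 (x k.+2 + ...)). Halving keeps the finite sums [s j k]
    of j terms in the ball of radius 2; the infinite sums are ultralimits, which costs a second
    factor 2, and pass through [T k] because it is an adjoint. *)
Lemma nested_series_ex (x : nat -> A) (T : nat -> A -> A) :
  (forall k, dual_le (x k) 1) -> (forall k, halving_adjoint (T k)) ->
  exists y : nat -> A, forall k, dual_le (y k) 4 /\ y k = x k + T k (y k.+1).
Proof.
move=> x1 Th; have [L [Llin Lle Lcvg]] := @cultralimit_ex R.
pose s := fix s j k : A := if j is i.+1 then x k + T k (s i k.+1) else 0.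
have s2 j k : dual_le (s j k) 2.
  elim: j k => [|j IH] k /=; first by move=> f M M0 _; rewrite (_ : normc _ = 0) ?mulr_ge0//; exact: normc0.
  rewrite [2](_ : _ = 1 + 2 / 2); last by field.
  by apply: dual_leD => //; apply: halving_adjoint_le.
(* The length j - k makes all the sums end at the common index j, so that the recursion between k
   and k + 1 holds exactly for j > k. *)
pose z k f := L (fun j => s (j - k)%N k f).
have zb k f : forall j, normc (s (j - k)%N k f) <= 2 * L0inf_norm f.
  by move=> j; apply: s2; [exact: L0inf_norm_ge0|exact: L0inf_norm_wbounded].
have zlin k (a : R[i]) f g : z k (a *: f + g) = a * z k f + z k g.
  rewrite /z -(Llin _ _ _ _ _ (zb k f) (zb k g)); congr L; apply/funext => j.
  by rewrite dual_lin.
have z4 k : dual_le (z k) 4.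
  move=> f M M0 fM; rewrite (_ : 4 * M = 2 * (2 * M)); last by ring.
  by apply: Lle => j; exact: s2.
exists (fun k => MkL0inf_dual (dual_in (zlin k) (z4 k))) => k; split; first exact: z4.
apply: dual_val_inj => f; rewrite dualDE.
have [S [TE SM]] := Th k.
rewrite TE /= /z; apply/eqP; rewrite -subr_eq0; apply/eqP.
transitivity (L (fun j => (-1) * s (j - k.+1)%N k.+1 (S f) + s (j - k)%N k f) - x k f).
  by rewrite (Llin _ _ _ _ _ (zb k.+1 (S f)) (zb k f)) mulN1r opprD addrA addrAC [- L _ + _]addrC.
apply/eqP; rewrite subr_eq0; apply/eqP; apply: Lcvg.
apply: cvg_near_cst; exists k.+1 => // j /= kj.
rewrite (_ : (j - k)%N = (j - k.+1).+1) /=; last by rewrite subnSK.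
set a := s (j - k.+1)%N k.+1; rewrite -[X in _ + X - _]/(x k f + T k a f) TE mulN1r addrA addrAC addrK.
by rewrite addNr normc0.
Qed.

(* The invariant I is carried by the affine maps which send the k-th remainder
   of the series under construction to its sum. *)
Lemma gliding_hump (I : nat -> (A -> A) -> Prop) (Q : nat -> A -> Prop) :
  I 0 id ->
  (forall k F, I k F -> exists x T, [/\ dual_le x 1, halving_adjoint T,
     I k.+1 (fun y => F (x + T y)) &
     forall y, dual_le y 4 -> Q k (F (x + T y))]) ->
  exists x, forall k, Q k x.
Proof.
move=> I0 IS.
pose st (k : nat) := {F : A -> A | I k F}.
pose xT k (F : st k) := cid (IS k (sval F) (svalP F)).
pose xx k (F : st k) := sval (xT k F).
pose TT k (F : st k) := sval (cid (svalP (xT k F))).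
have prop k (F : st k) : [/\ dual_le (xx k F) 1, halving_adjoint (TT k F),
     I k.+1 (fun y => sval F (xx k F + TT k F y)) &
     forall y, dual_le y 4 -> Q k (sval F (xx k F + TT k F y))].
  exact: (svalP (cid (svalP (xT k F)))).
have nextI k (F : st k) : I k.+1 (fun y => sval F (xx k F + TT k F y)).
  by case: (prop k F).
pose F := fix F k : st k := if k is j.+1 then exist _ _ (nextI j (F j)) else exist _ _ I0.
have [|k|y yE] := @nested_series_ex (fun k => xx k (F k)) (fun k => TT k (F k)).
- by move=> k; case: (prop k (F k)).
- by case: (prop k (F k)).
have Fy k : sval (F k) (y k) = y 0%N.
  by elim: k => //= k <-; have [_ <-] := yE k.
exists (y 0%N) => k; rewrite -(Fy k); have [_ ->] := yE k.
case: (prop k (F k)) => _ _ _; apply; by case: (yE k.+1).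
Qed.

End gliding_hump.

(** * The uniform boundedness principle *)

Section uniform_boundedness.
Context {R : realType} {w : weight R}.
Local Notation A := (L0inf_dual w).
Implicit Types (f g : L0inf w) (m n x y : A).

Definition scalar_map (phi : A -> R[i]) :=
  forall (a : R[i]) m n, phi (a *: m + n) = a * phi m + phi n.

Lemma scalar_mapD phi m n : scalar_map phi -> phi (m + n) = phi m + phi n.
Proof. by move=> /(_ 1 m n); rewrite scale1r mul1r. Qed.

Lemma scalar_map0 phi : scalar_map phi -> phi 0 = 0.
Proof. by move=> h; apply: (addrI (phi 0)); rewrite -scalar_mapD// !addr0. Qed.

Lemma scalar_mapZ phi (a : R[i]) m : scalar_map phi -> phi (a *: m) = a * phi m.
Proof. by move=> h; rewrite -[a *: m]addr0 h scalar_map0// addr0. Qed.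

Lemma dual_le0 (C : R) : 0 <= C -> dual_le (0 : A) C.
Proof.
by move=> C0 f M M0 _; rewrite (_ : normc _ = 0) ?mulr_ge0//; exact: normc0.
Qed.

Lemma normc_leB (z t : R[i]) : normc z - normc t <= normc (z + t).
Proof.
rewrite lerBlDr -[X in normc X <= _](addrK t) (le_trans (normc_leD _ _))//.
by rewrite normcN.
Qed.

Lemma unit_ball_bound phi (K F : R) m : scalar_map phi ->
  (forall m, dual_le m 1 -> normc (phi m) <= K) -> 0 < F -> dual_le m F ->
  normc (phi m) <= K * F.
Proof.
move=> phil phiK F0 mF.
have := phiK ((F^-1)%:C *: m); move=> /(_ _)/wrap[].
  have := dual_leZ (F^-1)%:C mF.
  by rewrite normc_real ger0_norm ?invr_ge0 ?(ltW F0)// mulVf// gt_eqF.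
rewrite scalar_mapZ// normcM normc_real ger0_norm ?invr_ge0 ?(ltW F0)//.
by rewrite mulrC ler_pdivrMr.
Qed.

(** A gliding hump whose invariant consists of the maps y |-> z + al y with al > 0. At stage k some
    phi j takes on al m a value exceeding k plus what z and the remainder can cancel. *)
Lemma uniform_boundedness (J : Type) (phi : J -> A -> R[i]) :
  (forall j, scalar_map (phi j)) ->
  (forall j, exists K, forall m, dual_le m 1 -> normc (phi j m) <= K) ->
  (forall m, exists B, forall j, normc (phi j m) <= B) ->
  exists K, forall j m, dual_le m 1 -> normc (phi j m) <= K.
Proof.
move=> phil phib phip; apply: contrapT => nK.
have big (K : R) : exists j m, dual_le m 1 /\ K < normc (phi j m).
  apply: contrapT => no; apply: nK; exists K => j m m1.
  by rewrite leNgt; apply/negP => Km; apply: no; exists j, m.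
pose I (k : nat) (F : A -> A) := exists (al : R) z, 0 < al /\ forall y, F y = z + al%:C *: y.
have [|k F [al [z [al0 FE]]]|x Qx] :=
    @gliding_hump R w I (fun k x => exists j, k%:R < normc (phi j x)).
- by exists 1, 0; split => // y; rewrite scale1r add0r.
- have [B HB] := phip z.
  (* After scaling by al the hump exceeds k + B + 1: B absorbs phi j z for every j, and 1 absorbs
     the remainder. *)
  have [j [m [m1 mK]]] := big ((k%:R + B + 1) / al).
  have [K HK] := phib j.
  have K0 : 0 <= K by apply: le_trans (HK 0 _); [exact: normc_ge0|exact: dual_le0].
  have s0 : 0 < 2 + 4 * al * K.
    by rewrite (@lt_le_trans _ _ 2)// lerDl !mulr_ge0// ltW.
  (* The 2 makes scaling by [ep] halving; 4 * al * K keeps al ep phi j y at most 1 for remainders y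
     of norm at most 4. *)
  pose ep := (2 + 4 * al * K)^-1.
  have ep0 : 0 < ep by rewrite invr_gt0.
  exists m, (fun y => ep%:C *: y); split => //.
  + exists (fun f => ep%:C *: f); split.
      by move=> n f; rewrite -[_ *: f]addr0 dual_lin dual0 addr0.
    move=> f M M0; apply: ae_mono => y Hy hy.
    rewrite -[(_ *: f) y]/(ep%:C * f y) normcM normc_real (ger0_norm (ltW ep0)).
    apply: (@le_trans _ _ (2^-1 * (M * w y))); last by rewrite mulrA [2^-1 * M]mulrC.
    apply: ler_pM; [exact: ltW|exact: normc_ge0| |exact: Hy].
    by rewrite lef_pV2 ?posrE// lerDl !mulr_ge0// ltW.
  + exists (al * ep), (z + al%:C *: m); split; first by rewrite mulr_gt0.
    by move=> y; rewrite FE scalerDr scalerA rmorphM addrA.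
  + move=> y y4; exists j; rewrite FE scalerDr scalerA -rmorphM.
    rewrite addrCA scalar_mapD// scalar_mapZ//.
    have alm : k%:R + B + 1 < normc (al%:C * phi j m).
      by rewrite normcM normc_real gtr0_norm// mulrC -ltr_pdivrMr.
    have phz := HB j.
    have phy : normc (phi j ((al * ep)%:C *: y)) <= 1.
      rewrite scalar_mapZ// normcM normc_real gtr0_norm ?mulr_gt0//.
      have := @unit_ball_bound _ K 4 y (phil j) HK ltac:(by []) y4.
      move=> /(ler_wpM2l (ltW (mulr_gt0 al0 ep0))) /le_trans; apply.
      rewrite (_ : _ * (K * 4) = 4 * al * K / (2 + 4 * al * K)); last by rewrite /ep; ring.
      by rewrite ler_pdivrMr// mul1r lerDr.
    rewrite scalar_mapD//; apply: lt_le_trans (normc_leB _ _).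
    have := normc_leD (phi j z) (phi j ((al * ep)%:C *: y)); lra.
have [B HB] := phip x.
have [j] := Qx (Num.bound B); apply/negP; rewrite -leNgt (le_trans (HB j))//.
have [j0] := Qx 0%N; move=> /ltW h0.
by rewrite ltW// archi_boundP// (le_trans h0).
Qed.

End uniform_boundedness.

(** * Derivations *)

Section derivation.
Context {R : realType} {w : weight R}.
Local Notation A := (L0inf_dual w).
Implicit Types (f g : L0inf w) (m n x y : A) (p q : L1 w) (E : set R).
Local Notation mu := (@lebesgue_measure R).
Local Notation mH := measurable_halfline.
Variable d : A -> A.
Hypothesis dlin : forall (a : R[i]) m n, d (a *: m + n) = a *: d m + d n.
Hypothesis dmul : forall m n, d (m ** n) = d m ** n + m ** d n.

Lemma derivation_scalar_map f : scalar_map (fun m => d m f).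
Proof. by move=> a m n; rewrite dlin. Qed.

Lemma derivationD m n : d (m + n) = d m + d n.
Proof. by rewrite -[m]scale1r dlin !scale1r. Qed.

(* Otherwise there are infinitely many bad exponentials expo (nn k). Right
   multiplication by aa k, which vanishes at expo (nn k) but not at expo (nn j)
   for j > k, makes d (m + y ** aa k) (expo (nn k)) independent of d y, so that
   it is large for a suitable m. *)
Lemma derivation_expo_bounded : exists N, forall k, (N <= k)%N ->
  exists K, forall m, dual_le m 1 -> normc (d m (expo k)) <= K.
Proof.
have [u uE] := @right_unit_ex R w.
have [b binj] := @expo_separating_ex R w.
pose bdd k := exists K, forall m, dual_le m 1 -> normc (d m (expo k)) <= K.
apply: contrapT => noN.
have pick N : exists k, (N <= k)%N /\ ~ bdd k.
  apply: contrapT => no; apply: noN; exists N => k Nk.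
  by apply: contrapT => nb; apply: no; exists k.
pose c N := sval (cid (pick N)).
have cP N : (N <= c N)%N /\ ~ bdd (c N) := svalP (cid (pick N)).
pose nn := fix nn k := if k is j.+1 then c (nn j).+1 else c 0%N.
have nnb k : ~ bdd (nn k) by case: k => [|k]; exact: (cP _).2.
have nnS k : (nn k < nn k.+1)%N := (cP (nn k).+1).1.
have nninj j k : (k < j)%N -> nn j != nn k.
  move=> kj; rewrite gtn_eqF//; exact: (homo_ltn ltn_trans nnS).
have a_ex k : exists a : A, [/\ a (expo (nn k)) = 0,
    forall j, (k < j)%N -> a (expo (nn j)) != 0 & halving_adjoint (fun y => y ** a)].
  (* As u(e_j) = 1, subtracting this multiple of u removes the value at [expo (nn k)]; the values at
     the later ones stay nonzero because b separates exponentials. *)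
  pose a0 := b - b (expo (nn k)) *: u.
  have [C C0 aC] := dual_bounded a0.
  have e0 : 0 < 8 * (C + 1) by rewrite mulr_gt0// ltr_wpDl.
  (* The action of e a0 multiplies bounds by at most 4 e C, and this choice makes it at most 1 /
     2. *)
  pose e := (8 * (C + 1))^-1.
  have e1 : 0 < e by rewrite invr_gt0.
  have a0E j : a0 (expo j) = b (expo j) - b (expo (nn k)).
    by rewrite /a0 dualBE dualZE (right_unit_expo uE) mulr1.
  exists (e%:C *: a0); split.
  - by rewrite dualZE a0E subrr mulr0.
  - move=> j kj; rewrite dualZE a0E mulf_neq0//.
      by apply/eqP => -[] /eqP; rewrite gt_eqF.
    by rewrite subr_eq0; apply/eqP => /binj /eqP; apply/negP; exact: nninj.
  - exists (arens_act (e%:C *: a0)); split; first by move=> m f; rewrite arens_mulE.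
    move=> f M M0 fM.
    have aeC := dual_leZ e%:C aC.
    rewrite normc_real gtr0_norm// in aeC.
    have eC0 : 0 <= e * C by rewrite mulr_ge0// ltW.
    apply: wboundedS (arens_act_wbounded eC0 aeC M0 fM).
    rewrite mulrC ler_wpM2l// /e.
    rewrite (_ : 4 * _ = 4 * C / (8 * (C + 1))); last by ring.
    by rewrite ler_pdivrMr//; lra.
pose aa k := sval (cid (a_ex k)).
have aaP k : [/\ aa k (expo (nn k)) = 0,
    forall j, (k < j)%N -> aa k (expo (nn j)) != 0 & halving_adjoint (fun y => y ** aa k)].
  exact: (svalP (cid (a_ex k))).
(* At each exponential still to be treated, d after F is a nonzero multiple of d up to a bounded
   error. The factor al accumulates the values of the earlier multipliers [aa] there. *)
pose I (k : nat) (F : A -> A) := forall j, (k <= j)%N -> exists (al : R[i]) (B : R),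
  al != 0 /\ forall y, dual_le y 4 ->
    normc (d (F y) (expo (nn j)) - al * d y (expo (nn j))) <= B.
have [|k F IF|x Qx] :=
    @gliding_hump R w I (fun k x => k%:R < normc (d x (expo (nn k)))).
- move=> j _; exists 1, 0; split; first exact: oner_neq0.
  by move=> y _; rewrite mul1r subrr normc0.
- have [ak0 akn0 akh] := aaP k.
  have [al [B [al0 HB]]] := IF k (leqnn k).
  have nal : 0 < normc al by rewrite lt_neqAle normc_ge0 eq_sym andbT; apply: contraNneq al0 => /eq0_normc ->.
  (* Available because d is unbounded at [expo (nn k)]. The first term survives the factor al and
     the error B; the second pays for y(e) d(aa k)(e) with y of norm at most 4. *)
  have [m [m1 mK]] : exists m, dual_le m 1 /\
      (k%:R + B) / normc al + 4 * normc (d (aa k) (expo (nn k))) < normc (d m (expo (nn k))).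
    apply: contrapT => no; apply: (nnb k).
    exists ((k%:R + B) / normc al + 4 * normc (d (aa k) (expo (nn k)))) => m m1.
    by rewrite leNgt; apply/negP => Km; apply: no; exists m.
  have y4' y : dual_le y 4 -> dual_le (m + y ** aa k) 4.
    move=> y4; apply: (@dual_leS _ _ _ (1 + 4 / 2)); first by lra.
    by apply: dual_leD => //; exact: (halving_adjoint_le akh).
  have dY y j : d (m + y ** aa k) (expo j) = d m (expo j) +
      (d y (expo j) * aa k (expo j) + y (expo j) * d (aa k) (expo j)).
    by rewrite derivationD dmul !dualDE !expo_mult.
  have yd y j : dual_le y 4 -> normc (y (expo j) * d (aa k) (expo j)) <=
      4 * normc (d (aa k) (expo j)).
    by move=> y4; rewrite normcM ler_wpM2r ?normc_ge0//; exact: dual_le_expo.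
  exists m, (fun y => y ** aa k); split => //.
  + move=> j kj; have [al' [B' [al'0 HB']]] := IF j (ltnW kj).
    exists (al' * aa k (expo (nn j))),
      (B' + normc al' * (normc (d m (expo (nn j))) + 4 * normc (d (aa k) (expo (nn j))))).
    split; first by rewrite mulf_neq0// akn0.
    move=> y y4.
    rewrite (_ : _ - _ = (d (F (m + y ** aa k)) (expo (nn j)) - al' * d (m + y ** aa k) (expo (nn j)))
       + al' * (d m (expo (nn j)) + y (expo (nn j)) * d (aa k) (expo (nn j)))); last first.
      by rewrite dY; ring.
    rewrite (le_trans (normc_leD _ _))// lerD//; first by apply: HB'; exact: y4'.
    rewrite normcM ler_wpM2l ?normc_ge0// (le_trans (normc_leD _ _))// lerD//.
    exact: yd.
  + move=> y y4; set Y := m + y ** aa k.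
    have h1 := HB Y (y4' y y4).
    have h2 : (k%:R + B) / normc al < normc (d Y (expo (nn k))).
      rewrite /Y dY ak0 mulr0 add0r.
      apply: lt_le_trans (normc_leB _ _).
      by have := yd y (nn k) y4; lra.
    rewrite ltr_pdivrMr// mulrC -normcM in h2.
    have := normc_leB (al * d Y (expo (nn k))) (d (F Y) (expo (nn k)) - al * d Y (expo (nn k))).
    by rewrite [al * _ + _]addrC subrK; lra.
have [C C0 xC] := dual_bounded (d x).
have := Qx (Num.bound C); apply/negP; rewrite -leNgt (le_trans (dual_le_expo _ xC))//.
by rewrite ltW// archi_boundP.
Qed.

(** The functions g at which m |-> d m g is bounded on the unit ball form a subspace. It is closed:
    if h k tends to g, then d m (h k) is bounded in k for each m, since [d m] is a bounded
    functional, and uniform boundedness applies. So [expo_density] applies. *)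
Lemma derivation_ract_bounded f p (B : R) : (forall x : R, halfline x -> normc (p x) <= B) ->
  exists K, forall m, dual_le m 1 -> normc (d m (ract f p)) <= K.
Proof.
have [N HN] := derivation_expo_bounded.
apply: (@expo_density _ _ N (fun g => exists K, forall m, dual_le m 1 -> normc (d m g) <= K)) => //.
- by exists 0 => m _; rewrite dual0 normc0.
- move=> a g h [K HK] [L HL]; exists (normc a * K + L) => m m1.
  rewrite dual_lin (le_trans (normc_leD _ _))// lerD ?HL//.
  by rewrite normcM ler_wpM2l ?normc_ge0// HK.
move=> g gapp.
have e0 k : 0 < (k.+1%:R)^-1 :> R by rewrite invr_gt0.
pose h k : L0inf w := sval (cid2 (gapp _ (e0 k))).
have hW k : exists K, forall m, dual_le m 1 -> normc (d m (h k)) <= K := s2valP (cid2 (gapp _ (e0 k))).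
have hg k : wbounded w (fun x : R => g x - h k x) (k.+1%:R)^-1 := s2valP' (cid2 (gapp _ (e0 k))).
have dgh m C k : dual_le (d m) C -> normc (d m g - d m (h k)) <= C * (k.+1%:R)^-1.
  move=> mC; rewrite (_ : _ - _ = d m (-1 *: h k + g)); last by rewrite dual_lin mulN1r addrC.
  apply: mC; first exact: ltW.
  have := hg k; apply: ae_mono => y + hy => /(_ hy).
  by rewrite L0inf_linE mulN1r addrC.
have [|K HK] := @uniform_boundedness _ w nat (fun k m => d m (h k))
  (fun k => derivation_scalar_map (h k)) hW.
  move=> m; have [C C0 mC] := dual_bounded (d m).
  exists (normc (d m g) + C) => k; rewrite -[d m (h k)](subKr (d m g)).
  rewrite (le_trans (normc_leD _ _))// lerD// normcN (le_trans (dgh m C k mC))//.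
  by rewrite ler_piMr// invf_le1// ler1n.
exists K => m m1; have [C C0 mC] := dual_bounded (d m).
apply/ler_addgt0Pr => e e1.
have [k kE] : exists k : nat, C / e < k.+1%:R.
  exists (Num.bound (C / e)); have := archi_boundP (divr_ge0 C0 (ltW e1)).
  by move=> /lt_trans; apply; rewrite ltr_nat.
rewrite -[d m g](subrK (d m (h k))) addrC (le_trans (normc_leD _ _))// lerD ?HK//.
rewrite (le_trans (dgh m C k mC))// ler_pdivrMr// mulrC -ler_pdivrMr// ltW//.
Qed.

(** A second use of uniform boundedness, now over all f and p, makes the bound of the previous lemma
    proportional to the norms of f and p. In effect it bounds m |-> [u ** d m]. *)
Lemma arens_act_derivation_bounded : exists2 K, 0 <= K & forall m f M, dual_le m 1 ->
  0 <= M -> wbounded w f M -> wbounded w (arens_act (d m) f) (K * M).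
Proof.
(* Pairs (f, p) with positive bounds (M, I) on their norms, to normalize by M I; the cases M = 0 and
   I = 0 are settled separately below. *)
pose J := {t : L0inf w * L1 w * (R * R) | [/\ 0 < t.2.1, 0 < t.2.2,
  wbounded w t.1.1 t.2.1, (wnorm1 w t.1.2 <= t.2.2%:E)%E &
  exists B, forall x : R, halfline x -> normc (t.1.2 x) <= B]}.
pose phi (j : J) m : R[i] := ((sval j).2.1 * (sval j).2.2)^-1%:C * d m (ract (sval j).1.1 (sval j).1.2).
have [||m|K HK] := @uniform_boundedness _ w J phi.
- by move=> j a m n; rewrite /phi dlin dual_linE; ring.
- move=> j; case: (svalP j) => _ _ _ _ [B HB].
  have [K HK] := derivation_ract_bounded (sval j).1.1 HB.
  exists (normc (((sval j).2.1 * (sval j).2.2)^-1%:C : R[i]) * K) => m m1.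
  by rewrite normcM ler_wpM2l ?normc_ge0// HK.
- have [C C0 mC] := dual_bounded (d m); exists (2 * C) => j.
  case: (svalP j) => M0 I0 fM pI _; rewrite /phi normcM normc_real.
  rewrite gtr0_norm ?invr_gt0 ?mulr_gt0// mulrC ler_pdivrMr ?mulr_gt0// mulrA.
  by apply: dual_ract_le => //; exact: ltW.
have K0 : 0 <= Num.max K 0 by rewrite le_max lexx orbT.
exists (2 * Num.max K 0); first by rewrite mulr_ge0.
move=> m f M m1 M0 fM; rewrite -mulrA.
have [C C0 mC] := dual_bounded (d m).
have := ae_normc_le_of_cintegral_le (L0inf_norm_ge0 (arens_act (d m) f))
  (cmeasurable_L0inf _) (@L0inf_norm_wbounded _ _ (arens_act (d m) f))
  mH (@subset_refl _ _) (mulr_ge0 K0 M0).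
apply => E X p I mE _ EX pE pI; rewrite arens_actE.
have I0 : 0 <= I by rewrite -lee_fin (le_trans _ pI)// wnorm1_ge0//; exact: weight_ge0.
have le0 := dual_ract_le C0 mC M0 fM pI.
have [M00|M00] := eqVneq M 0.
  by rewrite M00 !mulr0 !mul0r in le0 *.
have [I00|I00] := eqVneq I 0.
  by rewrite I00 !mulr0 in le0 *.
have M1 : 0 < M by rewrite lt_neqAle eq_sym M00.
have I1 : 0 < I by rewrite lt_neqAle eq_sym I00.
have jP : [/\ 0 < M, 0 < I, wbounded w f M, (wnorm1 w p <= I%:E)%E &
    exists B, forall x : R, halfline x -> normc (p x) <= B].
  by split => //; exists 1 => x _; rewrite pE normc_ind indic_le1.
have := HK (exist _ (f, p, (M, I)) jP : J) m m1.
rewrite /phi /= normcM normc_real gtr0_norm ?invr_gt0 ?mulr_gt0//.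
rewrite mulrC ler_pdivrMr ?mulr_gt0// => /le_trans; apply.
by rewrite -mulrA ler_wpM2r ?mulr_ge0// le_max lexx.
Qed.

Lemma iter_derivationD r m n : iter r d (m + n) = iter r d m + iter r d n.
Proof. by elim: r => //= r ->; rewrite derivationD. Qed.

Lemma iter_derivation_mul r k m n : (forall i, (i < r)%N -> iter i d m (expo k) = 0) ->
  iter r d (m ** n) (expo k) = iter r d m (expo k) * n (expo k).
Proof.
elim: r m n => [|r IH] m n mi; first exact: expo_mult.
rewrite iterSr dmul iter_derivationD dualDE.
rewrite (IH (d m)); last by move=> i ir; rewrite -iterSr mi.
rewrite (IH m); last by move=> i ir; rewrite mi// ltnW.
by rewrite mi// mul0r addr0 -iterSr.
Qed.

(** In the Leibniz expansion at e_k only the r + 1 terms with exactly one derivative on n survive: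
    with more on n, the factor from m vanishes; with none, n does. *)
Lemma iter_derivation_mulS r k m n : (forall i, (i < r)%N -> iter i d m (expo k) = 0) ->
  n (expo k) = 0 ->
  iter r.+1 d (m ** n) (expo k) = r.+1%:R * (iter r d m (expo k) * d n (expo k)).
Proof.
elim: r m => [|r IH] m mi n0.
  by rewrite /= dmul dualDE !expo_mult n0 mulr0 add0r mul1r.
rewrite iterSr dmul iter_derivationD dualDE (@iter_derivation_mul r.+1 k m)//.
rewrite IH ?n0//; last by move=> i ir; rewrite -iterSr mi.
by rewrite -iterSr -[in RHS]addn1 natrD mulrDl mul1r.
Qed.

(** Otherwise the terms (z / t)^n / n! of a convergent exponential series would all be at least 1
    for n >= 1. *)
Lemma fact_exprn_le_eq0 (t z : R) : 0 <= t ->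
  (forall r, r.+1`!%:R * t ^+ r.+1 <= z ^+ r.+1) -> t = 0.
Proof.
move=> t0 H; apply/eqP; apply: contrapT => /negP tn0.
have t1 : 0 < t by rewrite lt_neqAle eq_sym tn0.
have := cvg_series_cvg_0 (@is_cvg_series_exp_coeff R (z / t)).
move=> /cvgrPdist_lt /(_ 1 ltr01) [N _ /(_ N.+1 (leqnSn N))].
rewrite /= sub0r normrN exp_coeffE /=.
apply/negP; rewrite -leNgt (le_trans _ (ler_norm _))//.
rewrite expr_div_n ler_pdivlMl ?ltr0n ?fact_gt0// mulr1.
by rewrite ler_pdivlMr ?exprn_gt0.
Qed.

Hypothesis dbounded : exists2 K : R, 0 <= K & forall m, dual_le m 1 -> dual_le (d m) K.

Lemma derivation_dual_le : exists2 K : R, 1 <= K &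
  forall m F, 0 < F -> dual_le m F -> dual_le (d m) (K * F).
Proof.
have [K K0 HK] := dbounded; exists (Num.max K 1); first by rewrite le_max lexx orbT.
move=> m F F0 mF f M M0 fM.
have HM m' : dual_le m' 1 -> normc (d m' f) <= Num.max K 1 * M.
  move=> /HK /(_ f M M0 fM) /le_trans; apply.
  by rewrite ler_wpM2r// le_max lexx.
by rewrite mulrAC; exact: (unit_ball_bound (derivation_scalar_map f) HM).
Qed.

(* d^(r+1) (m^(r+1)) takes at expo k the value (r+1)! (d m (expo k))^(r+1),
   which would outgrow the geometric bound on its norm. *)
Lemma derivation_expo_eq0_of_expo_eq0 k m : m (expo k) = 0 -> d m (expo k) = 0.
Proof.
move=> m0; have [K K1 HK] := derivation_dual_le.
have [C' C'0 mC'] := dual_bounded m.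
pose C := C' + 1; have C0 : 0 < C by rewrite ltr_wpDl.
have mC : dual_le m C by apply: dual_leS mC'; rewrite lerDl.
have K0 : 0 < K by rewrite (lt_le_trans ltr01).
(* The power m^(r+1), bracketed to the left. *)
pose pw r := iter r (fun x => x ** m) m.
have pwC r : dual_le (pw r) (C * (4 * C) ^+ r).
  elim: r => [|r IH]; first by rewrite expr0 mulr1.
  rewrite exprS (_ : C * _ = 4 * (C * (4 * C) ^+ r) * C); last by ring.
  by apply: arens_mul_le => //; exact: ltW.
have itC r x (F : R) : 0 < F -> dual_le x F -> dual_le (iter r d x) (K ^+ r * F).
  move=> F0 xF; elim: r => [|r IH]; first by rewrite expr0 mul1r.
  by rewrite exprS -mulrA /=; apply: HK => //; rewrite mulr_gt0// exprn_gt0.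
have pw0 r : (forall i, (i <= r)%N -> iter i d (pw r) (expo k) = 0) /\
    iter r.+1 d (pw r) (expo k) = r.+1`!%:R * d m (expo k) ^+ r.+1.
  elim: r => [|r [IH0 IH1]].
    by split; [move=> i; rewrite leqn0 => /eqP ->|rewrite /= mul1r expr1].
  split.
    move=> i ir; rewrite /= iter_derivation_mul ?m0 ?mulr0// => j ji.
    by apply: IH0; rewrite -ltnS (leq_trans ji).
  rewrite [pw r.+1]/(pw r ** m) iter_derivation_mulS// IH1 [in RHS]factS natrM.
  by rewrite [in RHS]exprSr; ring.
(* In the rate, 4 * C accounts for each factor of the power and K for each application of d. *)
apply: eq0_normc; apply: (@fact_exprn_le_eq0 _ (4 * C * K)); first exact: normc_ge0.
move=> r; have := (pw0 r).2 => E.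
have nX (z : R[i]) j : normc (z ^+ j) = normc z ^+ j.
  by elim: j => [|j IH]; rewrite ?expr0 ?normc1// !exprS normcM IH.
have nat_normc j : normc (j%:R : R[i]) = j%:R.
  by rewrite -(rmorph_nat (real_complex R)) normc_real ger0_norm.
rewrite -nX -nat_normc -normcM -E.
have CP : 0 < C * (4 * C) ^+ r by rewrite mulr_gt0// exprn_gt0// mulr_gt0.
rewrite (le_trans (dual_le_expo _ (itC r.+1 (pw r) _ CP (pwC r))))//.
rewrite [leRHS]exprMn mulrC ler_wpM2r ?exprn_ge0 ?(ltW K0)// exprS ler_wpM2r//.
  by rewrite exprn_ge0// mulr_ge0// ltW.
by rewrite ler_peMl ?(ltW C0)// ler1n.
Qed.

(** Subtracting m(e_k) u reduces to an element vanishing at e_k. This is harmless: u is idempotent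
    with u(e_k) = 1, so d(u)(e_k) equals twice itself. *)
Lemma derivation_expo_eq0 k m : d m (expo k) = 0.
Proof.
have [u uE] := @right_unit_ex R w.
have uk : u (expo k) = 1 by exact: right_unit_expo.
have du : d u (expo k) = 0.
  have := congr1 (fun x : A => x (expo k)) (dmul u u).
  rewrite uE dualDE !expo_mult uk mulr1 mul1r => /eqP.
  by rewrite -subr_eq0 opprD addrA subrr sub0r oppr_eq0 => /eqP.
have := @derivation_expo_eq0_of_expo_eq0 k (- m (expo k) *: u + m).
by rewrite dlin !dual_linE uk du mulr1 mulr0 add0r addNr => /(_ erefl).
Qed.

End derivation.

(** * Commuting generalized derivations and statement (iii) *)

Section commuting_generalized_derivation.
Context {R : realType} {w : weight R}.
Local Notation A := (L0inf_dual w).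
Implicit Types (f : L0inf w) (m n : A).

Lemma in_ranP m : in_ran m <-> forall k, m (expo k) = 0.
Proof.
split=> [mr k|m0]; last by apply: (@in_ran_of_expo _ _ 0) => k _; exact: m0.
have [u uE] := @right_unit_ex R w.
have := congr1 (fun x : A => x (expo k)) (mr u).
by rewrite expo_mult (right_unit_expo uE) mul1r.
Qed.

Variables D d : A -> A.
Hypothesis Dlin : forall (a : R[i]) m n, D (a *: m + n) = a *: D m + D n.
Hypothesis dlin : forall (a : R[i]) m n, d (a *: m + n) = a *: d m + d n.
Hypothesis dmul : forall m n, d (m ** n) = d m ** n + m ** d n.
Hypothesis DM : forall m n, D (m ** n) = m ** D n + d m ** n.
Hypothesis DC : forall m, D m ** m = m ** D m.

Lemma commuting_derivation_eq0 m : d m = 0.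
Proof.
have [u uE] := @right_unit_ex R w.
pose c := D u.
have cu : u ** c = c by rewrite -[RHS]uE DC.
(* Commutation at x + u, with D x = x ** c + d x. *)
have formula x : d x = u ** (x ** c) + u ** d x - c ** x.
  have Dx : D x = x ** c + d x by rewrite -[in LHS](uE x) DM uE.
  have := DC (x + u).
  rewrite (_ : D (x + u) = D x + c); last by rewrite -[x]scale1r Dlin !scale1r.
  rewrite !arens_mulDl !arens_mulDr (DC x) !uE -!addrA => /addrI.
  rewrite cu addrA [x ** c + _]addrC => E.
  have {E} : D x + c ** x = u ** D x + x ** c.
    by apply: (addIr c); rewrite -addrA E addrAC.
  rewrite Dx arens_mulDr -[X in X = _]addrA [X in X = _]addrC => /addIr.
  by move=> <-; rewrite addrK.
have [Cu Cu0 uC] := dual_bounded u; have [Cc Cc0 cC] := dual_bounded c.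
have dbounded : exists2 K : R, 0 <= K & forall x : A, dual_le x 1 -> dual_le (d x) K.
  have [K K0 HK] := arens_act_derivation_bounded dlin dmul.
  exists (4 * Cu * (4 * 1 * Cc) + Cu * K + 4 * Cc * 1); first by rewrite !addr_ge0// !mulr_ge0.
  move=> x x1; rewrite formula; apply: dual_leD; last first.
    by apply: dual_leN; exact: arens_mul_le.
  apply: dual_leD.
    by apply: arens_mul_le => //; [rewrite !mulr_ge0|exact: arens_mul_le].
  move=> f M M0 fM; rewrite arens_mulE -mulrA.
  by apply: uC; [rewrite mulr_ge0|exact: HK].
have dran x : in_ran (d x).
  by apply/in_ranP => k; exact: (derivation_expo_eq0 dlin dmul dbounded).
have dr0 r : in_ran r -> d r = 0.
  move=> rr; rewrite formula dran rr addr0 subr0.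
  (* All the characters vanish on r, hence on r ** c, so its left multiple by u is 0 too. *)
  suff : in_ran (r ** c) by move=> ->.
  by apply/in_ranP => k; rewrite expo_mult (in_ranP r).1// mul0r.
(* At u the formula reads c + 0 - c. *)
have du : d u = 0 by rewrite formula dran addr0 cu uE -/c cu subrr.
have -> : m = u ** m + (m - u ** m) by rewrite addrC subrK.
rewrite (derivationD dlin) dmul du dran arens_mul0l !add0r dr0//.
by apply/in_ranP => k; rewrite dualBE expo_mult (right_unit_expo uE) mul1r subrr.
Qed.

End commuting_generalized_derivation.

Theorem theorem2p1 (R : realType) (w : weight R)
    (theta D d : {linear L0inf_dual w -> L0inf_dual w}) :
  multiplicative_map theta ->
  theta_generalized_derivation theta D d ->
  [/\ (forall r : L0inf_dual w, in_ran r -> in_ran (D r)),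
      theta_centralizing theta D <-> theta_commuting theta D &
      bijective theta -> theta_centralizing theta D ->
        theta_right_centralizer theta D].
Proof.
move=> tM gder; split.
- exact: ran_preserved tM gder.
- exact: centralizing_commuting.
move=> [g tK gK] /centralizing_commuting DC.
have [dM DM] := gder.
have glin (a : R[i]) m n : g (a *: m + n) = a *: g m + g n.
  by apply: (can_inj tK); rewrite linearP !gK.
have gM m n : g (m ** n) = g m ** g n.
  by apply: (can_inj tK); rewrite tM !gK.
(* With g the inverse of theta, D after g and d after g satisfy the untwisted identities; d after g
   = 0 then means d = 0. *)
have dg0 : forall m, d (g m) = 0.
  apply: (@commuting_derivation_eq0 _ _ (fun m => D (g m)) (fun m => d (g m))).
  - by move=> a m n; rewrite glin linearP.
  - by move=> a m n; rewrite glin linearP.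
  - by move=> m n; rewrite gM dM !gK.
  - by move=> m n; rewrite gM DM !gK.
  - by move=> m; have := DC (g m); rewrite gK.
by move=> m n; rewrite DM -[m in d m]tK dg0 arens_mul0l addr0.
Qed.
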